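(* Let $s>1/2$. If $u_0\in G^{1,s+3}$, then there exists a positive time $T=T(u_0,s)$ such that for every $\delta\in(0,1)$, the Cauchy problem $$u_t+uu_x+\partial_xA^{-2}\Big[2\mu(u)u+\tfrac12u_x^2-3u_xu_{xxx}-\tfrac72u_{xx}^2\Big]=0,\qquad u(0,x)=u_0(x),$$ has a unique solution which is a holomorphic function valued in $G^{\delta,s+3}$ in the disk $D(0,T(1-\delta))$. Furthermore, the analytic lifespan $T$ satisfies, for $u_0\ne0$, $$T=\frac{\mathrm{const.}}{\|u_0\|_{1,s+3}},$$ where $\mathrm{const.}$ is a positive constant which does not depend on $u_0$ (it may depend on $s$).
   Context: $S^1=\mathbb R/\mathbb Z$; $L^2(S^1)$ denotes real-valued square-integrable functions; $\hat\varphi(k)=\int_{S^1}\varphi(x)e^{-2k\pi ix}\,dx$; $\langle k\rangle=(1+k^2)^{1/2}$. For $\delta\ge0,s\ge0$, $G^{\delta,s}=\{\varphi\in L^2(S^1):\|\varphi\|_{\delta,s}<\infty\}$ with $\|\varphi\|_{\delta,s}^2=\sum_{k\in\mathbb Z}\langle k\rangle^{2s}e^{4\pi\delta|k|}|\hat\varphi(k)|^2$. $\mu(\varphi)=\int_{S^1}\varphi\,dx$ (integration in $x$), $A(\varphi)=\mu(\varphi)-\varphi_{xx}$, whose inverse is $A^{-1}(\varphi)=\hat\varphi(0)+\sum_{k\ne0}\frac{\hat\varphi(k)}{(2\pi k)^2}e^{2k\pi ix}$, and $A^{-2}=A^{-1}\circ A^{-1}$. $D(0,r)=\{t\in\mathbb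 C:|t|<r\}$. For complex $t$ the values of a holomorphic function of $t$ are taken in the complexification of $G^{\delta,s+3}$ (complex-valued functions, same norm), with $\mu$, $A^{-2}$, $\partial_x$ and products extended by the same formulas. *)

(* Defs.v *)
From mathcomp Require Export all_boot all_order all_algebra.
From mathcomp Require Export complex.
From mathcomp Require Export all_classical all_reals all_analysis.

Export Order.TTheory GRing.Theory Num.Theory.
Export numFieldNormedType.Exports.
Export ComplexField.Normc.

#[export] Set Implicit Arguments.
#[export] Unset Strict Implicit.
#[export] Unset Printing Implicit Defensive.

Local Open Scope classical_set_scope.
Local Open Scope ring_scope.
Local Open Scope complex_scope.

(* A function on the circle S^1 = R/Z is a 1-periodic function on R; an element
   of L^2(S^1) is such a function taken up to equality almost everywhere, so
   every identity between elements of L^2(S^1) below is an [ae] equality.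
   The values are complex; a real-valued g : R -> R enters as [realfun g].
   [normc] is the modulus as an element of R. *)

Section Circle.
Context {R : realType}.
Implicit Types (f g : R -> R[i]) (phi : R -> R) (delta s : R) (k : int).

Definition realfun phi : R -> R[i] := fun x => (phi x)%:C.

Definition circ_int f : R[i] :=
  (\int[lebesgue_measure]_(x in `[0, 1]) complex.Re (f x)) +i*
  (\int[lebesgue_measure]_(x in `[0, 1]) complex.Im (f x)).

Definition L2circle f : Prop :=
  [/\ periodic f 1,
      measurable_fun setT (fun x => complex.Re (f x)),
      measurable_fun setT (fun x => complex.Im (f x)) &
      (\int[lebesgue_measure]_(x in `[0%R, 1%R]) (normc (f x) ^+ 2)%:E < +oo)%E].

(* e^{2 k pi i x} *)
Definition fexp k (x : R) : R[i] :=
  cos (2 * k%:~R * pi * x) +i* sin (2 * k%:~R * pi * x).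

Definition fcoef f k : R[i] := circ_int (fun x => f x * fexp (- k) x).

Definition japanese k : R := Num.sqrt (1 + k%:~R ^+ 2).

(* The norm takes the value +oo exactly when the defining series diverges. *)
Definition Gnorm delta s f : \bar R :=
  ((\esum_(k in [set: int])
      (japanese k `^ (2 * s) * expR (4 * pi * delta * `|k%:~R|)
        * normc (fcoef f k) ^+ 2)%:E) `^ 2^-1)%E.

(* The complexification of G^{delta,s}; G^{delta,s} itself consists of the
   phi : R -> R with [inG delta s (realfun phi)]. *)
Definition inG delta s f : Prop := L2circle f /\ (Gnorm delta s f < +oo)%E.

Definition test_function phi : Prop :=
  periodic phi 1 /\ forall (n : nat) (x : R), derivable (derive1n n phi) x 1.

Definition weak_derivative f g : Prop :=
  L2circle g /\
  forall phi, test_function phi ->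
    circ_int (fun x => f x * (derive1 phi x)%:C) =
    - circ_int (fun x => g x * (phi x)%:C).

(* The derivative in x of a class in L^2(S^1): a representative of the weak
   derivative, which is unique up to [ae] equality; 0 when there is none. *)
Definition dx f : R -> R[i] := xget (fun=> 0) [set g | weak_derivative f g].

(* The series over k <> 0 is summed by grouping k = n and k = - n, n >= 1;
   it converges absolutely for every integrable f. *)
Definition Ainv_psum f (x : R) (N : nat) : R[i] :=
  fcoef f 0 +
  \sum_(1 <= n < N.+1)
    (fcoef f n%:Z * fexp n%:Z x + fcoef f (- n%:Z) * fexp (- n%:Z) x)
      / ((2 * pi * n%:R) ^+ 2)%:C.

Definition Ainv f : R -> R[i] := fun x =>
  limn (fun N => complex.Re (Ainv_psum f x N)) +i*
  limn (fun N => complex.Im (Ainv_psum f x N)).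

Definition nonlocal_arg f : R -> R[i] := fun x =>
  2 * circ_int f * f x + 1 / 2 * dx f x ^+ 2
  - 3 * dx f x * dx (dx (dx f)) x - 7 / 2 * dx (dx f) x ^+ 2.

(* v is the derivative at t of u with respect to the complex variable, in the
   complexification of G^{delta,s}. *)
Definition Gderiv delta s (u : R[i] -> R -> R[i]) (t : R[i]) (v : R -> R[i]) :
    Prop :=
  inG delta s v /\
  forall e : R, 0 < e -> exists2 d : R, 0 < d &
    forall h : R[i], h != 0 -> normc h < d ->
      (Gnorm delta s (fun x => h^-1 * (u (t + h) x - u t x) - v x)%R < e%:E)%E.

Definition Gholomorphic delta s (r : R) (u : R[i] -> R -> R[i]) : Prop :=
  forall t : R[i], normc t < r ->
    inG delta s (u t) /\ exists v, Gderiv delta s u t v.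

Definition cauchy_solution delta s (r : R) (u0 : R -> R)
    (u : R[i] -> R -> R[i]) : Prop :=
  u 0 = realfun u0 %[ae lebesgue_measure] /\
  forall t : R[i], normc t < r -> exists2 ut, Gderiv delta s u t ut &
    (fun x => ut x + u t x * dx (u t) x
              + dx (Ainv (Ainv (nonlocal_arg (u t)))) x)
    = (fun=> 0) %[ae lebesgue_measure].

Definition holomorphic_solution delta s (r : R) (u0 : R -> R)
    (u : R[i] -> R -> R[i]) : Prop :=
  Gholomorphic delta s r u /\ cauchy_solution delta s r u0 u.

End Circle.

(* Main.v *)
Require Import Defs.
From mathcomp Require Import measurable_realfun.
From mathcomp Require Import ring lra zify.

Local Open Scope classical_set_scope.
Local Open Scope ring_scope.
Local Open Scope complex_scope.

(** On Fourier coefficients the Cauchy problem reads [a'(t) = Q (a(t)) (a(t))], where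
   [Q] is the quadratic form obtained from [u u_x] and the nonlocal term.  The operator
   [d/dx A^-2] has a symbol of size [|k|^-3], so it absorbs the derivatives in the
   bracket, and only the factor [u_x] of [u u_x] costs one derivative.  Coefficient
   sequences are measured by the weights [wgt d k = (1+|k|)^-3 exp(-2 pi d |k|)].  These
   weights are stable under convolution, and one derivative is paid for by decreasing
   the radius from [d] to [d'], with a factor [1/(d - d')].  This gives the basic
   estimate [Q_wbound]: bounds [A] and [B] at radius [d] turn into the bound
   [C A B / (d - d')] at radius [d'].

   Existence.  A power series [sum_n t^n u_n] solves the equation if and only if
   [(n+1) u_(n+1) = sum_(i <= n) Q u_i u_(n-i)].  By induction, if [u_0] is bounded by
   [r] at radius 1, then [u_n] is bounded at every radius [d < 1] by
   [r (K r / (1 - d))^n / (n+1)^2] ([taylor_wbound]): spending [(1-d)/(n+2)] of the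
   radius costs only a bounded multiple of [n+1] ([shrink_radius]), the factor [1/(n+1)]
   of the recursion pays for it, and [1/(n+1)^2] is stable under convolution.  So the
   series converges for [|t| < (1 - d) / (K r)].  Since the disk is open, there is room
   for a slightly larger radius [d1 > d] at each of its points, and a weighted
   supremum bound at radius [d1] dominates the norm of [G^(d,s)] ([Gnorm_le]).
   Conversely the norm of [u_0] in [G^(1,s+3)] dominates the weighted supremum
   ([Gnorm_wbound]), which makes [r] proportional to that norm and the lifespan inversely
   proportional to it.

   From coefficients to functions.  A function [f] satisfies [has_coefs f a] when it equals almost
   everywhere the sum of an exponentially decaying Fourier series with coefficients [a].
   This relation is compatible with sums, products (convolution), weak derivatives and
   [A^-1], so the equation for functions is the equation for coefficients
   ([has_coefs_equation]).  Passing from equality of coefficients to equality almost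
   everywhere is the completeness of the exponentials, [fcoef0_ae].

   Uniqueness.  For two solutions, follow their coefficients along the segment from [0]
   to [t].  As long as they coincide at a point and are bounded by [M] near it, their
   difference satisfies a linear differential inequality that loses radius; iterating
   it [n] times while splitting the radius into [n] parts gives a bound
   [2 M (L (x - x0) / d)^n] ([gap_iterate]), so the difference vanishes on a whole
   interval.  A supremum argument carries the equality along the segment. *)

(** * Complex sequences, series and sums over the integers *)

Section ComplexSeries.
Context {R : realType}.
Implicit Types (z : R[i]).

Lemma normc_ge0 z : 0 <= normc z.
Proof. by case: z => a b; exact: sqrtr_ge0. Qed.

Lemma normcB z1 z2 : normc (z1 - z2) <= normc z1 + normc z2.
Proof. by rewrite -(normcN z2); exact: le_normcD. Qed.

Lemma normc_distC z1 z2 : normc (z1 - z2) = normc (z2 - z1).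
Proof. by rewrite -opprB normcN. Qed.

Lemma normcX z n : normc (z ^+ n) = normc z ^+ n.
Proof. by elim: n => [|n IH]; rewrite ?expr0 ?normc1// !exprS normcM IH. Qed.

Lemma normcR (x : R) : normc x%:C = `|x|.
Proof. by rewrite /normc /= expr0n /= addr0 sqrtr_sqr. Qed.

Lemma normc_nat n : normc (n%:R : R[i]) = n%:R.
Proof. by rewrite -(rmorph_nat (real_complex R)) normcR normr_nat. Qed.

Lemma normc_conj z : normc (conjc z) = normc z.
Proof. by case: z => a b; rewrite /normc /= sqrrN. Qed.

Lemma normc_sum (I : Type) (r : seq I) (P : pred I) (F : I -> R[i]) :
  normc (\sum_(i <- r | P i) F i) <= \sum_(i <- r | P i) normc (F i).
Proof.
elim/big_rec2: _ => [|i y1 y2 _ h]; first by rewrite normc0.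
by apply: le_trans (le_normcD _ _) _; rewrite lerD2l.
Qed.

Lemma Re_le_normc z : `|complex.Re z| <= normc z.
Proof.
case: z => a b /=; rewrite -sqrtr_sqr ler_sqrt ?addr_ge0 ?sqr_ge0//.
by rewrite lerDl sqr_ge0.
Qed.

Lemma Im_le_normc z : `|complex.Im z| <= normc z.
Proof.
case: z => a b /=; rewrite -sqrtr_sqr ler_sqrt ?addr_ge0 ?sqr_ge0//.
by rewrite lerDr sqr_ge0.
Qed.

Lemma normc_le_ReIm z : normc z <= `|complex.Re z| + `|complex.Im z|.
Proof.
rewrite {1}[z]complexE; apply: le_trans (le_normcD _ _) _.
by rewrite normcM !normcR {1}/normc expr0n/= expr1n add0r sqrtr1 mul1r.
Qed.

Lemma normc_eq0 z : (normc z == 0) = (z == 0).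
Proof.
by apply/eqP/eqP => [/eq0_normc//|->]; rewrite normc0.
Qed.

Lemma normc_gt0 z : (0 < normc z) = (z != 0).
Proof. by rewrite lt_neqAle normc_ge0 andbT eq_sym normc_eq0. Qed.

Definition cvgc (S : nat -> R[i]) (l : R[i]) := normc (S n - l) @[n --> \oo] --> (0:R).

Lemma ReD z1 z2 : complex.Re (z1 + z2) = complex.Re z1 + complex.Re z2.
Proof. by case: z1 z2 => [a b] []. Qed.
Lemma ImD z1 z2 : complex.Im (z1 + z2) = complex.Im z1 + complex.Im z2.
Proof. by case: z1 z2 => [a b] []. Qed.
Lemma ReN z : complex.Re (- z) = - complex.Re z.
Proof. by case: z. Qed.
Lemma ImN z : complex.Im (- z) = - complex.Im z.
Proof. by case: z. Qed.
Lemma ReM z1 z2 : complex.Re (z1 * z2) =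
  complex.Re z1 * complex.Re z2 - complex.Im z1 * complex.Im z2.
Proof. by case: z1 z2 => [a b] []. Qed.
Lemma ImM z1 z2 : complex.Im (z1 * z2) =
  complex.Re z1 * complex.Im z2 + complex.Im z1 * complex.Re z2.
Proof. by case: z1 z2 => [a b] []. Qed.

Lemma Re_sum (I : Type) (r : seq I) (P : pred I) (F : I -> R[i]) :
  complex.Re (\sum_(i <- r | P i) F i) = \sum_(i <- r | P i) complex.Re (F i).
Proof. by apply: (big_morph _ ReD). Qed.
Lemma Im_sum (I : Type) (r : seq I) (P : pred I) (F : I -> R[i]) :
  complex.Im (\sum_(i <- r | P i) F i) = \sum_(i <- r | P i) complex.Im (F i).
Proof. by apply: (big_morph _ ImD). Qed.

Lemma cvgcP (S : nat -> R[i]) l :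
  (complex.Re (S n) @[n --> \oo] --> complex.Re l) ->
  (complex.Im (S n) @[n --> \oo] --> complex.Im l) -> cvgc S l.
Proof.
move=> hr hi.
have h : (`|complex.Re (S n) - complex.Re l| +
  `|complex.Im (S n) - complex.Im l|) @[n --> \oo] --> (0:R).
  rewrite -(addr0 0); apply: cvgD; rewrite -(normr0 R); apply: cvg_norm;
  by apply/subr_cvg0.
apply: (squeeze_cvgr _ (cvg_cst 0) h); apply: nearW => n.
rewrite normc_ge0 /=; apply: le_trans (normc_le_ReIm _) _.
by rewrite ReD ImD ReN ImN.
Qed.

Lemma cvgc_ReIm (S : nat -> R[i]) l : cvgc S l ->
  (complex.Re (S n) @[n --> \oo] --> complex.Re l) /\
  (complex.Im (S n) @[n --> \oo] --> complex.Im l).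
Proof.
move=> h; split; apply/subr_cvg0; apply/norm_cvg0P;
apply: (squeeze_cvgr _ (cvg_cst 0) h); apply: nearW => n; rewrite normr_ge0 /=.
- by rewrite -ReN -ReD Re_le_normc.
- by rewrite -ImN -ImD Im_le_normc.
Qed.

Lemma cvgc_unique (S : nat -> R[i]) l1 l2 : cvgc S l1 -> cvgc S l2 -> l1 = l2.
Proof.
move=> /cvgc_ReIm[a b] /cvgc_ReIm[c d]; apply/eqP; rewrite eq_complex.
by rewrite (cvg_unique _ a c)// (cvg_unique _ b d)// !eqxx.
Qed.

Lemma cvgc_ub (S : nat -> R[i]) l z M : cvgc S l ->
  (forall n, normc (S n - z) <= M) -> normc (l - z) <= M.
Proof.
move=> h hM; apply/ler_addgt0Pl => e e0.
have [N _ HN] : \forall n \near \oo, normc (S n - l) < e.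
  by move/cvgrPdist_lt: h => /(_ _ e0); apply: filterS => n;
   rewrite sub0r normrN ger0_norm ?normc_ge0.
have := HN N (leqnn N) => /= h1.
have -> : l - z = (l - S N) + (S N - z) by ring.
apply: le_trans (le_normcD _ _) _; rewrite lerD// normc_distC; exact: ltW.
Qed.

(** Real and imaginary limits are total functions, so that [csum] is defined for every
   sequence; it is only meaningful under a bound such as [asum]. *)
Definition csum (F : nat -> R[i]) : R[i] :=
  limn (fun N => complex.Re (\sum_(n < N) F n)) +i*
  limn (fun N => complex.Im (\sum_(n < N) F n)).

(** A quantitative form of absolute convergence: the bound [M] is kept because it also
   bounds the sum. *)
Definition asum (F : nat -> R[i]) (M : R) :=
  forall N, \sum_(n < N) normc (F n) <= M.

Lemma csumP (F : nat -> R[i]) l : cvgc (fun N => \sum_(n < N) F n) l -> csum F = l.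
Proof.
move=> /cvgc_ReIm[a b]; rewrite /csum; case: l a b => x y /= a b.
by congr (_ +i* _); apply/cvg_lim.
Qed.

Lemma asum_cvg_real (f : nat -> R) (M : R) :
  (forall N, \sum_(n < N) `|f n| <= M) -> cvgn (fun N => \sum_(n < N) f n).
Proof.
move=> h.
have := @normed_cvg R R^o f.
have e1 : (fun N => \sum_(n < N) f n) = series (f : nat -> R^o).
  by apply/funext => N; rewrite /series /= big_mkord.
have e2 : [normed series (f : nat -> R^o)] = (fun N => \sum_(n < N) `|f n|).
  by apply/funext => N; rewrite /= /series /= big_mkord.
rewrite e2 -e1; apply; apply: nondecreasing_is_cvgn.
  move=> n m nm; rewrite -(subnKC nm) big_split_ord /= lerDl.
  by apply: sumr_ge0.
by exists M => _ [n _ <-].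
Qed.

Lemma csum_cvg (F : nat -> R[i]) M : asum F M -> cvgc (fun N => \sum_(n < N) F n) (csum F).
Proof.
move=> h; apply: cvgcP; rewrite /csum /=.
- under eq_fun do rewrite Re_sum.
  apply: (asum_cvg_real (M := M) (f := fun n => complex.Re (F n))) => N.
  by apply: le_trans (h N); apply: ler_sum => i _; exact: Re_le_normc.
- under eq_fun do rewrite Im_sum.
  apply: (asum_cvg_real (M := M) (f := fun n => complex.Im (F n))) => N.
  by apply: le_trans (h N); apply: ler_sum => i _; exact: Im_le_normc.
Qed.

(** Any bound on the blocks following [N] bounds the remainder, whatever its origin:
   this is how uniform convergence rates are obtained. *)
Lemma csum_tail (F : nat -> R[i]) M N B : asum F M ->
  (forall K, \sum_(N <= n < N + K) normc (F n) <= B) ->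
  normc (csum F - \sum_(n < N) F n) <= B.
Proof.
move=> hM hB; have hc := csum_cvg hM.
have hs : cvgc (fun K => \sum_(n < N + K) F n) (csum F).
  have := hc; rewrite /cvgc -(cvg_shiftn N) /=.
  by under eq_fun do rewrite addnC.
apply: (cvgc_ub hs) => K.
apply: le_trans (hB K).
rewrite -!(big_mkord xpredT F) (big_cat_nat (n := N)) ?leq_addr//=.
by rewrite addrAC subrr add0r normc_sum.
Qed.

Lemma csum_le (F : nat -> R[i]) M : asum F M -> normc (csum F) <= M.
Proof.
move=> h; have := @csum_tail F M 0 M h; rewrite big_ord0 subr0; apply => K.
by rewrite add0n big_mkord.
Qed.

Lemma cvgcD S1 S2 l1 l2 : cvgc S1 l1 -> cvgc S2 l2 ->
  cvgc (fun n => S1 n + S2 n) (l1 + l2).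
Proof.
move=> h1 h2; have h : normc (S1 n - l1) + normc (S2 n - l2) @[n --> \oo] --> (0:R).
  by rewrite -(addr0 0); apply: cvgD.
apply: (squeeze_cvgr _ (cvg_cst (0:R)) h); apply: nearW => n.
rewrite normc_ge0 /=.
by have -> : S1 n + S2 n - (l1 + l2) = (S1 n - l1) + (S2 n - l2); [ring|exact: le_normcD].
Qed.

Lemma cvgcZ c S l : cvgc S l -> cvgc (fun n => c * S n) (c * l).
Proof.
move=> h; have h1 : normc c * normc (S n - l) @[n --> \oo] --> normc c * (0:R).
  by apply: cvgM h; exact: cvg_cst.
by move: h1; rewrite mulr0 /cvgc; under eq_fun do rewrite -normcM mulrBr.
Qed.

(** * Sums over the integers *)

(** Summing over the integers shell by shell is the
   grouping of [k] with [- k] that the definition of [Ainv] uses. *)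
Definition shell (n : nat) : seq int := if n is 0%N then [:: 0] else [:: n%:Z; - n%:Z].
Definition window (N : nat) : seq int := flatten [seq shell n | n <- iota 0 N].

Lemma mem_shell n j : (j \in shell n) = (absz j == n).
Proof.
case: n => [|n]; rewrite !inE ?absz_eq0//.
by apply/idP/idP; lia.
Qed.

Lemma mem_window N j : (j \in window N) = (absz j < N)%N.
Proof.
apply/flattenP/idP => [[s /mapP[n + ->]]|h].
  by rewrite mem_iota mem_shell add0n => + /eqP ->.
exists (shell (absz j)); last by rewrite mem_shell.
by apply/mapP; exists (absz j); rewrite // mem_iota add0n.
Qed.

Lemma windowS N : window N.+1 = window N ++ shell N.
Proof. by rewrite /window -(addn1 N) iotaD map_cat flatten_cat /= cats0 add0n. Qed.

Lemma uniq_window N : uniq (window N).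
Proof.
elim: N => [//|N IH]; rewrite windowS cat_uniq IH /=; apply/andP; split.
  by apply/hasPn => j; rewrite mem_shell mem_window => /eqP ->; rewrite ltnn.
by case: N {IH} => [//|N]; apply/andP; split.
Qed.

Definition shell_sum (F : int -> R[i]) (n : nat) : R[i] := \sum_(j <- shell n) F j.
Definition zsum (F : int -> R[i]) : R[i] := csum (shell_sum F).
(** Bounding the sums over arbitrary duplicate-free lists makes the notion independent of
   the order of summation, hence invariant under translation and reflection. *)
Definition zasum (F : int -> R[i]) (M : R) :=
  forall s : seq int, uniq s -> \sum_(j <- s) normc (F j) <= M.

Lemma shell_sum_window (V : nmodType) (F : int -> V) N :
  \sum_(n < N) \sum_(j <- shell n) F j = \sum_(j <- window N) F j.
Proof.
elim: N => [|N IH]; first by rewrite big_ord0 big_nil.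
by rewrite big_ord_recr /= IH windowS big_cat.
Qed.

Lemma zasum_asum (F : int -> R[i]) M : zasum F M -> asum (shell_sum F) M.
Proof.
move=> h N; apply: le_trans (h _ (uniq_window N)).
rewrite -shell_sum_window; apply: ler_sum => n _; exact: normc_sum.
Qed.

Lemma zsum_le (F : int -> R[i]) M : zasum F M -> normc (zsum F) <= M.
Proof. by move=> /zasum_asum/csum_le. Qed.

Lemma zsum_cvg (F : int -> R[i]) M : zasum F M -> cvgc (fun N => \sum_(j <- window N) F j) (zsum F).
Proof.
move=> /zasum_asum/csum_cvg; rewrite /zsum.
by under eq_fun do rewrite shell_sum_window.
Qed.

Lemma zsumP (F : int -> R[i]) l : cvgc (fun N => \sum_(j <- window N) F j) l -> zsum F = l.
Proof. by move=> h; apply: csumP; under eq_fun do rewrite shell_sum_window. Qed.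

Lemma zasumW (F G : int -> R[i]) M : zasum G M -> (forall j, normc (F j) <= normc (G j)) -> zasum F M.
Proof. by move=> h FG s us; apply: le_trans (h s us); apply: ler_sum. Qed.

Lemma zsumD (F1 F2 : int -> R[i]) M1 M2 : zasum F1 M1 -> zasum F2 M2 ->
  zsum (fun n => F1 n + F2 n) = zsum F1 + zsum F2.
Proof.
move=> /zsum_cvg h1 /zsum_cvg h2; apply: zsumP.
by under eq_fun do rewrite big_split /=; apply: cvgcD.
Qed.

Lemma zsumZ c (F : int -> R[i]) M : zasum F M -> zsum (fun n => c * F n) = c * zsum F.
Proof.
move=> /zsum_cvg h; apply: zsumP.
by under eq_fun do rewrite -mulr_sumr /=; apply: cvgcZ.
Qed.

Lemma zsum0 : zsum (fun=> 0) = 0.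
Proof.
apply: zsumP; rewrite /cvgc; under eq_fun do rewrite big1 // subr0 normc0.
exact: cvg_cst.
Qed.

Lemma zsum_single k (F : int -> R[i]) : (forall j, j != k -> F j = 0) -> zsum F = F k.
Proof.
move=> h; apply: zsumP; rewrite /cvgc; apply: cvg_near_cst.
exists (absz k).+1 => // N /= hN.
rewrite (bigD1_seq k) /= ?uniq_window ?mem_window// big1 ?addr0 ?subrr ?normc0//.
Qed.

Lemma zsum_reflect (F : int -> R[i]) M : zasum F M -> zsum (fun j => conjc (F (- j))) = conjc (zsum F).
Proof.
move=> /zsum_cvg h; apply: zsumP.
have -> : (fun N => \sum_(j <- window N) (F (- j))^*) =
          (fun N => conjc (\sum_(j <- window N) F j)).
  apply/funext => N; rewrite rmorph_sum /=.
  have -> : \sum_(j <- window N) (F (- j))^* = \sum_(j <- map -%R (window N)) (F j)^*.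
    by rewrite big_map.
  apply: perm_big; apply: uniq_perm.
  - by rewrite map_inj_uniq ?uniq_window//; exact: oppr_inj.
  - exact: uniq_window.
  - move=> j; rewrite mem_window -[j]opprK mem_map; last exact: oppr_inj.
    by rewrite mem_window abszN opprK.
by rewrite /cvgc; under eq_fun do rewrite -rmorphB /= normc_conj.
Qed.

(** A substitute for the Japanese bracket that is linear in [|k|]; both differ by at most
   a factor 2. *)
Definition bracket (k : int) : R := 1 + (absz k)%:R.

Lemma bracket_ge1 k : 1 <= bracket k.
Proof. by rewrite lerDl. Qed.
Lemma bracket_gt0 k : 0 < bracket k.
Proof. exact: lt_le_trans (bracket_ge1 k). Qed.

(** Telescoping: [1/(n+1)^2 <= 1/n - 1/(n+1)]. *)
Lemma sum_inv_sqr_le (N : nat) : \sum_(1 <= n < N) ((n%:R + 1) ^- 2 : R) <= 1 - N%:R^-1 \/ N = 0%N.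
Proof.
case: N => [|N]; [by right|left].
elim: N => [|N IH]; first by rewrite big_geq// invr1 subrr.
rewrite big_nat_recr //= -(subrK (N.+1%:R^-1) (1 - N.+2%:R^-1)).
apply: le_trans (lerD IH (lexx _)) _.
have h1 : (0:R) < N.+1%:R by rewrite ltr0n.
have h2 : (0:R) < N.+2%:R by rewrite ltr0n.
have e : N.+2%:R = N.+1%:R + 1 :> R by rewrite -natr1.
have : (N.+1%:R + 1) ^- 2 <= N.+1%:R^-1 - N.+2%:R^-1 :> R.
  have -> : N.+1%:R^-1 - N.+2%:R^-1 = (N.+1%:R * N.+2%:R)^-1 :> R.
    rewrite e; move: h1; set a := _%:R => a0; field.
    by apply/andP; split; apply: lt0r_neq0; lra.
  rewrite e lef_pV2 ?posrE; [|nra|nra].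
  nra.
by move: (_ ^- 2) (N.+1%:R^-1) (N.+2%:R^-1) => x y z; lra.
Qed.

Lemma sum_bracketV2 (s : seq int) : uniq s -> \sum_(j <- s) (bracket j ^- 2) <= 3.
Proof.
(* enlarge [s] to a window, which contains 0 once and every other modulus twice *)
move=> us; pose N := (\max_(j <- s) absz j).+1.
have hs : {subset s <= window N}.
  move=> j js; rewrite mem_window ltnS.
  by rewrite (big_rem j)//= leq_maxl.
have : \sum_(j <- s) (bracket j ^- 2) <= \sum_(j <- window N) (bracket j ^- 2).
  have -> : \sum_(j <- s) (bracket j ^- 2) = \sum_(j <- window N | j \in s) (bracket j ^- 2).
    rewrite -[RHS]big_filter; apply: perm_big; apply: uniq_perm => //.
      by rewrite filter_uniq// uniq_window.
    move=> j; rewrite mem_filter; case js: (j \in s) => //=; by rewrite hs.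
  rewrite [leLHS]big_mkcond /=; apply: ler_sum => j _.
  by case: ifP => // _; rewrite invr_ge0 exprn_ge0// ltW// bracket_gt0.
move=> /le_trans; apply; rewrite -shell_sum_window.
rewrite -(big_mkord xpredT (fun n => \sum_(j <- shell n) bracket j ^- 2)) big_ltn// /= big_seq1 {1}/bracket /= addr0 expr1n invr1.
have -> : \sum_(1 <= i < N) \sum_(j <- shell i) bracket j ^- 2 =
  2 * \sum_(1 <= n < N) ((n%:R + 1) ^- 2 : R).
  rewrite mulr_sumr; apply: eq_big_nat => -[//|n] _.
  by rewrite /= !big_cons big_nil addr0 /bracket abszN /= addrC [1 + _]addrC; ring.
have [h|//] := sum_inv_sqr_le N.
have : 0 <= N%:R^-1 :> R by rewrite invr_ge0.
lra.
Qed.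

Lemma sum_bracketV2_shift (k : int) (s : seq int) : uniq s ->
  \sum_(j <- s) (bracket (k - j) ^- 2) <= 3.
Proof.
move=> us; have -> : \sum_(j <- s) bracket (k - j) ^- 2 = \sum_(j <- map
  (fun j => k - j) s) bracket j ^- 2.
  by rewrite big_map.
apply: sum_bracketV2; rewrite map_inj_uniq// => i j /addrI/oppr_inj//.
Qed.

End ComplexSeries.

(** * The quadratic form of the equation on Fourier coefficients *)

Section QuadraticForm.
Context {R : realType}.
Implicit Types (a b : int -> R[i]) (k j l : int) (A B : R).

Definition absr k : R := (absz k)%:R.

Lemma bracketE k : bracket k = 1 + absr k. Proof. by []. Qed.
Lemma absr_ge0 k : 0 <= absr k. Proof. by rewrite /absr. Qed.
Lemma absrN k : absr (- k) = absr k. Proof. by rewrite /absr abszN. Qed.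
Lemma absr_split k j : absr k <= absr j + absr (k - j).
Proof. by rewrite /absr -natrD ler_nat; lia. Qed.
Lemma normr_intr k : `|k%:~R : R| = absr k.
Proof. by rewrite -intr_norm /absr natr_absz. Qed.

(** Locked, since otherwise conversion unfolds the definition of [pi]. *)
Definition twopi : R := locked (2 * pi).
Lemma twopiE : twopi = 2 * pi. Proof. by rewrite /twopi -lock. Qed.
Lemma twopi_ge1 : 1 <= twopi.
Proof. rewrite twopiE; have := pi_ge2 R; lra. Qed.
Lemma twopi_gt0 : 0 < twopi. Proof. exact: lt_le_trans twopi_ge1. Qed.
Lemma twopi_ge0 : 0 <= twopi. Proof. exact: ltW twopi_gt0. Qed.

Definition expw (d : R) k : R := expR (- (twopi * d * absr k)).
(** The cubic factor makes three derivatives of a sequence bounded by [wgt] still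
   convolvable with a summable one; this matches the term [u_x u_xxx]. *)
Definition wgt (d : R) k : R := bracket k ^- 3 * expw d k.

Lemma expw_gt0 d k : 0 < expw d k. Proof. exact: expR_gt0. Qed.

(** The triangle inequality [|k| <= |j| + |k - j|]: exponential weights are submultiplicative
   along convolution, hence no radius is lost in a product. *)
Lemma expw_split d k j : 0 <= d -> expw d j * expw d (k - j) <= expw d k.
Proof.
move=> d0; rewrite /expw -expRD ler_expR -opprD lerN2 -mulrDr.
by apply: ler_wpM2l (absr_split _ _); rewrite mulr_ge0// twopi_ge0.
Qed.

Lemma expw0 k : expw 0 k = 1.
Proof. by rewrite /expw mulr0 mul0r oppr0 expR0. Qed.

Lemma expw_anti d d' k : d' <= d -> expw d k <= expw d' k.
Proof.
move=> h; rewrite /expw ler_expR lerN2 ler_wpM2r ?absr_ge0// ler_wpM2l//.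
by rewrite twopi_ge0.
Qed.

Lemma expw_le1 d k : 0 <= d -> expw d k <= 1.
Proof. by move=> d0; rewrite -(expw0 k); exact: expw_anti. Qed.

Lemma bracketXV_ge0 k n : 0 <= bracket k ^- n :> R.
Proof. by rewrite invr_ge0 exprn_ge0// ltW// bracket_gt0. Qed.

Lemma bracketXV_gt0 k n : 0 < bracket k ^- n :> R.
Proof. by rewrite invr_gt0 exprn_gt0// bracket_gt0. Qed.

Lemma bracketXV_le1 k n : bracket k ^- n <= 1 :> R.
Proof. by rewrite invf_le1 ?exprn_gt0 ?bracket_gt0// exprn_ege1// bracket_ge1. Qed.

Lemma wgt_gt0 d k : 0 < wgt d k.
Proof. by rewrite mulr_gt0 ?bracketXV_gt0 ?expw_gt0. Qed.

Lemma wgt_anti d d' k : d' <= d -> wgt d k <= wgt d' k.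
Proof. by move=> h; rewrite ler_wpM2l ?bracketXV_ge0// expw_anti. Qed.

Definition dx_symbol k : R[i] := 0 +i* (twopi * k%:~R).
Definition dx_coef a : int -> R[i] := fun k => dx_symbol k * a k.
Definition conv a b k : R[i] := zsum (fun j => a j * b (k - j)).
Definition Ainv_symbol k : R[i] :=
  if k == 0 then 1 else (((twopi * absr k) ^+ 2)%:C)^-1.
Definition nonlocal_coef a b k : R[i] :=
  2 * a 0 * b k + 1 / 2 * conv (dx_coef a) (dx_coef b) k
  - 3 * conv (dx_coef a) (dx_coef (dx_coef (dx_coef b))) k - 7 / 2 * conv (dx_coef (dx_coef a))
    (dx_coef (dx_coef b)) k.
(** The right-hand side of the equation, polarised so that the power series recursion and
   differences of solutions can be treated by bilinearity. *)
Definition Q a b k : R[i] :=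
  - (conv a (dx_coef b) k + dx_symbol k * (Ainv_symbol k * (Ainv_symbol k * nonlocal_coef a b k))).

Lemma normc_dx_symbol k : normc (dx_symbol k) = twopi * absr k.
Proof.
rewrite /normc /= expr0n /= add0r sqrtr_sqr normrM normr_intr.
by rewrite ger0_norm// twopi_ge0.
Qed.

(** The symbol is of order [1 - 4 = -3].  This gain compensates the cubic factor that is
   missing in [nonlocal_est]. *)
Lemma normc_dx_Ainv2 k : normc (dx_symbol k * (Ainv_symbol k * Ainv_symbol k)) <= 8 * bracket k ^- 3.
Proof.
rewrite /Ainv_symbol; case: eqP => [->|k0].
  by rewrite !mulr1 normc_dx_symbol /absr absz0 mulr0 mulr_ge0// bracketXV_ge0.
have az1 : 1 <= absr k by rewrite /absr -[1]/(1%:R) ler_nat lt0n absz_eq0; apply/eqP.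
have p1 := twopi_ge1; have p0 := twopi_ge0.
rewrite !normcM normcV normcR normc_dx_symbol ger0_norm; last by rewrite exprn_ge0//; nra.
rewrite bracketE; move: (absr k) az1 => x x1.
move: twopi p1 p0 => p p1 p0.
have px : 1 <= p * x by nra.
have -> : p * x * ((p * x) ^- 2 * (p * x) ^- 2) = ((p * x) ^+ 3)^-1.
  by field; apply/andP; split; apply: lt0r_neq0; lra.
have -> : 8 * (1 + x) ^- 3 = (((1 + x) / 2) ^+ 3)^-1.
  by field; apply: lt0r_neq0; lra.
rewrite lef_pV2 ?posrE ?exprn_gt0//; [|lra|lra].
apply: lerXn2r; rewrite ?nnegrE; [lra|lra|nra].
Qed.

(** The common pattern of the product estimates: the exponential factors are handled by
   [expw_split], and the algebraic factors [f] and [g] must be dominated by two summable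
   families, one in [j] and one in [k - j]. *)
Lemma conv_est k (f g : int -> R) c d a b : 0 <= d -> 0 <= c ->
  (forall j, 0 <= f j) -> (forall j, 0 <= g j) ->
  (forall j, normc (a j) <= f j * expw d j) ->
  (forall j, normc (b j) <= g j * expw d j) ->
  (forall j, f j * g (k - j) <= c * (bracket j ^- 2 + bracket (k - j) ^- 2)) ->
  zasum (fun j => a j * b (k - j)) (6 * c * expw d k).
Proof.
move=> d0 c0 f0 g0 ha hb hfg s us.
apply: (@le_trans _ _ (\sum_(j <- s) c * expw d k * (bracket j ^- 2 + bracket (k - j) ^- 2))).
  apply: ler_sum => j _; rewrite normcM.
  apply: le_trans (ler_pM (normc_ge0 _) (normc_ge0 _) (ha j) (hb (k - j))) _.
  rewrite mulrACA.
  apply: (@le_trans _ _ (c * (bracket j ^- 2 + bracket (k - j) ^- 2) * expw d k)).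
    apply: ler_pM (hfg j) (expw_split _ _ d0); first exact: mulr_ge0.
    by rewrite mulr_ge0// ltW// expw_gt0.
  by rewrite mulrAC.
rewrite -mulr_sumr big_split /=.
have := sum_bracketV2 us (R := R); have := sum_bracketV2_shift k us (R := R).
move: (\sum_(_ <- _) _) (\sum_(_ <- _) _) => x y hx hy.
have := mulr_ge0 c0 (ltW (expw_gt0 d k)); rewrite -(mulrA 6); move: (c * _) => z z0; nra.
Qed.

Definition wbound (d A : R) a := forall k, normc (a k) <= A * wgt d k.

Lemma wbound_ge0 d A a : wbound d A a -> 0 <= A.
Proof.
move=> /(_ 0) h; have := le_trans (normc_ge0 _) h.
by rewrite pmulr_lge0// wgt_gt0.
Qed.

Lemma wboundW d d' A A' a : d' <= d -> A <= A' -> wbound d A a -> wbound d' A' a.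
Proof.
move=> hd hA h k; have A0 := wbound_ge0 h; apply: le_trans (h k) _.
by apply: ler_pM => //; [exact/ltW/wgt_gt0|exact: wgt_anti].
Qed.

(** A derivative costs one power of the bracket. *)
Lemma dx_coef_est (g : R) d n a : 0 <= g ->
  (forall k, normc (a k) <= g * bracket k ^- n.+1 * expw d k) ->
  forall k, normc (dx_coef a k) <= twopi * g * bracket k ^- n * expw d k.
Proof.
move=> g0 h k; rewrite /dx_coef normcM normc_dx_symbol.
have p1 := twopi_ge1; have p0 := twopi_ge0.
have -> : twopi * g * bracket k ^- n * expw d k =
   (twopi * bracket k) * (g * bracket k ^- n.+1 * expw d k).
  rewrite exprS; field; rewrite expf_neq0 ?gt_eqF ?bracket_gt0//.
apply: ler_pM => //; first by rewrite mulr_ge0 ?absr_ge0//; lra.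
- exact: normc_ge0.
- apply: ler_wpM2l; first lra.
  by rewrite bracketE; lra.
Qed.

Section bounds.
Variables (d A B : R) (a b : int -> R[i]).
Hypotheses (d0 : 0 <= d) (ha : wbound d A a) (hb : wbound d B b).
Let A0 : 0 <= A. Proof. exact: wbound_ge0 ha. Qed.
Let B0 : 0 <= B. Proof. exact: wbound_ge0 hb. Qed.
Local Notation P := twopi.
Let P1 : 1 <= P. Proof. exact: twopi_ge1. Qed.

Let P0 : 0 <= P. Proof. exact: le_trans P1. Qed.
Let ha3 k : normc (a k) <= A * bracket k ^- 3 * expw d k.
Proof. by rewrite -mulrA; exact: ha. Qed.
Let hb3 k : normc (b k) <= B * bracket k ^- 3 * expw d k.
Proof. by rewrite -mulrA; exact: hb. Qed.
Let ha2 k : normc (dx_coef a k) <= P * A * bracket k ^- 2 * expw d k.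
Proof. exact: (dx_coef_est A0 ha3). Qed.
Let hb2 k : normc (dx_coef b k) <= P * B * bracket k ^- 2 * expw d k.
Proof. exact: (dx_coef_est B0 hb3). Qed.
Let PA0 : 0 <= P * A. Proof. exact: mulr_ge0. Qed.
Let PB0 : 0 <= P * B. Proof. exact: mulr_ge0. Qed.
Let ha1 k : normc (dx_coef (dx_coef a) k) <= P * (P * A) * bracket k ^- 1 * expw d k.
Proof. exact: (dx_coef_est PA0 ha2). Qed.
Let hb1 k : normc (dx_coef (dx_coef b) k) <= P * (P * B) * bracket k ^- 1 * expw d k.
Proof. exact: (dx_coef_est PB0 hb2). Qed.
Let PPB0 : 0 <= P * (P * B). Proof. exact: mulr_ge0. Qed.
Let hb0 k : normc (dx_coef (dx_coef (dx_coef b)) k) <= P * (P * (P * B)) * bracket k ^- 0 * expw d k.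
Proof. exact: (dx_coef_est PPB0 hb1). Qed.

Let P4 : 1 <= P ^+ 4. Proof. by rewrite exprn_ege1. Qed.
Let P24 : P ^+ 2 <= P ^+ 4. Proof. by rewrite ler_weXn2l. Qed.

Let AB0 : 0 <= A * B. Proof. exact: mulr_ge0. Qed.
Let C0 : 0 <= P ^+ 4 * (A * B). Proof. by apply: mulr_ge0 AB0; exact: exprn_ge0. Qed.

Lemma conv_dx1_dx1 k : zasum (fun j => dx_coef a j * dx_coef b (k - j)) (6 * (P ^+ 4 * (A * B)) *
  expw d k).
Proof.
apply: (conv_est (f := fun j => P * A * bracket j ^- 2) (g := fun j => P * B * bracket j ^- 2)) => //.
- by move=> j; rewrite mulr_ge0// bracketXV_ge0.
- by move=> j; rewrite mulr_ge0// bracketXV_ge0.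
- move=> j; have := bracketXV_ge0 j 2; have := bracketXV_ge0 (k - j) 2; have := bracketXV_le1 (k - j) 2.
  move: (bracket j ^- 2) (bracket (k - j) ^- 2) => x y y1 y0 x0.
  have -> : P * A * x * (P * B * y) = P ^+ 2 * (A * B) * (x * y) by ring.
  have xy : x * y <= x + y by nra.
  have h1 : P ^+ 2 * (A * B) <= P ^+ 4 * (A * B) by exact: ler_wpM2r.
  by apply: ler_pM h1 xy; rewrite mulr_ge0 ?sqr_ge0.
Qed.

Lemma conv_dx1_dx3 k : zasum (fun j => dx_coef a j * dx_coef (dx_coef (dx_coef b)) (k - j)) (6 *
  (P ^+ 4 * (A * B)) * expw d k).
Proof.
apply: (conv_est (f := fun j => P * A * bracket j ^- 2)
   (g := fun j => P * (P * (P * B)) * bracket j ^- 0)) => //.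
- by move=> j; rewrite mulr_ge0// bracketXV_ge0.
- by move=> j; rewrite mulr_ge0// ?bracketXV_ge0// mulr_ge0//; lra.
- move=> j; have := bracketXV_ge0 j 2; have := bracketXV_ge0 (k - j) 2.
  rewrite expr0 invr1 mulr1; move: (bracket j ^- 2) (bracket (k - j) ^- 2) => x y y0 x0.
  have -> : P * A * x * (P * (P * (P * B))) = P ^+ 4 * (A * B) * x by ring.
  by apply: ler_wpM2l => //; lra.
Qed.

Lemma conv_dx2_dx2 k : zasum (fun j => dx_coef (dx_coef a) j * dx_coef (dx_coef b) (k - j)) (6 *
  (P ^+ 4 * (A * B)) * expw d k).
Proof.
apply: (conv_est (f := fun j => P * (P * A) * bracket j ^- 1) (g :=
  fun j => P * (P * B) * bracket j ^- 1)) => //.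
- by move=> j; rewrite mulr_ge0 ?bracketXV_ge0// mulr_ge0//; lra.
- by move=> j; rewrite mulr_ge0 ?bracketXV_ge0.
- move=> j; rewrite !expr1 -!exprVn; move: (bracket j)^-1 (bracket (k - j))^-1 => x y.
  have -> : P * (P * A) * x * (P * (P * B) * y) = P ^+ 4 * (A * B) * (x * y) by ring.
  by apply: ler_wpM2l => //; nra.
Qed.

Lemma conv_dx0_dx1 k : zasum (fun j => a j * dx_coef b (k - j)) (6 * (P * (A * B)) * expw d k).
Proof.
apply: (conv_est (f := fun j => A * bracket j ^- 3) (g := fun j => P * B * bracket j ^- 2)) => //.
- exact: mulr_ge0.
- by move=> j; rewrite mulr_ge0 ?bracketXV_ge0.
- by move=> j; rewrite mulr_ge0 ?bracketXV_ge0.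
- move=> j; have -> : A * bracket j ^- 3 * (P * B * bracket (k - j) ^- 2) =
    P * (A * B) * (bracket j ^- 3 * bracket (k - j) ^- 2) by ring.
  apply: ler_wpM2l; first exact: mulr_ge0.
  have := bracketXV_ge0 j 3; have := bracketXV_le1 j 3; have := bracketXV_ge0 (k - j) 2;
    have := bracketXV_ge0 j 2.
  move: (bracket j ^- 2) (bracket j ^- 3) (bracket (k - j) ^- 2) => x y z; nra.
Qed.

(** With [z <= x + y] for the three brackets, convexity gives [z^3 <= 4 (x^3 + y^3)]; dividing
   by [x^3 y^3 z^3] leaves a single inverse cube, which is summable, next to [z^-3]. *)
Lemma bracketV3_conv k j : bracket j ^- 3 * bracket (k - j) ^- 3 <= 4 * bracket k ^- 3 *
  (bracket j ^- 2 + bracket (k - j) ^- 2) :> R.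
Proof.
have b1 := bracket_gt0 j (R := R); have b2 := bracket_gt0 (k - j) (R := R).
have b3 := bracket_gt0 k (R := R).
have g1 := bracket_ge1 j (R := R); have g2 := bracket_ge1 (k - j) (R := R).
have g3 := bracket_ge1 k (R := R).
have h : @bracket R k <= bracket j + bracket (k - j) by have := absr_split k j; rewrite !bracketE; lra.
move: (bracket j) (bracket (k - j)) (bracket k) b1 b2 b3 g1 g2 g3 h => x y z x0 y0 z0 x1 y1 z1 h.
have hz : z ^+ 3 <= 4 * (x ^+ 3 + y ^+ 3).
  apply: (@le_trans _ _ ((x + y) ^+ 3)); first by apply: lerXn2r; rewrite ?nnegrE; lra.
  have : 0 <= (x + y) * (x - y) ^+ 2 by apply: mulr_ge0; [lra|exact: sqr_ge0].
  nra.
have -> : 4 * z ^- 3 * (x ^- 2 + y ^- 2) =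
  x ^- 3 * y ^- 3 * (z ^- 3 * (4 * (x * y ^+ 3 + x ^+ 3 * y))).
  by field; do !(apply/andP; split); apply: lt0r_neq0.
rewrite -[leLHS]mulr1; apply: ler_wpM2l.
  by rewrite mulr_ge0// invr_ge0 exprn_ge0// ltW.
rewrite -(ler_pM2l (exprn_gt0 3 z0)) mulr1 mulrA divff ?mul1r; last by rewrite expf_neq0// gt_eqF.
apply: le_trans hz _.
have : 0 <= y ^+ 3 by rewrite exprn_ge0// ltW.
have : 0 <= x ^+ 3 by rewrite exprn_ge0// ltW.
move: (x ^+ 3) (y ^+ 3) => X Y; nra.
Qed.

(** From [x exp(-x) <= 1]: one power of the bracket is paid for with a piece [g] of the
   exponential weight. *)
Lemma bracket_loss (g : R) k : 0 < g -> bracket k * expR (- (g * absr k)) <= 1 + g^-1.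
Proof.
move=> g0; rewrite bracketE mulrDl mul1r.
have a0 := absr_ge0 k.
have e1 : expR (- (g * absr k)) <= 1 by rewrite -expR0 ler_expR oppr_le0 mulr_ge0// ltW.
apply: lerD => //.
rewrite expRN -(ler_pM2l g0) divff ?gt_eqF// mulrA ler_pdivrMr ?expR_gt0// mul1r.
have := expR_ge1Dx (g * absr k); lra.
Qed.

(** The only term in which a derivative is lost for good.  A cubic factor
   in the result requires one on both arguments, and [dx_coef b] has only a square; the
   derivative is traded for radius by [bracket_loss]. *)
Lemma conv_dx0_dx1_loss d' k : 0 <= d' -> d' < d -> d <= 1 ->
  zasum (fun j => a j * dx_coef b (k - j)) (6 * (8 * P / (d - d') * (A * B) * bracket k ^- 3) *
    expw d' k).
Proof.
move=> d'0 dd d1.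
have pi2 := pi_ge2 R.
have g0 : 0 < d - d' by lra.
apply: (conv_est (f := fun j => A * bracket j ^- 3) (g := fun j => 2 * P / (d - d') * B *
  bracket j ^- 3)) => //.
- rewrite !mulr_ge0 ?bracketXV_ge0 ?invr_ge0//; lra.
- by move=> j; rewrite mulr_ge0 ?bracketXV_ge0.
- by move=> j; rewrite !mulr_ge0 ?bracketXV_ge0 ?invr_ge0//; lra.
- move=> j; apply: le_trans (ha3 j) _; apply: ler_wpM2l; first by rewrite mulr_ge0 ?bracketXV_ge0.
  exact/expw_anti/ltW.
- move=> j; apply: le_trans (hb2 j) _.
  have -> : expw d j = expR (- (twopi * (d - d') * absr j)) * expw d' j.
    by rewrite /expw -expRD; congr expR; ring.
  rewrite !mulrA; apply: ler_wpM2r; first exact/ltW/expw_gt0.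
  have := @bracket_loss (twopi * (d - d')) j; set E := expR _ => hE.
  have {}hE : bracket j * E <= 2 / (d - d').
    apply: (le_trans (hE _)); first exact: mulr_gt0 twopi_gt0 g0.
    have -> : 2 / (d - d') = (d - d')^-1 + (d - d')^-1 by field; rewrite gt_eqF.
    apply: lerD; first by rewrite invf_ge1//; lra.
    rewrite lef_pV2 ?posrE//; last exact: mulr_gt0 twopi_gt0 g0.
    by rewrite -[leLHS]mul1r; apply: ler_wpM2r => //; exact: ltW.
  have -> : twopi * B * bracket j ^- 2 * E = P * B * bracket j ^- 3 * (bracket j * E).
    by field; rewrite gt_eqF// bracket_gt0.
  have -> : 2 * P / (d - d') * B * bracket j ^- 3 = P * B * bracket j ^- 3 * (2 / (d - d')).
    by ring.
  by apply: ler_wpM2l => //; rewrite mulr_ge0 ?bracketXV_ge0.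
- move=> j.
  have -> : A * bracket j ^- 3 * (2 * P / (d - d') * B * bracket (k - j) ^- 3) =
    2 * P / (d - d') * (A * B) * (bracket j ^- 3 * bracket (k - j) ^- 3) by ring.
  have -> : 8 * P / (d - d') * (A * B) * bracket k ^- 3 * (bracket j ^- 2 + bracket (k - j) ^- 2) =
    2 * P / (d - d') * (A * B) * (4 * bracket k ^- 3 * (bracket j ^- 2 + bracket (k - j) ^- 2)) by ring.
  apply: ler_wpM2l (bracketV3_conv _ _).
  by rewrite !mulr_ge0 ?invr_ge0//; lra.
Qed.

(** Without the cubic factor: the third derivative in [u_x u_xxx] uses it up. *)
Lemma nonlocal_est k : normc (nonlocal_coef a b k) <= 44 * (P ^+ 4 * (A * B)) * expw d k.
Proof.
have h1 := zsum_le (conv_dx1_dx1 k); have h2 := zsum_le (conv_dx1_dx3 k);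
  have h3 := zsum_le (conv_dx2_dx2 k).
have h0 : normc (2 * a 0 * b k) <= 2 * (P ^+ 4 * (A * B)) * expw d k.
  have X0 : 0 <= A * (B * expw d k) by rewrite !mulr_ge0// ltW// expw_gt0.
  have -> : 2 * (P ^+ 4 * (A * B)) * expw d k = 2 * (P ^+ 4 * (A * (B * expw d k))) by ring.
  rewrite !normcM normc_nat -mulrA; apply: ler_wpM2l => //.
  apply: (@le_trans _ _ (A * (B * expw d k))); last by rewrite -[leLHS]mul1r; apply: ler_wpM2r.
  apply: ler_pM; rewrite ?normc_ge0//.
    apply: le_trans (ha 0) _; rewrite -[leRHS]mulr1; apply: ler_wpM2l => //.
    by rewrite /wgt /expw /bracket /absr absz0 mulr0 oppr0 expR0 addr0 expr1n invr1 mulr1.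
  apply: le_trans (hb k) _; apply: ler_wpM2l => //.
  by rewrite -[leRHS]mul1r; apply: ler_wpM2r (bracketXV_le1 _ _); exact/ltW/expw_gt0.
rewrite /nonlocal_coef.
apply: le_trans (normcB _ _) _.
apply: le_trans (lerD (normcB _ _) (lexx _)) _.
apply: le_trans (lerD (lerD (le_normcD _ _) (lexx _)) (lexx _)) _.
rewrite [normc (1 / 2 * _)]normcM [normc (3 * _)]normcM [normc (7 / 2 * _)]normcM.
rewrite !normcM !normcV !normc_nat normc1.
move: h1 h2 h3 h0; rewrite !normcM !normc_nat /conv; lra.
Qed.

Lemma Q_est d' : 0 <= d' -> d' < d -> d <= 1 ->
  wbound d' ((48 * P + 352 * P ^+ 4) / (d - d') * (A * B)) (Q a b).
Proof.
move=> d'0 dd d1 k; rewrite /Q normcN.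
apply: le_trans (le_normcD _ _) _.
have h1 := zsum_le (conv_dx0_dx1_loss k d'0 dd d1).
have h2 : normc (dx_symbol k * (Ainv_symbol k * (Ainv_symbol k * nonlocal_coef a b k))) <=
   352 * P ^+ 4 / (d - d') * (A * B) * wgt d' k.
  rewrite (mulrA (Ainv_symbol k)) (mulrA (dx_symbol k)) normcM.
  apply: le_trans (ler_pM (normc_ge0 _) (normc_ge0 _) (normc_dx_Ainv2 k) (nonlocal_est k)) _.
  have -> : 8 * bracket k ^- 3 * (44 * (P ^+ 4 * (A * B)) * expw d k) =
     352 * P ^+ 4 * (A * B) * (bracket k ^- 3 * expw d k) by ring.
  have -> : 352 * P ^+ 4 / (d - d') * (A * B) * wgt d' k =
     352 * P ^+ 4 * (A * B) * (wgt d' k / (d - d')) by ring.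
  apply: ler_wpM2l; first by rewrite -mulrA; apply: mulr_ge0 (ler0n _ _) C0.
  rewrite -[leLHS]mulr1; apply: ler_pM => //.
  - by rewrite mulr_ge0 ?bracketXV_ge0// ltW ?expw_gt0.
  - exact/wgt_anti/ltW.
  - by rewrite invf_ge1; lra.
apply: le_trans (lerD h1 h2) _.
by rewrite le_eqVlt; apply/orP; left; apply/eqP; rewrite /wgt; ring.
Qed.

End bounds.

Definition Qconst : R := 48 * twopi + 352 * twopi ^+ 4.

Lemma Qconst_ge1 : 1 <= Qconst.
Proof.
have h := twopi_ge1; have : 0 <= (twopi) ^+ 4 by rewrite exprn_ge0//; lra.
by rewrite /Qconst; lra.
Qed.

(** The Cauchy-Kovalevskaya type estimate on which existence and uniqueness rest. *)
Lemma Q_wbound d d' A B a b : 0 <= d' -> d' < d -> d <= 1 -> wbound d A a -> wbound d B b ->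
  wbound d' (Qconst / (d - d') * (A * B)) (Q a b).
Proof. by move=> h0 h1 h2 h3 h4; apply: (Q_est _ h3 h4) => //; lra. Qed.

(** * Bilinearity and Hermitian symmetry *)

(** The weakest bound under which all the sums in [Q] converge absolutely; bilinearity and
   symmetry are proved under it. *)
Definition cubic_decay a := exists A, wbound 0 A a.

Lemma wbound_decay d A a : 0 <= d -> wbound d A a -> cubic_decay a.
Proof. by move=> d0 h; exists A; apply: wboundW h. Qed.

Lemma wboundD d A B a b : wbound d A a -> wbound d B b -> wbound d (A + B) (fun k => a k + b k).
Proof.
by move=> h1 h2 k; apply: le_trans (le_normcD _ _) _; rewrite mulrDl lerD.
Qed.

Lemma wboundZ d A a c : wbound d A a -> wbound d (normc c * A) (fun k => c * a k).
Proof. by move=> h k; rewrite normcM -mulrA ler_wpM2l// normc_ge0. Qed.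

Lemma wbound0 d : wbound d 0 (fun=> 0).
Proof. by move=> k; rewrite normc0 mul0r. Qed.

Lemma cubic_decayZ a c : cubic_decay a -> cubic_decay (fun k => c * a k).
Proof. by move=> [A h1]; exists (normc c * A); exact: wboundZ. Qed.
Lemma cubic_decay_sum (I : Type) (r : seq I) (y : I -> int -> R[i]) :
  (forall i, cubic_decay (y i)) -> cubic_decay (fun k => \sum_(i <- r) y i k).
Proof.
move=> h; elim: r => [|i r [A IH]].
  by exists 0 => k; rewrite big_nil normc0 mul0r.
have [B hB] := h i; exists (B + A) => k; rewrite big_cons.
exact: (wboundD hB IH k).
Qed.

Lemma convDl a1 a2 b k M1 M2 : zasum (fun j => a1 j * b (k - j)) M1 ->
  zasum (fun j => a2 j * b (k - j)) M2 ->
  conv (fun j => a1 j + a2 j) b k = conv a1 b k + conv a2 b k.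
Proof.
move=> h1 h2; rewrite /conv -(zsumD h1 h2); congr zsum.
by apply/funext => j; rewrite mulrDl.
Qed.

Lemma convDr a b1 b2 k M1 M2 : zasum (fun j => a j * b1 (k - j)) M1 ->
  zasum (fun j => a j * b2 (k - j)) M2 ->
  conv a (fun j => b1 j + b2 j) k = conv a b1 k + conv a b2 k.
Proof.
move=> h1 h2; rewrite /conv -(zsumD h1 h2); congr zsum.
by apply/funext => j; rewrite mulrDr.
Qed.

Lemma convZl c a b k M : zasum (fun j => a j * b (k - j)) M ->
  conv (fun j => c * a j) b k = c * conv a b k.
Proof.
move=> h; rewrite /conv -(zsumZ c h); congr zsum.
by apply/funext => j; rewrite mulrA.
Qed.

Lemma convZr c a b k M : zasum (fun j => a j * b (k - j)) M ->
  conv a (fun j => c * b j) k = c * conv a b k.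
Proof.
move=> h; rewrite /conv -(zsumZ c h); congr zsum.
by apply/funext => j; rewrite mulrCA.
Qed.

Lemma dx_coefD a b : dx_coef (fun k => a k + b k) = fun k => dx_coef a k + dx_coef b k.
Proof. by apply/funext => k; rewrite /dx_coef mulrDr. Qed.
Lemma dx_coefZ c a : dx_coef (fun k => c * a k) = fun k => c * dx_coef a k.
Proof. by apply/funext => k; rewrite /dx_coef mulrCA. Qed.

Lemma QDl a1 a2 b k : cubic_decay a1 -> cubic_decay a2 -> cubic_decay b ->
  Q (fun j => a1 j + a2 j) b k = Q a1 b k + Q a2 b k.
Proof.
move=> [A1 h1] [A2 h2] [B hb]; rewrite /Q /nonlocal_coef !dx_coefD.
have l := lexx (0 : R).
rewrite (convDl (conv_dx0_dx1 l h1 hb k) (conv_dx0_dx1 l h2 hb k)).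
rewrite (convDl (conv_dx1_dx1 l h1 hb k) (conv_dx1_dx1 l h2 hb k)).
rewrite (convDl (conv_dx1_dx3 l h1 hb k) (conv_dx1_dx3 l h2 hb k)).
rewrite (convDl (conv_dx2_dx2 l h1 hb k) (conv_dx2_dx2 l h2 hb k)).
ring.
Qed.

Lemma QDr a b1 b2 k : cubic_decay a -> cubic_decay b1 -> cubic_decay b2 ->
  Q a (fun j => b1 j + b2 j) k = Q a b1 k + Q a b2 k.
Proof.
move=> [A ha] [A1 h1] [A2 h2]; rewrite /Q /nonlocal_coef !dx_coefD.
have l := lexx (0 : R).
rewrite (convDr (conv_dx0_dx1 l ha h1 k) (conv_dx0_dx1 l ha h2 k)).
rewrite (convDr (conv_dx1_dx1 l ha h1 k) (conv_dx1_dx1 l ha h2 k)).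
rewrite (convDr (conv_dx1_dx3 l ha h1 k) (conv_dx1_dx3 l ha h2 k)).
rewrite (convDr (conv_dx2_dx2 l ha h1 k) (conv_dx2_dx2 l ha h2 k)).
ring.
Qed.

Lemma QZl c a b k : cubic_decay a -> cubic_decay b -> Q (fun j => c * a j) b k = c * Q a b k.
Proof.
move=> [A ha] [B hb]; rewrite /Q /nonlocal_coef !dx_coefZ.
have l := lexx (0 : R).
rewrite (convZl c (conv_dx0_dx1 l ha hb k)) (convZl c (conv_dx1_dx1 l ha hb k)).
rewrite (convZl c (conv_dx1_dx3 l ha hb k)) (convZl c (conv_dx2_dx2 l ha hb k)).
ring.
Qed.

Lemma QZr c a b k : cubic_decay a -> cubic_decay b -> Q a (fun j => c * b j) k = c * Q a b k.
Proof.
move=> [A ha] [B hb]; rewrite /Q /nonlocal_coef !dx_coefZ.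
have l := lexx (0 : R).
rewrite (convZr c (conv_dx0_dx1 l ha hb k)) (convZr c (conv_dx1_dx1 l ha hb k)).
rewrite (convZr c (conv_dx1_dx3 l ha hb k)) (convZr c (conv_dx2_dx2 l ha hb k)).
ring.
Qed.

Lemma QBl a1 a2 b k : cubic_decay a1 -> cubic_decay a2 -> cubic_decay b ->
  Q (fun j => a1 j - a2 j) b k = Q a1 b k - Q a2 b k.
Proof.
move=> h1 h2 hb; rewrite -(mulN1r (Q a2 b k)) -(QZl (-1)) // -QDl //; last exact: cubic_decayZ.
have -> // : (fun j => a1 j - a2 j) = (fun j => a1 j + -1 * a2 j).
by apply/funext => j; rewrite mulN1r.
Qed.

Lemma QBr a b1 b2 k : cubic_decay a -> cubic_decay b1 -> cubic_decay b2 ->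
  Q a (fun j => b1 j - b2 j) k = Q a b1 k - Q a b2 k.
Proof.
move=> h1 h2 hb; rewrite -(mulN1r (Q a b2 k)) -(QZr (-1)) // -QDr //; last exact: cubic_decayZ.
have -> // : (fun j => b1 j - b2 j) = (fun j => b1 j + -1 * b2 j).
by apply/funext => j; rewrite mulN1r.
Qed.

Lemma cubic_decay0 : cubic_decay (fun=> 0).
Proof. by exists 0; exact: wbound0. Qed.

Lemma Q0l b k : cubic_decay b -> Q (fun=> 0) b k = 0.
Proof.
move=> h; transitivity (Q (fun j => 0 * (fun=> 0) j) b k).
  by congr (Q _ b k); apply/funext => j; rewrite mul0r.
by rewrite (QZl 0 k cubic_decay0 h) [LHS]mul0r.
Qed.

Lemma Q0r a k : cubic_decay a -> Q a (fun=> 0) k = 0.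
Proof.
move=> h; transitivity (Q a (fun j => 0 * (fun=> 0) j) k).
  by congr (Q a _ k); apply/funext => j; rewrite mul0r.
by rewrite (QZr 0 k h cubic_decay0) [LHS]mul0r.
Qed.

Lemma Qsuml (I : Type) (r : seq I) (y : I -> int -> R[i]) b k :
  (forall i, cubic_decay (y i)) -> cubic_decay b ->
  Q (fun j => \sum_(i <- r) y i j) b k = \sum_(i <- r) Q (y i) b k.
Proof.
move=> hy hb; elim: r => [|i r IH].
  have -> : (fun j => \sum_(i <- [::]) y i j) = (fun=> 0).
    by apply/funext => j; rewrite big_nil.
  by rewrite big_nil Q0l.
rewrite big_cons -IH -QDl //; last exact: cubic_decay_sum.
have -> // : (fun j => \sum_(i0 <- i :: r) y i0 j) = (fun j => y i j + \sum_(i0 <- r) y i0 j).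
by apply/funext => j; rewrite big_cons.
Qed.

Lemma conjcD (x y : R[i]) : conjc (x + y) = conjc x + conjc y.
Proof. exact: rmorphD. Qed.
Lemma conjcM (x y : R[i]) : conjc (x * y) = conjc x * conjc y.
Proof. exact: rmorphM. Qed.
Lemma conjcN (x : R[i]) : conjc (- x) = - conjc x.
Proof. exact: rmorphN. Qed.

(** The symmetry of the Fourier coefficients of a real-valued function. *)
Definition hermitian a := forall k, a (- k) = conjc (a k).

Lemma hermitian_dx a : hermitian a -> hermitian (dx_coef a).
Proof.
move=> h k; rewrite /dx_coef h rmorphM /=; congr (_ * _).
by rewrite /dx_symbol /= intrN mulrN.
Qed.

Lemma hermitian_conv a b M k : hermitian a -> hermitian b ->
  zasum (fun j => a j * b (k - j)) M -> conv a b (- k) = conjc (conv a b k).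
Proof.
move=> ha hb h; rewrite /conv -(zsum_reflect h); congr zsum.
apply/funext => j; rewrite rmorphM /= ha conjcK; congr (_ * _).
by rewrite -hb; congr b; lia.
Qed.

Lemma hermitian_Q a b : hermitian a -> hermitian b -> cubic_decay a -> cubic_decay b ->
  hermitian (Q a b).
Proof.
move=> Ha Hb [A ha] [B hb] k.
have l := lexx (0 : R).
have D1 := hermitian_dx Ha; have D2 := hermitian_dx D1.
have E1 := hermitian_dx Hb; have E2 := hermitian_dx E1; have E3 := hermitian_dx E2.
rewrite /Q /nonlocal_coef (hermitian_conv Ha E1 (conv_dx0_dx1 l ha hb k)).
rewrite (hermitian_conv D1 E1 (conv_dx1_dx1 l ha hb k)).
rewrite (hermitian_conv D1 E3 (conv_dx1_dx3 l ha hb k)).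
rewrite (hermitian_conv D2 E2 (conv_dx2_dx2 l ha hb k)).
have e1 : dx_symbol (- k) = conjc (dx_symbol k) by rewrite /dx_symbol /= intrN mulrN.
have e2 : Ainv_symbol (- k) = conjc (Ainv_symbol k).
  rewrite /Ainv_symbol oppr_eq0 absrN; case: ifP => _; first by rewrite conjc1.
  by rewrite conjc_inv conjc_real.
have e3 : a 0 = conjc (a 0) by rewrite -Ha oppr0.
rewrite e1 e2 Hb {1}e3.
by rewrite !(conjcN, conjcD, conjcM, conjc_inv, conjc_nat, conjc1).
Qed.

End QuadraticForm.

(** * The power series solution *)

Section PowerSeries.
Context {R : realType}.
Implicit Types (k j l : int).

(** This factor in the coefficient bounds makes the Cauchy product stable: without it the
   [n+1] terms of the recursion would spoil the induction. *)
Definition sqrV (n : nat) : R := (n.+1)%:R ^- 2.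

Lemma sqrV_gt0 n : 0 < sqrV n.
Proof. by rewrite invr_gt0 exprn_gt0// ltr0n. Qed.
Lemma sqrV_le1 n : sqrV n <= 1.
Proof. by rewrite /sqrV invf_le1 ?exprn_gt0 ?ltr0n// exprn_ege1// ler1n. Qed.

Lemma sum_sqrV n : \sum_(i < n) sqrV i <= 2.
Proof.
case: n => [|n]; first by rewrite big_ord0.
rewrite -(big_mkord xpredT sqrV) big_ltn// /sqrV expr1n invr1.
have -> : \sum_(1 <= i < n.+1) i.+1%:R ^- 2 = \sum_(1 <= i < n.+1) (i%:R + 1) ^- 2 :> R.
  by apply: eq_bigr => i _; rewrite -natr1.
have [h|//] := sum_inv_sqr_le (R := R) n.+1.
have : 0 <= n.+1%:R^-1 :> R by rewrite invr_ge0.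
move: h; move: (\sum_(_ <= _ < _) _) (_^-1) => x y; lra.
Qed.

(** With [x = i+1], [y = n-i+1] and [x + y = n+2]: since [(x + y)^2 <= 2 (x^2 + y^2)], the
   product [x^-2 y^-2] is at most [2 (n+2)^-2 (x^-2 + y^-2)], which is summable. *)
Lemma sum_sqrV_conv n : \sum_(i < n.+1) (sqrV i * sqrV (n - i)) <= 8 * sqrV n.+1.
Proof.
have e : \sum_(i < n.+1) sqrV (n - i) = \sum_(i < n.+1) sqrV i.
  rewrite (reindex_inj rev_ord_inj) /=; apply: eq_bigr => i _.
  by congr sqrV; have := ltn_ord i; lia.
apply: (@le_trans _ _ (\sum_(i < n.+1) 2 * sqrV n.+1 * (sqrV i + sqrV (n - i)))).
  apply: ler_sum => i _.
  have li : (i <= n)%N by rewrite -ltnS.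
  have : (n.+2)%:R = i.+1%:R + (n - i).+1%:R :> R by rewrite -natrD; congr (_%:R); lia.
  rewrite /sqrV => ->.
  have : 0 < i.+1%:R :> R by rewrite ltr0n.
  have : 0 < (n - i).+1%:R :> R by rewrite ltr0n.
  move: (i.+1%:R) ((n - i).+1%:R) => x y y0 x0.
  have -> : 2 * (x + y) ^- 2 * (x ^- 2 + y ^- 2) =
     x ^- 2 * y ^- 2 + (x - y) ^+ 2 * ((x + y) ^- 2 * x ^- 2 * y ^- 2) :> R.
    field; do !(apply/andP; split); apply: lt0r_neq0; lra.
  rewrite lerDl; apply: mulr_ge0 (sqr_ge0 _) _.
  by apply: mulr_ge0; [apply: mulr_ge0|]; rewrite invr_ge0 sqr_ge0.
rewrite -mulr_sumr big_split /= e.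
have := sum_sqrV n.+1; have := sqrV_gt0 n.+1.
move: (\sum_(_ < _) _) (sqrV _) => x y; nra.
Qed.

(** Spending the fraction [1/(n+2)] of the available radius [g] divides by [g/(n+2)], while
   the [n]-th power of what is left loses only [(1 + 1/(n+1))^n <= e]. *)
Lemma shrink_radius (n : nat) (g : R) : 0 < g ->
  ((g / n.+2%:R) * (g * n.+1%:R / n.+2%:R) ^+ n)^-1 <=
  2 * expR 1 * n.+1%:R * g ^- n.+1.
Proof.
move=> g0.
have x0 : 0 < n.+1%:R :> R by rewrite ltr0n.
have x1 : 1 <= n.+1%:R :> R by rewrite ler1n.
have e : n.+2%:R = n.+1%:R + 1 :> R by rewrite -natr1.
have h : ((n.+1%:R + 1) / n.+1%:R) ^+ n <= expR 1 :> R.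
  apply: (@le_trans _ _ (expR (n.+1%:R^-1) ^+ n)).
    apply: lerXn2r; rewrite ?nnegrE ?expR_ge0//.
    have -> : (n.+1%:R + 1) / n.+1%:R = 1 + n.+1%:R^-1 :> R by field; exact: lt0r_neq0.
    exact: expR_ge1Dx.
  rewrite -expRM_natl ler_expR ler_pdivrMr// mul1r ler_nat; lia.
rewrite e; move: (n.+1%:R) x0 x1 e h => x x0 x1 _ h.
have -> : (g / (x + 1) * (g * x / (x + 1)) ^+ n)^-1 =
   (x + 1) * ((x + 1) / x) ^+ n * g ^- n.+1.
  rewrite exprS !expr_div_n exprMn.
  field; do !(apply/andP; split); rewrite ?expf_neq0 ?gt_eqF//; lra.
apply: ler_wpM2r; first by rewrite invr_ge0 exprn_ge0// ltW.
have := expR_gt0 (1:R); move: (expR 1) h => E h E0.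
have : 0 <= ((x + 1) / x) ^+ n by rewrite exprn_ge0// divr_ge0// ?ltW//; lra.
move: (_ ^+ n) h => y h y0; nra.
Qed.

Section recursion.
Variable a : int -> R[i].

(** The recursion needs all previous terms, so the list of them is built. *)
Fixpoint taylor_seq (n : nat) : seq (int -> R[i]) :=
  if n is m.+1 then
    rcons (taylor_seq m) (fun k => (m.+1)%:R^-1 *
      \sum_(i < m.+1) Q (nth a (taylor_seq m) i) (nth a (taylor_seq m) (m - i)) k)
  else [:: a].

Definition taylor n := nth a (taylor_seq n) n.

Lemma size_taylor_seq n : size (taylor_seq n) = n.+1.
Proof. by elim: n => [//|n IH]; rewrite /= size_rcons IH. Qed.

Lemma nth_taylor_seq n i : (i <= n)%N -> nth a (taylor_seq n) i = taylor i.
Proof.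
elim: n => [|n IH]; first by rewrite leqn0 => /eqP ->.
rewrite leq_eqVlt => /orP[/eqP -> //|h]; rewrite /= nth_rcons size_taylor_seq h.
exact: IH.
Qed.

Lemma taylor0 : taylor 0 = a. Proof. by []. Qed.

Lemma taylorS n k : taylor n.+1 k = (n.+1)%:R^-1 * \sum_(i < n.+1) Q (taylor i) (taylor (n - i)) k.
Proof.
rewrite /taylor /= nth_rcons size_taylor_seq ltnn eqxx; congr (_ * _).
apply: eq_bigr => i _; rewrite !nth_taylor_seq//; last by rewrite -ltnS.
exact: leq_subr.
Qed.

(** The constant of the lifespan: 16 is 8 from [sum_sqrV_conv] times 2 from
   [shrink_radius], which also yields the factor [e]. *)
Definition Tconst : R := 16 * expR 1 * Qconst.

Lemma Qconst_ge0 : 0 <= Qconst :> R.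
Proof. by apply: le_trans (Qconst_ge1). Qed.

Lemma Tconst_gt0 : 0 < Tconst.
Proof. by rewrite !mulr_gt0 ?expR_gt0//; apply: lt_le_trans (Qconst_ge1). Qed.

Variables (r : R).
Hypothesis (r0 : 0 < r) (ha : wbound 1 r a).

Let Kr0 : 0 <= Tconst * r.
Proof. by apply: mulr_ge0; apply: ltW => //; exact: Tconst_gt0. Qed.

(** Induction on [n], for all radii at once: the terms of the recursion are estimated at the
   intermediate radius [d'] of [shrink_radius], and the loss [n+1] is compensated by the
   division by [n+1]. *)
Lemma taylor_wbound n d : 0 <= d -> d < 1 ->
  wbound d (r * (Tconst * r / (1 - d)) ^+ n * sqrV n) (taylor n).
Proof.
elim/ltn_ind: n d => -[|n] IH d d0 d1.
  rewrite expr0 taylor0 /sqrV expr1n invr1 !mulr1; apply: wboundW ha => //; exact: ltW.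
pose g := 1 - d; have g0 : 0 < g by rewrite /g; lra.
have n1 : 0 < n.+1%:R :> R by rewrite ltr0n.
have n2 : 0 < n.+2%:R :> R by rewrite ltr0n.
have e2 : n.+2%:R = n.+1%:R + 1 :> R by rewrite -natr1.
(* spend the fraction [1 / (n+2)] of the radius left above [d] *)
pose d' := d + g / n.+2%:R.
have dd : d' - d = g / n.+2%:R by rewrite /d'; ring.
have dd' : 1 - d' = g * n.+1%:R / n.+2%:R.
  rewrite /d' /g e2; move: (n.+1%:R) n1 => x x0.
  by field; apply: lt0r_neq0; lra.
have hd : d < d' by rewrite -subr_gt0 dd divr_gt0.
have hd1 : d' < 1 by rewrite -subr_gt0 dd' divr_gt0// mulr_gt0.
have hd0 : 0 <= d' by lra.
move=> k; rewrite taylorS normcM normcV normc_nat.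
have C0 : 0 <= Qconst / (d' - d) * (r ^+ 2 * (Tconst * r / (1 - d')) ^+ n) :> R.
  apply: mulr_ge0; first by apply: divr_ge0; rewrite ?subr_ge0 ?(ltW hd) ?Qconst_ge0.
  apply: mulr_ge0; first exact: sqr_ge0.
  by apply/exprn_ge0/divr_ge0; [exact: Kr0|rewrite subr_ge0 ltW].
have hS : normc (\sum_(i < n.+1) Q (taylor i) (taylor (n - i)) k) <=
   Qconst / (d' - d) * (r ^+ 2 * (Tconst * r / (1 - d')) ^+ n) * (8 * sqrV n.+1) * wgt d k.
  apply: le_trans (normc_sum _ _ _) _.
  apply: (@le_trans _ _ (\sum_(i < n.+1) Qconst / (d' - d) * (r ^+ 2 * (Tconst *
    r / (1 - d')) ^+ n) * wgt d k * (sqrV i * sqrV (n - i)))).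
    apply: ler_sum => i _; have li : (i <= n)%N by rewrite -ltnS.
    have h1 := IH i (ltn_ord i) d' hd0 hd1.
    have h2 := IH (n - i)%N (leq_ltn_trans (leq_subr _ _) (ltnSn n)) d' hd0 hd1.
    apply: le_trans (Q_wbound d0 hd (ltW hd1) h1 h2 k) _.
    rewrite le_eqVlt; apply/orP; left; apply/eqP.
    have -> : (Tconst * r / (1 - d')) ^+ n = (Tconst * r / (1 - d')) ^+ i * (Tconst *
      r / (1 - d')) ^+ (n - i).
      by rewrite -exprD subnKC.
    ring.
  rewrite -mulr_sumr [leRHS]mulrAC; apply: ler_wpM2l (sum_sqrV_conv n).
  by rewrite mulr_ge0// ltW// wgt_gt0.
apply: le_trans (ler_wpM2l _ hS) _; first by rewrite invr_ge0 ltW.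
rewrite [leLHS]mulrA; apply: ler_wpM2r; first exact/ltW/wgt_gt0.
rewrite !mulrA; apply: ler_wpM2r; first exact/ltW/sqrV_gt0.
have hs := shrink_radius n g0.
have -> : n.+1%:R^-1 * Qconst / (d' - d) * r * r * (Tconst * r / (1 - d')) ^+ n * 8 =
  8 * Qconst * r ^+ 2 * (Tconst * r) ^+ n * n.+1%:R^-1 * ((d' - d) * (1 - d') ^+ n)^-1.
  by rewrite expr_div_n invfM; ring.
rewrite dd dd'.
apply: le_trans (ler_wpM2l _ hs) _.
  apply: mulr_ge0; last by rewrite invr_ge0 ltW.
  apply: mulr_ge0; last exact: exprn_ge0 Kr0.
  by apply: mulr_ge0; [apply: mulr_ge0; rewrite ?Qconst_ge0|exact: sqr_ge0].
rewrite le_eqVlt; apply/orP; left; apply/eqP.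
rewrite -/g expr_div_n (exprS (Tconst * r)) {2}/Tconst; field.
by rewrite expf_neq0 ?gt_eqF//= gt_eqF.
Qed.

Lemma taylor_wbound_geo n d : 0 <= d -> d < 1 ->
  wbound d (r * (Tconst * r / (1 - d)) ^+ n) (taylor n).
Proof.
move=> d0 d1; apply: wboundW (taylor_wbound n d0 d1) => //.
rewrite -[leRHS]mulr1; apply: ler_wpM2l (sqrV_le1 n).
apply: mulr_ge0; first exact: ltW.
by apply: exprn_ge0; apply: divr_ge0 Kr0 _; lra.
Qed.

Lemma taylor_decay n : cubic_decay (taylor n).
Proof. exact: (wbound_decay (lexx 0) (taylor_wbound_geo n (lexx 0) ltr01)). Qed.

Lemma taylor_hermitian : hermitian a -> forall n, hermitian (taylor n).
Proof.
move=> h; elim/ltn_ind => -[//|n] IH k.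
rewrite !taylorS conjcM conjc_inv conjc_nat; congr (_ * _).
rewrite rmorph_sum; apply: eq_bigr => i _.
apply: hermitian_Q; try exact: taylor_decay; apply: IH => //.
by rewrite ltnS leq_subr.
Qed.

End recursion.

Lemma eq_cvgc (S S' : nat -> R[i]) (l l' : R[i]) : S =1 S' -> l = l' -> cvgc S l -> cvgc S' l'.
Proof. by move=> /funext -> ->. Qed.

Lemma cvgc_conj (S : nat -> R[i]) (l : R[i]) : cvgc S l -> cvgc (fun n => conjc (S n)) (conjc l).
Proof. by rewrite /cvgc; under [in X in _ -> X]eq_fun do rewrite -rmorphB /= normc_conj. Qed.

(** * Cauchy products and power series in time *)

Lemma geometric_le (x : R) N : 0 <= x -> x < 1 -> \sum_(n < N) x ^+ n <= (1 - x)^-1.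
Proof.
move=> x0 x1; rewrite -[leRHS]mul1r ler_pdivlMr; last by rewrite subr_gt0.
rewrite mulrC -(opprB x) mulNr -subrX1 opprB lerBlDr lerDl exprn_ge0//.
Qed.

Lemma geometric_tail (x : R) m K : 0 <= x -> x < 1 ->
  \sum_(m <= n < m + K) x ^+ n <= x ^+ m / (1 - x).
Proof.
move=> x0 x1; rewrite -{1}[m]add0n big_addn addKn big_mkord.
under eq_bigr do rewrite addnC exprD.
rewrite -mulr_sumr; apply: ler_wpM2l (geometric_le _ x0 x1); exact: exprn_ge0.
Qed.

Lemma nX_cvg0 (x : R) : 0 <= x -> x < 1 -> (n.+1%:R * x ^+ n) @[n --> \oo] --> (0:R).
Proof.
(* [x ^+ n = y ^+ n * y ^+ n], and [n.+1%:R * y ^+ n] is a part of a geometric sum *)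
move=> x0 x1; pose y := Num.sqrt x.
have y0 : 0 <= y by exact: sqrtr_ge0.
have y1 : y < 1 by rewrite -sqrtr1 ltr_sqrt.
have xy : x = y * y by rewrite -expr2 sqr_sqrtr.
have h : (1 - y)^-1 * y ^+ n @[n --> \oo] --> (1 - y)^-1 * (0:R).
  apply: cvgM; first exact: cvg_cst.
  by apply: cvg_expr; rewrite ger0_norm.
rewrite mulr0 in h.
apply: (squeeze_cvgr _ (cvg_cst (0:R)) h); apply: nearW => n.
rewrite mulr_ge0 ?exprn_ge0//= xy exprMn mulrA; apply: ler_wpM2r; first exact: exprn_ge0.
apply: le_trans (geometric_le n.+1 y0 y1).
apply: (@le_trans _ _ (\sum_(i < n.+1) y ^+ n)); first by rewrite sumr_const card_ord mulr_natl.
apply: ler_sum => i _; apply: ler_wiXn2l => //; [exact: ltW|by rewrite -ltnS].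
Qed.

Section cauchy.
Variables (y : nat -> int -> R[i]) (c x d : R).
Hypotheses (c0 : 0 <= c) (x0 : 0 <= x) (x1 : x < 1) (d0 : 0 < d) (d1 : d <= 1).
Hypothesis hy : forall n, wbound d (c * x ^+ n) (y n).

Definition family_sum k : R[i] := csum (fun n => y n k).

Lemma family_asum k : asum (fun n => y n k) (c / (1 - x) * wgt d k).
Proof.
move=> N; apply: (@le_trans _ _ (\sum_(n < N) c * x ^+ n * wgt d k)).
  by apply: ler_sum => n _; exact: hy.
rewrite -mulr_suml -mulr_sumr; apply: ler_wpM2r; first exact/ltW/wgt_gt0.
by apply: ler_wpM2l => //; exact: geometric_le.
Qed.

Lemma family_sum_wbound : wbound d (c / (1 - x)) family_sum.
Proof. by move=> k; apply: csum_le; exact: family_asum. Qed.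

Lemma family_sum_tail m : wbound d (c * x ^+ m / (1 - x)) (fun k => family_sum k - \sum_(n < m) y n k).
Proof.
move=> k; apply: (csum_tail (family_asum k)) => K.
apply: (@le_trans _ _ (\sum_(m <= n < m + K) c * x ^+ n * wgt d k)).
  by apply: ler_sum => n _; exact: hy.
rewrite -mulr_suml -mulr_sumr; apply: ler_wpM2r; first exact/ltW/wgt_gt0.
by rewrite -mulrA; apply: ler_wpM2l => //; exact: geometric_tail.
Qed.

Let y_dec n : cubic_decay (y n). Proof. exact: (wbound_decay (ltW d0) (hy n)). Qed.
Let Y_dec : cubic_decay family_sum. Proof. exact: (wbound_decay (ltW d0) family_sum_wbound). Qed.
Let Yp_dec m : cubic_decay (fun k => \sum_(n < m) y n k). Proof. exact: cubic_decay_sum. Qed.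

(** The triangle of the Cauchy product, summed by rows. *)
Lemma cauchy_partial N k :
  \sum_(n < N) \sum_(i < n.+1) Q (y i) (y (n - i)) k =
  \sum_(i < N) Q (y i) (fun j => \sum_(n < N - i) y n j) k.
Proof.
elim: N => [|N IH]; first by rewrite !big_ord0.
rewrite big_ord_recr /= IH.
have -> : \sum_(i < N) Q (y i) (fun j => \sum_(n < N - i) y n j) k =
  \sum_(i < N.+1) Q (y i) (fun j => \sum_(n < N - i) y n j) k.
  rewrite big_ord_recr /= subnn.
  have -> : (fun j => \sum_(n < 0) y n j) = (fun=> 0).
    by apply/funext => j; rewrite big_ord0.
  by rewrite Q0r// addr0.
rewrite -big_split /=; apply: eq_bigr => i _.
rewrite -(QDr k (y_dec i) (Yp_dec _) (y_dec _)); congr (Q _ _ k); apply/funext => j.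
have li : (i <= N)%N by rewrite -ltnS ltn_ord.
by rewrite subSn// big_ord_recr.
Qed.

(** The remainder consists of [N+1] terms, each bounded by a multiple of [x^N], because in
   each of them a tail of length [N - i] meets a factor of size [x^i]. *)
Lemma Q_cauchy k :
  cvgc (fun N => \sum_(n < N) \sum_(i < n.+1) Q (y i) (y (n - i)) k) (Q family_sum family_sum k).
Proof.
have x10 : 0 < 1 - x by rewrite subr_gt0.
(* bounds are taken at radius 0, so that the whole radius [d] can be lost *)
pose C := Qconst / d * (c / (1 - x)) ^+ 2 * wgt 0 k.
have KQ0 : 0 <= Qconst :> R by apply: le_trans (@Qconst_ge1 R).
have h : C * (n.+1%:R * x ^+ n) @[n --> \oo] --> C * (0:R).
  by apply: cvgM (nX_cvg0 x0 x1); exact: cvg_cst.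
rewrite mulr0 in h.
apply: (squeeze_cvgr _ (cvg_cst (0:R)) h); apply: nearW => N.
rewrite normc_ge0 /= cauchy_partial normc_distC.
have -> : Q family_sum family_sum k - \sum_(i < N) Q (y i) (fun j => \sum_(n < N - i) y n j) k =
  Q (fun j => family_sum j - \sum_(n < N) y n j) family_sum k +
  \sum_(i < N) Q (y i) (fun j => family_sum j - \sum_(n < N - i) y n j) k.
  under [X in _ = _ + X]eq_bigr do rewrite QBr//.
  by rewrite sumrB QBl// Qsuml//; ring.
have Qb A B a b : wbound d A a -> wbound d B b -> normc (Q a b k) <= Qconst / d * (A * B) * wgt 0 k.
  by move=> hA hB; have := Q_wbound (lexx 0) d0 d1 hA hB k; rewrite subr0.
apply: le_trans (le_normcD _ _) _.
apply: (@le_trans _ _ (C * x ^+ N + \sum_(i < N) C * x ^+ N)); last first.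
  by rewrite sumr_const card_ord -mulrS -mulr_natl -/C; rewrite le_eqVlt; apply/orP; left;
    apply/eqP; ring.
apply: lerD.
  apply: le_trans (Qb _ _ _ _ (family_sum_tail N) family_sum_wbound) _.
  by rewrite le_eqVlt; apply/orP; left; apply/eqP; rewrite /C; ring.
apply: le_trans (normc_sum _ _ _) _; apply: ler_sum => i _.
apply: le_trans (Qb _ _ _ _ (hy i) (family_sum_tail (N - i))) _.
have -> : x ^+ N = x ^+ i * x ^+ (N - i) by rewrite -exprD subnKC// ltnW.
have -> : Qconst / d * (c * x ^+ i * (c * x ^+ (N - i) / (1 - x))) * wgt 0 k =
  Qconst / d * (c ^+ 2 / (1 - x)) * wgt 0 k * (x ^+ i * x ^+ (N - i)) by ring.
apply: ler_wpM2r; first by rewrite mulr_ge0 ?exprn_ge0.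
rewrite /C; apply: ler_wpM2r; first exact/ltW/wgt_gt0.
apply: ler_wpM2l; first by rewrite divr_ge0// ltW.
rewrite expr_div_n; apply: ler_wpM2l; first exact: exprn_ge0.
rewrite lef_pV2 ?posrE ?exprn_gt0//.
have h1 : 1 - x <= 1 by rewrite lerBlDr lerDl.
by rewrite expr2; apply: ler_piMr => //; exact: ltW.
Qed.

End cauchy.

Lemma expr_increment (t h : R[i]) (p : R) n : normc t <= p -> normc (t + h) <= p ->
  normc ((t + h) ^+ n - t ^+ n) * p <= n%:R * normc h * p ^+ n.
Proof.
move=> ht hth; have p0 : 0 <= p by apply: le_trans ht; exact: normc_ge0.
elim: n => [|n IH]; first by rewrite !expr0 subrr normc0 !mul0r.
have -> : (t + h) ^+ n.+1 - t ^+ n.+1 = t * ((t + h) ^+ n - t ^+ n) + h * (t + h) ^+ n.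
  by rewrite !exprS; ring.
apply: le_trans (ler_wpM2r p0 (le_normcD _ _)) _.
rewrite !normcM normcX mulrDl -natr1.
have h1 : normc t * normc ((t + h) ^+ n - t ^+ n) * p <= p * (n%:R * normc h * p ^+ n).
  by rewrite -mulrA; apply: ler_pM => //; rewrite ?mulr_ge0 ?normc_ge0.
have h2 : normc h * normc (t + h) ^+ n * p <= normc h * p ^+ n * p.
  apply: ler_wpM2r => //; apply: ler_wpM2l; first exact: normc_ge0.
  by apply: lerXn2r; rewrite ?nnegrE ?normc_ge0.
apply: le_trans (lerD h1 h2) _.
by rewrite le_eqVlt; apply/orP; left; apply/eqP; rewrite exprS; ring.
Qed.

(** The remainder of order two, multiplied by [p ^+ 2] to avoid negative exponents. *)
Lemma expr_increment2 (t h : R[i]) (p : R) n : normc t <= p -> normc (t + h) <= p ->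
  normc ((t + h) ^+ n - t ^+ n - n%:R * h * t ^+ n.-1) * p ^+ 2 <=
  n%:R ^+ 2 * normc h ^+ 2 * p ^+ n.
Proof.
move=> ht hth; have p0 : 0 <= p by apply: le_trans ht; exact: normc_ge0.
elim: n => [|n IH]; first by rewrite !expr0 subrr !mul0r oppr0 addr0 normc0 mul0r expr0n/= !mul0r.
have -> : (t + h) ^+ n.+1 - t ^+ n.+1 - n.+1%:R * h * t ^+ n.+1.-1 =
   t * ((t + h) ^+ n - t ^+ n - n%:R * h * t ^+ n.-1) + h * ((t + h) ^+ n - t ^+ n).
  rewrite -natr1 /=; case: n {IH} => [|n] /=; rewrite !exprS; ring.
apply: le_trans (ler_wpM2r _ (le_normcD _ _)) _; first exact: exprn_ge0.
rewrite !normcM mulrDl -natr1.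
have h1 : normc t * normc ((t + h) ^+ n - t ^+ n - n%:R * h * t ^+ n.-1) * p ^+ 2
   <= p * (n%:R ^+ 2 * normc h ^+ 2 * p ^+ n).
  by rewrite -mulrA; apply: ler_pM => //; rewrite ?mulr_ge0 ?normc_ge0 ?exprn_ge0.
have h2 : normc h * normc ((t + h) ^+ n - t ^+ n) * p ^+ 2 <=
   normc h * p * (n%:R * normc h * p ^+ n).
  rewrite [leLHS](_ : _ = normc h * p * (normc ((t + h) ^+ n - t ^+ n) * p)); last by ring.
  apply: ler_wpM2l (expr_increment n ht hth); first by rewrite mulr_ge0// normc_ge0.
apply: le_trans (lerD h1 h2) _; rewrite (exprS p n) -subr_ge0.
rewrite [leRHS](_ : _ = (n%:R + 1) * (normc h ^+ 2 * (p * p ^+ n))); last by ring.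
apply: mulr_ge0; first by rewrite addr_ge0.
by apply: mulr_ge0; rewrite ?sqr_ge0 ?mulr_ge0 ?exprn_ge0.
Qed.

Lemma csum_shift (F : nat -> R[i]) M : asum F M -> csum F = F 0%N + csum (fun n => F n.+1).
Proof.
move=> h; have := csum_cvg h => hc.
have h1 : asum (fun n => F n.+1) M.
  move=> N; apply: le_trans (h N.+1); rewrite big_ord_recl /= lerDr; exact: normc_ge0.
have h2 : cvgc (fun N => F 0%N + \sum_(n < N) F n.+1) (csum F).
  have := hc; rewrite /cvgc -(cvg_shiftS _) /=.
  by under eq_fun do rewrite big_ord_recl /=.
apply: (cvgc_unique h2).
rewrite /cvgc; under eq_fun do rewrite opprD addrACA subrr add0r.
exact: csum_cvg h1.
Qed.

Section series.
Variables (a : int -> R[i]) (r : R).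
Hypothesis (r0 : 0 < r) (ha : wbound 1 r a).

Definition Useries (t : R[i]) k : R[i] := csum (fun n => t ^+ n * taylor a n k).
(** The term of index 0 is 0 thanks to the factor [n%:R], whatever [n.-1] means there. *)
Definition dUseries (t : R[i]) k : R[i] := csum (fun n => n%:R * t ^+ n.-1 * taylor a n k).

Variable (d : R).
Hypotheses (d0 : 0 < d) (d1 : d < 1).
Let kappa : R := Tconst * r / (1 - d).
Let kappa_gt0 : 0 < kappa.
Proof. by apply: divr_gt0; [apply: mulr_gt0 => //; exact: Tconst_gt0|rewrite subr_gt0]. Qed.

Lemma Uterm_wbound t n : wbound d (r * (kappa * normc t) ^+ n) (fun k => t ^+ n * taylor a n k).
Proof.
have := wboundZ (t ^+ n) (taylor_wbound_geo r0 ha n (ltW d0) d1).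
by rewrite normcX mulrCA [normc t ^+ n * _]mulrC -exprMn.
Qed.

Lemma Useries_wbound t : kappa * normc t < 1 -> wbound d (r / (1 - kappa * normc t)) (Useries t).
Proof.
move=> h; apply: (family_sum_wbound (ltW r0) _ h (Uterm_wbound t)).
by rewrite mulr_ge0 ?normc_ge0// ltW.
Qed.

Lemma dUterm_asum t k : kappa * normc t < 1 ->
  asum (fun n => n%:R * t ^+ n.-1 * taylor a n k) (r * kappa / (1 - kappa * normc t) * wgt d k).
Proof.
move=> ht; have x0 : 0 <= kappa * normc t by rewrite mulr_ge0 ?normc_ge0// ltW.
have hw := ltW (wgt_gt0 d k).
case=> [|N].
  rewrite big_ord0; apply: mulr_ge0 => //; apply: divr_ge0; last by rewrite subr_ge0 ltW.
  by apply: mulr_ge0; exact: ltW.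
rewrite big_ord_recl !mul0r normc0 add0r.
apply: (@le_trans _ _ (\sum_(n < N) r * kappa * (kappa * normc t) ^+ n * wgt d k)); last first.
  rewrite -mulr_suml -mulr_sumr; apply: ler_wpM2r => //.
  by apply: ler_wpM2l (geometric_le _ x0 ht); rewrite mulr_ge0// ltW.
apply: ler_sum => n _; rewrite /= /bump leq0n add1n /= ?add0n.
rewrite !normcM normc_nat normcX.
have h := taylor_wbound r0 ha n.+1 (ltW d0) d1 k.
apply: le_trans (ler_wpM2l _ h) _; first by rewrite mulr_ge0 ?exprn_ge0 ?normc_ge0.
rewrite -/kappa mulrA; apply: ler_wpM2r => //.
have -> : n.+1%:R * normc t ^+ n * (r * kappa ^+ n.+1 * sqrV n.+1) =
  r * kappa * (kappa * normc t) ^+ n * (n.+1%:R * sqrV n.+1) by rewrite exprS (exprMn _ kappa); ring.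
rewrite -[leRHS]mulr1; apply: ler_wpM2l.
  by apply: mulr_ge0 (exprn_ge0 _ x0); apply: mulr_ge0; exact: ltW.
rewrite /sqrV ler_pdivrMr ?exprn_gt0 ?ltr0n// mul1r -natrX ler_nat.
by rewrite (leq_trans (leqnSn _))// expnS expn1 leq_pmulr.
Qed.

Lemma dUseries_wbound t : kappa * normc t < 1 -> wbound d (r * kappa / (1 - kappa *
  normc t)) (dUseries t).
Proof. by move=> ht k; apply: csum_le; exact: dUterm_asum. Qed.

Lemma Useries0 k : Useries 0 k = a k.
Proof.
apply: csumP; rewrite /cvgc; apply: cvg_near_cst; exists 1%N => // -[//|N] _ /=.
rewrite big_ord_recl expr0 mul1r big1 ?addr0 ?subrr ?normc0//.
by move=> i _; rewrite /= expr0n mul0r.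
Qed.

(** Cauchy product and the recursion: this is the equation for the coefficients. *)
Lemma dUseries_Q t k : kappa * normc t < 1 -> dUseries t k = Q (Useries t) (Useries t) k.
Proof.
move=> ht; have x0 : 0 <= kappa * normc t by rewrite mulr_ge0 ?normc_ge0// ltW.
have /(@csumP _ (fun n => \sum_(i < n.+1) Q (fun k => t ^+ i * taylor a i k)
    (fun k => t ^+ (n - i) * taylor a (n - i) k) k)) <- :=
  Q_cauchy (ltW r0) x0 ht d0 (ltW d1) (Uterm_wbound t) k.
rewrite /dUseries (csum_shift (dUterm_asum k ht)) !mul0r add0r; congr csum.
apply/funext => n /=; rewrite taylorS.
rewrite -[X in X * (_ * _)]mulrC -mulrA (mulrA n.+1%:R) mulfV ?mul1r; last by rewrite pnatr_eq0.
rewrite mulr_sumr; apply: eq_bigr => i _.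
have hu n' := taylor_decay r0 ha n'.
rewrite QZl//; last exact: cubic_decayZ.
rewrite QZr// mulrA -exprD subnKC// -ltnS//.
Qed.

(** The difference quotient converges with a rate that is uniform in [k] for the weight [wgt d],
   so that differentiability holds for the norms and not only for each coefficient.  The
   factor [n^2] from the second order remainder is absorbed by [sqrV]. *)
Lemma Useries_deriv (t h : R[i]) (p : R) : 0 < p -> normc t <= p -> normc (t + h) <= p ->
  kappa * p < 1 -> h != 0 ->
  wbound d (normc h * (r / p ^+ 2 / (1 - kappa * p)))
    (fun k => h^-1 * (Useries (t + h) k - Useries t k) - dUseries t k).
Proof.
move=> p0 ht hth hp h0.
have x0 : 0 <= kappa * p by rewrite mulr_ge0 ?ltW.
have ht' : kappa * normc t < 1 by apply: le_lt_trans hp; rewrite ler_wpM2l// ltW.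
have hth' : kappa * normc (t + h) < 1 by apply: le_lt_trans hp; rewrite ler_wpM2l// ltW.
have xt : 0 <= kappa * normc t by rewrite mulr_ge0 ?normc_ge0// ltW.
have xth : 0 <= kappa * normc (t + h) by rewrite mulr_ge0 ?normc_ge0// ltW.
move=> k; have hw := ltW (wgt_gt0 d k).
have A1 := family_asum (ltW r0) xth hth' (Uterm_wbound (t + h)) k.
have A2 := family_asum (ltW r0) xt ht' (Uterm_wbound t) k.
have A3 := dUterm_asum k ht'.
have e1 : h^-1 * (Useries (t + h) k - Useries t k) - dUseries t k =
  csum (fun n => h^-1 * ((t + h) ^+ n - t ^+ n - n%:R * h * t ^+ n.-1) * taylor a n k).
  apply/esym/csumP.
  have H1 := csum_cvg A1; have H2 := csum_cvg A2; have H3 := csum_cvg A3.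
  have := cvgcD (cvgcZ h^-1 (cvgcD H1 (cvgcZ (-1) H2))) (cvgcZ (-1) H3).
  apply: eq_cvgc => [N|]; last by rewrite !mulN1r.
  rewrite !mulr_sumr -big_split /= mulr_sumr -big_split /=; apply: eq_bigr => n _.
  by field.
rewrite e1; apply: csum_le => N.
apply: (@le_trans _ _ (\sum_(n < N) normc h * (r / p ^+ 2) * (kappa * p) ^+ n * wgt d k)); last first.
  rewrite -mulr_suml -mulr_sumr; apply: ler_wpM2r => //.
  rewrite [leRHS]mulrA; apply: ler_wpM2l (geometric_le _ x0 hp).
  by rewrite mulr_ge0 ?normc_ge0// divr_ge0 ?exprn_ge0// ltW.
apply: ler_sum => n _; rewrite !normcM normcV.
have hn := expr_increment2 n ht hth; have hu := taylor_wbound r0 ha n (ltW d0) d1 k.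
have h0' : 0 < normc h by rewrite normc_gt0.
rewrite -/kappa in hu.
have {hn}hn : (normc h)^-1 * normc ((t + h) ^+ n - t ^+ n - n%:R * h * t ^+ n.-1) <=
  normc h * n%:R ^+ 2 * p ^+ n / p ^+ 2.
  rewrite [leLHS]mulrC ler_pdivrMr// [leRHS]mulrAC ler_pdivlMr ?exprn_gt0//.
  by apply: le_trans hn _; rewrite le_eqVlt; apply/orP; left; apply/eqP; ring.
apply: le_trans (ler_pM _ (normc_ge0 _) hn hu) _.
  by rewrite mulr_ge0 ?invr_ge0 ?normc_ge0.
rewrite mulrA; apply: ler_wpM2r => //.
have -> : normc h * n%:R ^+ 2 * p ^+ n / p ^+ 2 * (r * kappa ^+ n * sqrV n) =
  normc h * (r / p ^+ 2) * (kappa * p) ^+ n * (n%:R ^+ 2 * sqrV n) by rewrite (exprMn _ kappa); ring.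
rewrite -[leRHS]mulr1; apply: ler_wpM2l.
  by rewrite !mulr_ge0 ?normc_ge0 ?exprn_ge0 ?invr_ge0 ?exprn_ge0// ltW.
rewrite /sqrV ler_pdivrMr ?exprn_gt0 ?ltr0n// mul1r; apply: lerXn2r; rewrite ?nnegrE//.
by rewrite ler_nat.
Qed.

Lemma Useries_hermitian (t : R) : hermitian a -> kappa * normc t%:C < 1 -> hermitian (Useries t%:C).
Proof.
move=> H ht k; have x0 : 0 <= kappa * normc t%:C by rewrite mulr_ge0 ?normc_ge0// ltW.
have A := family_asum (ltW r0) x0 ht (Uterm_wbound t%:C) k.
apply: csumP; have := csum_cvg A => /cvgc_conj; apply: eq_cvgc => // N.
rewrite rmorph_sum; apply: eq_bigr => n _.
transitivity (conjc (t%:C ^+ n * taylor a n k)) => //.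
have -> : t%:C ^+ n = (t ^+ n)%:C by rewrite rmorphXn.
by rewrite conjcM (taylor_hermitian r0 ha H) conjc_real.
Qed.

End series.
End PowerSeries.

(** * Integration on the circle and summation of Fourier series *)

Section CircleIntegration.
Context {R : realType}.
Implicit Types (k j l : int) (f g : R -> R[i]).
Local Notation mu := (@lebesgue_measure R).
Local Notation I01 := (`[0%R, 1%R]%classic : set R).

Definition Rintble (f : R -> R) := mu.-integrable I01 (EFin \o f).

Definition Cmeas f := measurable_fun setT (fun x => complex.Re (f x)) /\
  measurable_fun setT (fun x => complex.Im (f x)).
Definition Cintble f := Rintble (fun x => complex.Re (f x)) /\ Rintble (fun x => complex.Im (f x)).
Definition Cbounded f := exists M, forall x, normc (f x) <= M.

Lemma measurable_I01 : measurable (I01 : set (measurableTypeR R)). Proof. exact: measurable_itv. Qed.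
Lemma measure_I01 : mu I01 = 1%E.
Proof. by rewrite lebesgue_measure_itv /= lte_fin ltr01 sube0. Qed.
Hint Resolve measurable_I01 : core.

Lemma CmeasD f g : Cmeas f -> Cmeas g -> Cmeas (fun x => f x + g x).
Proof.
move=> [a b] [c d]; split; [under eq_fun do rewrite ReD|under eq_fun do rewrite ImD];
exact: measurable_funD.
Qed.
Lemma CmeasN f : Cmeas f -> Cmeas (fun x => - f x).
Proof.
move=> [a b]; split; [under eq_fun do rewrite ReN|under eq_fun do rewrite ImN];
exact: measurableT_comp.
Qed.
Lemma CmeasB f g : Cmeas f -> Cmeas g -> Cmeas (fun x => f x - g x).
Proof. by move=> h /CmeasN; exact: CmeasD. Qed.
Lemma CmeasM f g : Cmeas f -> Cmeas g -> Cmeas (fun x => f x * g x).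
Proof.
move=> [a b] [c d]; split; [under eq_fun do rewrite ReM|under eq_fun do rewrite ImM].
- by apply: measurable_funB; exact: measurable_funM.
- by apply: measurable_funD; exact: measurable_funM.
Qed.
Lemma Cmeas_cst (c : R[i]) : Cmeas (fun=> c).
Proof. by split; exact: measurable_cst. Qed.
Lemma CmeasZ (c : R[i]) f : Cmeas f -> Cmeas (fun x => c * f x).
Proof. by apply: CmeasM; exact: Cmeas_cst. Qed.

Lemma RintbleD (f g : R -> R) : Rintble f -> Rintble g -> Rintble (fun x => f x + g x).
Proof. by move=> hf hg; rewrite /Rintble; have := integrableD measurable_I01 hf hg. Qed.
Lemma RintbleZ (c : R) (f : R -> R) : Rintble f -> Rintble (fun x => c * f x).
Proof. by move=> hf; rewrite /Rintble; have := integrableZl measurable_I01 c hf. Qed.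
Lemma RintbleN (f : R -> R) : Rintble f -> Rintble (fun x => - f x).
Proof. by move=> hf; rewrite /Rintble; have := integrableN hf. Qed.
Lemma RintbleB (f g : R -> R) : Rintble f -> Rintble g -> Rintble (fun x => f x - g x).
Proof. by move=> h /RintbleN; exact: RintbleD. Qed.

Lemma Rintble_dom (f g : R -> R) : measurable_fun setT f -> Rintble g ->
  (forall x, I01 x -> `|f x| <= g x) -> Rintble f.
Proof.
move=> mf hg h; apply: (le_integrable measurable_I01 _ _ hg).
  exact/measurable_EFinP/measurable_funTS.
move=> x Ix /=; rewrite lee_fin; apply: le_trans (h x Ix) _.
exact: ler_norm.
Qed.

Lemma Rintble_cst (c : R) : Rintble (fun=> c).
Proof.
apply: measurable_bounded_integrable => //.
  by rewrite /= lebesgue_measure_itv /= lte_fin ltr01 sube0 ltry.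
exact: bounded_cst.
Qed.

Lemma Rintble_bounded (f : R -> R) M : measurable_fun setT f ->
  (forall x, I01 x -> `|f x| <= M) -> Rintble f.
Proof. by move=> mf; apply: Rintble_dom mf (Rintble_cst M). Qed.

Lemma measurable_normc f : Cmeas f -> measurable_fun setT (fun x => normc (f x)).
Proof.
move=> [a b].
rewrite (_ : (fun x => normc (f x)) =
  (fun x => Num.sqrt (complex.Re (f x) ^+ 2 + complex.Im (f x) ^+ 2))).
  have ms : measurable_fun setT (@Num.sqrt R).
    by apply: continuous_measurable_fun; exact: sqrt_continuous.
  apply: (measurableT_comp ms).
  by apply: measurable_funD; apply: measurable_funX.
by apply/funext => x; case: (f x).
Qed.

Lemma Cintble_dom f (g : R -> R) : Cmeas f -> Rintble g ->
  (forall x, I01 x -> normc (f x) <= g x) -> Cintble f.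
Proof.
move=> [a b] hg h; split; apply: Rintble_dom hg _ => // x Ix; apply: le_trans (h x Ix).
- exact: Re_le_normc.
- exact: Im_le_normc.
Qed.

Lemma Cintble_bounded f : Cmeas f -> Cbounded f -> Cintble f.
Proof. by move=> mf [M h]; apply: (Cintble_dom mf (Rintble_cst M)) => x _; exact: h. Qed.

Lemma Rintble_normc f : Cmeas f -> Cintble f -> Rintble (fun x => normc (f x)).
Proof.
move=> mf [a b].
have h : Rintble (fun x => `|complex.Re (f x)| + `|complex.Im (f x)|).
  by apply: RintbleD; exact: integrable_norm.
apply: Rintble_dom h _; first exact: measurable_normc.
by move=> x _; rewrite ger0_norm ?normc_ge0//; exact: normc_le_ReIm.
Qed.

Lemma CintbleD f g : Cintble f -> Cintble g -> Cintble (fun x => f x + g x).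
Proof.
move=> [a b] [c d]; split; [under eq_fun do rewrite ReD|under eq_fun do rewrite ImD];
exact: RintbleD.
Qed.

Lemma CintbleZ (c : R[i]) f : Cintble f -> Cintble (fun x => c * f x).
Proof.
move=> [a b]; split; [under eq_fun do rewrite ReM|under eq_fun do rewrite ImM].
- by apply: RintbleB; exact: RintbleZ.
- by apply: RintbleD; exact: RintbleZ.
Qed.

Lemma CintbleM f g : Cmeas f -> Cintble f -> Cmeas g -> Cbounded g -> Cintble (fun x => f x * g x).
Proof.
move=> mf hf mg [M h]; have M0 : 0 <= M by apply: le_trans (h 0); exact: normc_ge0.
apply: (Cintble_dom (CmeasM mf mg) (RintbleZ M (Rintble_normc mf hf))) => x _.
by rewrite normcM mulrC; apply: ler_wpM2r => //; exact: normc_ge0.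
Qed.

Lemma circ_intD f g : Cintble f -> Cintble g ->
  circ_int (fun x => f x + g x) = circ_int f + circ_int g.
Proof.
move=> [a b] [c d]; rewrite /circ_int.
under eq_Rintegral do rewrite ReD; under [X in _ +i* X]eq_Rintegral do rewrite ImD.
by rewrite !RintegralD.
Qed.

Lemma circ_intZ (c : R[i]) f : Cintble f ->
  circ_int (fun x => c * f x) = c * circ_int f.
Proof.
move=> [a b]; rewrite /circ_int.
under eq_Rintegral do rewrite ReM; under [X in _ +i* X]eq_Rintegral do rewrite ImM.
rewrite RintegralB//; [|exact: RintbleZ..]; rewrite RintegralD//; [|exact: RintbleZ..].
by rewrite !RintegralZl//; case: c.
Qed.

Lemma circ_intB f g : Cintble f -> Cintble g ->
  circ_int (fun x => f x - g x) = circ_int f - circ_int g.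
Proof.
move=> hf hg; rewrite -mulN1r -circ_intZ// -circ_intD//; last exact: CintbleZ.
by congr circ_int; apply/funext => x; rewrite mulN1r.
Qed.

Lemma circ_int0 : circ_int (fun=> 0 : R[i]) = 0.
Proof. by rewrite /circ_int /= !Rintegral_cst// !mul0r. Qed.

Lemma circ_int_le f (g : R -> R) e : Cmeas f -> Rintble g ->
  (forall x, I01 x -> normc (f x) <= e * g x) ->
  normc (circ_int f) <= 2 * (e * \int[mu]_(x in I01) g x).
Proof.
move=> mf hg h.
have [a b] := Cintble_dom mf (RintbleZ e hg) h.
apply: le_trans (normc_le_ReIm _) _; rewrite /circ_int /=.
rewrite -RintegralZl// mulr_natl mulr2n; apply: lerD.
- apply: le_trans (le_normr_Rintegral _ a) _ => //; apply: le_Rintegral => //.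
  + exact: integrable_norm.
  + exact: RintbleZ.
  + by move=> x Ix; apply: le_trans (Re_le_normc _) (h x Ix).
- apply: le_trans (le_normr_Rintegral _ b) _ => //; apply: le_Rintegral => //.
  + exact: integrable_norm.
  + exact: RintbleZ.
  + by move=> x Ix; apply: le_trans (Im_le_normc _) (h x Ix).
Qed.

Lemma ae_imply1 (P P' : R -> Prop) : (forall x, P x -> P' x) ->
  (\forall x \ae mu, P x) -> \forall x \ae mu, P' x.
Proof. by apply: (@filterS _ _ (ae_filter_ringOfSetsType mu)). Qed.

Lemma ae_imply2 (P P' P'' : R -> Prop) : (forall x, P x -> P' x -> P'' x) ->
  (\forall x \ae mu, P x) -> (\forall x \ae mu, P' x) -> \forall x \ae mu, P'' x.
Proof. by apply: (@filterS2 _ _ (ae_filter_ringOfSetsType mu)). Qed.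

Lemma Rintegral_ae (f g : R -> R) : measurable_fun setT f -> measurable_fun setT g ->
  f = g %[ae mu] -> \int[mu]_(x in I01) f x = \int[mu]_(x in I01) g x.
Proof.
move=> mf mg fg; congr fine; apply: ae_eq_integral => //.
- exact/measurable_EFinP/measurable_funTS.
- exact/measurable_EFinP/measurable_funTS.
- by apply: ae_imply1 fg => x /= h _; rewrite h.
Qed.

Lemma circ_int_ae f g : Cmeas f -> Cmeas g -> f = g %[ae mu] -> circ_int f = circ_int g.
Proof.
move=> [a b] [c d] fg; rewrite /circ_int; congr (_ +i* _); apply: Rintegral_ae => //;
by apply: ae_imply1 fg => x /= h _; rewrite h.
Qed.

(** * Exponentials and Fourier series *)

Lemma fexpE k x : fexp k x = cos (twopi * k%:~R * x) +i* sin (twopi * k%:~R * x) :> R[i].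
Proof.
have e : 2 * k%:~R * pi * x = twopi * k%:~R * x :> R by rewrite twopiE; ring.
by rewrite /fexp e.
Qed.

Lemma normc_fexp k x : normc (fexp k x : R[i]) = 1.
Proof. by rewrite fexpE /normc cos2Dsin2 sqrtr1. Qed.

Lemma fexpD j k x : fexp (j + k) x = fexp j x * fexp k x :> R[i].
Proof.
rewrite !fexpE intrD mulrDr mulrDl cosD sinD /=.
by apply/eqP; rewrite eq_complex /= eqxx /=; apply/eqP; rewrite addrC mulrC [X in _ + X]mulrC addrC.
Qed.

Lemma fexp0 x : fexp 0 x = 1 :> R[i].
Proof. by rewrite fexpE mulr0 mul0r cos0 sin0. Qed.

Lemma fexpN k x : fexp (- k) x = conjc (fexp k x) :> R[i].
Proof. by rewrite !fexpE intrN mulrN mulNr cosN sinN. Qed.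

Lemma fexp_addx k x y : fexp k (x + y) = fexp k x * fexp k y :> R[i].
Proof.
rewrite !fexpE mulrDr cosD sinD /=.
by apply/eqP; rewrite eq_complex /= eqxx /=; apply/eqP; rewrite addrC mulrC [X in _ + X]mulrC addrC.
Qed.

Lemma fexp_at1 k : fexp k 1 = 1 :> R[i].
Proof.
have h m : fexp (Posz m) 1 = 1 :> R[i].
  elim: m => [|m IH]; first by rewrite fexp0.
  rewrite -addn1 PoszD fexpD IH mul1r fexpE twopiE !mulr1 mulr_natl.
  by rewrite -[_ *+ 2]add0r cosD2pi sinD2pi cos0 sin0.
case: k => n; first exact: h.
by rewrite NegzE fexpN h conjc1.
Qed.

Lemma fexp_periodic k (x : R) : fexp k (x + 1) = fexp k x.
Proof. by rewrite fexp_addx fexp_at1 mulr1. Qed.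

Lemma is_derive_scale (c x : R) : is_derive x 1 (fun y => c * y) c.
Proof. by have := is_deriveZ c (is_derive_id x (1 : R)); rewrite /GRing.scale /= mulr1. Qed.

Lemma is_derive_cos_scale (c x : R) : is_derive x 1 (fun y => cos (c * y)) (- c * sin (c * x)).
Proof.
have := @is_derive1_comp R cos (fun y => c * y) x _ _ (is_derive_cos _) (is_derive_scale c x).
by rewrite mulNr mulNr mulrC.
Qed.

Lemma is_derive_sin_scale (c x : R) : is_derive x 1 (fun y => sin (c * y)) (c * cos (c * x)).
Proof.
have := @is_derive1_comp R sin (fun y => c * y) x _ _ (is_derive_sin _) (is_derive_scale c x).
by rewrite mulrC.
Qed.

Lemma continuous_cos_scale (c : R) : continuous (fun y => cos (c * y)).
Proof.
by move=> x; apply/differentiable_continuous/derivable1_diffP; case: (is_derive_cos_scale c x).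
Qed.
Lemma continuous_sin_scale (c : R) : continuous (fun y => sin (c * y)).
Proof.
by move=> x; apply/differentiable_continuous/derivable1_diffP; case: (is_derive_sin_scale c x).
Qed.

Lemma Cmeas_fexp k : Cmeas (fexp k).
Proof.
split; under eq_fun do rewrite fexpE /=; apply: continuous_measurable_fun.
- exact: continuous_cos_scale.
- exact: continuous_sin_scale.
Qed.

Lemma Cbounded_fexp k : Cbounded (fexp k).
Proof. by exists 1 => x; rewrite normc_fexp. Qed.

Lemma Cmeas_trig_sum (s : seq int) (a : int -> R[i]) :
  Cmeas (fun x => \sum_(k <- s) a k * fexp k x).
Proof.
elim: s => [|j s IH]; first by under eq_fun do rewrite big_nil; exact: Cmeas_cst.
under eq_fun do rewrite big_cons; apply: CmeasD IH; exact/CmeasZ/Cmeas_fexp.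
Qed.

Lemma circ_int_trig_sum (s : seq int) (a : int -> R[i]) g : Cmeas g -> Cintble g ->
  circ_int (fun x => (\sum_(k <- s) a k * fexp k x) * g x) =
  \sum_(k <- s) a k * circ_int (fun x => fexp k x * g x).
Proof.
move=> mg hg; have hk k : Cintble (fun x => fexp k x * g x).
  by under eq_fun do rewrite mulrC; apply: CintbleM => //; [exact: Cmeas_fexp|exact: Cbounded_fexp].
have cs t : Cintble (fun x => (\sum_(k <- t) a k * fexp k x) * g x).
  elim: t => [|j t IH].
    under eq_fun do rewrite big_nil mul0r; by split; exact: Rintble_cst.
  under eq_fun do rewrite big_cons mulrDl -mulrA; apply: CintbleD IH; exact: CintbleZ.
elim: s => [|j s IH].
  rewrite big_nil; under eq_fun do rewrite big_nil mul0r; exact: circ_int0.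
rewrite big_cons -IH -circ_intZ// -circ_intD//; last exact: CintbleZ.
by congr circ_int; apply/funext => x; rewrite big_cons mulrDl mulrA.
Qed.

Definition synth (a : int -> R[i]) (x : R) : R[i] := zsum (fun k => a k * fexp k x).

Section synth.
Variables (a : int -> R[i]) (M : R).
Hypothesis ha : zasum a M.

Lemma zasum_fexp x : zasum (fun k => a k * fexp k x) M.
Proof. by apply: (zasumW ha) => k; rewrite normcM normc_fexp mulr1. Qed.

Lemma synth_cvg x : cvgc (fun N => \sum_(k <- window N) a k * fexp k x) (synth a x).
Proof. exact: zsum_cvg (zasum_fexp x). Qed.

Lemma Cmeas_synth : Cmeas (synth a).
Proof.
split.
- apply: (measurable_fun_cvg (h := fun N x => complex.Re (\sum_(k <- window N) a k * fexp k x))).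
    by move=> N; exact: (Cmeas_trig_sum _ _).1.
  by move=> x _; exact: (cvgc_ReIm (synth_cvg x)).1.
- apply: (measurable_fun_cvg (h := fun N x => complex.Im (\sum_(k <- window N) a k * fexp k x))).
    by move=> N; exact: (Cmeas_trig_sum _ _).2.
  by move=> x _; exact: (cvgc_ReIm (synth_cvg x)).2.
Qed.

Lemma normc_synth_le x : normc (synth a x) <= M.
Proof. exact: zsum_le (zasum_fexp x). Qed.

Lemma Cbounded_synth : Cbounded (synth a).
Proof. by exists M; exact: normc_synth_le. Qed.

Lemma synth_periodic : periodic (synth a) 1.
Proof. by move=> x; rewrite /synth; under eq_fun do rewrite fexp_periodic. Qed.

(** The tails are bounded by those of the sum of the moduli of the coefficients, hence
   uniformly in [x]; this allows integration term by term. *)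
Lemma synth_tail : exists2 T : nat -> R, (T n @[n --> \oo] --> (0:R)) &
  forall N x, normc (synth a x - \sum_(k <- window N) a k * fexp k x) <= T N.
Proof.
pose s (N : nat) := \sum_(k <- window N) normc (a k).
have sS N K : s (N + K)%N = s N + \sum_(N <= n < N + K) \sum_(j <- shell n) normc (a j).
  rewrite /s -!shell_sum_window.
  rewrite -!(big_mkord xpredT (fun n => \sum_(j <- shell n) normc (a j))).
  by rewrite (big_cat_nat (n := N)) ?leq_addr.
have sm : {homo s : n m / (n <= m)%N >-> n <= m}.
  move=> n m nm; rewrite -(subnKC nm) sS lerDl.
  by apply: sumr_ge0 => i _; apply: sumr_ge0 => j _; exact: normc_ge0.
have sc : cvgn s.
  apply: nondecreasing_is_cvgn sm _; exists M => _ [n _ <-]; apply: ha.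
  exact: uniq_window.
exists (fun N => limn s - s N).
  by rewrite -(subrr (limn s)); apply: cvgB => //; exact: cvg_cst.
move=> N x; rewrite -shell_sum_window.
apply: (csum_tail (zasum_asum (zasum_fexp x))) => K.
rewrite lerBrDl; apply: le_trans (nondecreasing_cvgn_le sm sc (N + K)%N).
rewrite sS lerD2l; apply: ler_sum => n _.
apply: le_trans (normc_sum _ _ _) _; apply: ler_sum => j _.
by rewrite normcM normc_fexp mulr1.
Qed.

Lemma circ_int_synth g : Cmeas g -> Cintble g ->
  circ_int (fun x => synth a x * g x) = zsum (fun k => a k * circ_int (fun x => fexp k x * g x)).
Proof.
move=> mg hg; apply/esym/zsumP.
have [T T0 hT] := synth_tail.
have hn := Rintble_normc mg hg.
have h : (2 * \int[mu]_(x in I01) normc (g x)) * T n @[n --> \oo] -->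
   (2 * \int[mu]_(x in I01) normc (g x)) * (0:R).
  by apply: cvgM T0; exact: cvg_cst.
rewrite mulr0 in h.
apply: (squeeze_cvgr _ (cvg_cst (0:R)) h); apply: nearW => N.
rewrite normc_ge0 /= normc_distC -circ_int_trig_sum//.
have cs : Cintble (fun x => synth a x * g x).
  by under eq_fun do rewrite mulrC; apply: CintbleM => //; [exact: Cmeas_synth|exact: Cbounded_synth].
have cp : Cintble (fun x => (\sum_(k <- window N) a k * fexp k x) * g x).
  under eq_fun do rewrite mulrC; apply: CintbleM => //; first exact: Cmeas_trig_sum.
  exists M => x; apply: le_trans (normc_sum _ _ _) _.
  by apply: (zasum_fexp x); exact: uniq_window.
rewrite -circ_intB//.
have := @circ_int_le (fun x => synth a x * g x - (\sum_(k <- window N) a k * fexp k x) * g x)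
  (fun x => normc (g x)) (T N).
rewrite mulrA mulrAC; apply => //.
- by apply: CmeasB; apply: CmeasM => //; [exact: Cmeas_synth|exact: Cmeas_trig_sum].
- move=> x _; rewrite -mulrBl normcM; apply: ler_wpM2r (hT N x); exact: normc_ge0.
Qed.

End synth.

Lemma integral_of_derivative (F f : R -> R) : (forall x : R, is_derive x (1 : R) F (f x)) ->
  continuous f ->
  \int[mu]_(x in I01) f x = F 1 - F 0.
Proof.
move=> dF cf; rewrite /Rintegral.
have cF : continuous F.
  by move=> x; apply/differentiable_continuous/derivable1_diffP; case: (dF x).
rewrite (@continuous_FTC2 R f F 0 1) //.
- by apply: continuous_subspaceT.
- split; first by move=> x _; case: (dF x).
    by apply: cvg_at_right_filter; exact: cF.
  by apply: cvg_at_left_filter; exact: cF.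
- by move=> x _; rewrite derive1E; have [_ ->] := dF x.
Qed.

Lemma circ_int_fexp k : circ_int (fexp k : R -> R[i]) = (k == 0)%:R.
Proof.
case: eqP => [->|/eqP k0].
  rewrite /circ_int; under eq_Rintegral do rewrite fexp0.
  under [X in _ +i* X]eq_Rintegral do rewrite fexp0.
  have e : fine (mu I01) = 1 by rewrite measure_I01.
  by rewrite /= !Rintegral_cst// e mulr1 mul0r.
have c0 : twopi * k%:~R != 0 :> R by rewrite mulf_neq0 ?intr_eq0// gt_eqF// twopi_gt0.
have [] : complex.Re (fexp k 1 : R[i]) = 1 /\ complex.Im (fexp k 1 : R[i]) = 0 by rewrite fexp_at1.
rewrite fexpE mulr1 /= => hc hs.
rewrite /circ_int; under eq_Rintegral do rewrite fexpE /=.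
under [X in _ +i* X]eq_Rintegral do rewrite fexpE /=.
set c := twopi * k%:~R in c0 hc hs *.
have d1 (x : R) : is_derive x (1 : R) (fun x => c^-1 * sin (c * x)) (cos (c * x)).
  have := is_deriveZ c^-1 (is_derive_sin_scale c x).
  by rewrite /GRing.scale /= mulrA mulVf// mul1r.
have d2 (x : R) : is_derive x (1 : R) (fun x => - c^-1 * cos (c * x)) (sin (c * x)).
  have := is_deriveZ (- c^-1) (is_derive_cos_scale c x).
  by rewrite /GRing.scale /= mulrA mulrNN mulVf// mul1r.
rewrite (integral_of_derivative d1 (@continuous_cos_scale c)) (integral_of_derivative d2
  (@continuous_sin_scale c)).
by rewrite !mulr1 !mulr0 hc hs cos0 sin0 !mulr0 !subrr.
Qed.

Lemma fcoef_synth a M k : zasum a M -> fcoef (synth a) k = a k.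
Proof.
move=> ha; rewrite /fcoef (circ_int_synth ha (Cmeas_fexp _) (Cintble_bounded (Cmeas_fexp _)
  (Cbounded_fexp _))).
rewrite (@zsum_single _ k) => [|j jk].
  under eq_fun do rewrite -fexpD addrN.
  by rewrite circ_int_fexp eqxx mulr1.
under eq_fun do rewrite -fexpD.
by rewrite circ_int_fexp subr_eq0 (negbTE jk) mulr0.
Qed.

End CircleIntegration.

(** * Completeness of the exponentials *)

Section Completeness.
Context {R : realType}.
Implicit Types (k j l : int) (f g : R -> R[i]).
Local Notation mu := (@lebesgue_measure R).
Local Notation I01 := (`[0%R, 1%R]%classic : set R).

(** For [z] in [0, 1] these polynomials tend to 1 if [z < 1/2] and to 0 if [z > 1/2], by
   Bernoulli's inequality; composed with a trigonometric polynomial they cut out an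
   interval. *)
Definition step_poly (n : nat) (z : R) : R := (1 - z ^+ n) ^+ (2 ^ n)%N.

Lemma step_poly_ge0 n z : 0 <= z -> z <= 1 -> 0 <= step_poly n z.
Proof. by move=> z0 z1; rewrite exprn_ge0// subr_ge0 exprn_ile1. Qed.

Lemma step_poly_le1 n z : 0 <= z -> z <= 1 -> step_poly n z <= 1.
Proof.
move=> z0 z1; rewrite exprn_ile1// ?subr_ge0 ?exprn_ile1//.
by rewrite lerBlDr lerDl exprn_ge0.
Qed.

Lemma bernoulli_le (a : R) m : 0 <= a -> a <= 1 -> 1 - m%:R * a <= (1 - a) ^+ m.
Proof.
move=> a0 a1; elim: m => [|m IH]; first by rewrite mul0r subr0 expr0.
rewrite exprS -natr1; have : (1 - a) * (1 - m%:R * a) <= (1 - a) * (1 - a) ^+ m.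
  by apply: ler_wpM2l => //; lra.
apply: le_trans; have : 0 <= m%:R * (a * a) by rewrite !mulr_ge0.
by move: (m%:R : R) => x; lra.
Qed.

(** From [(1 - a)^m (1 + a)^m <= 1] and [1 + m a <= (1 + a)^m]. *)
Lemma bernoulli_ge (a : R) m : 0 <= a -> a <= 1 -> (1 - a) ^+ m * (m%:R * a) <= 1.
Proof.
move=> a0 a1; have h : 1 + m%:R * a <= (1 + a) ^+ m.
  elim: m => [|m IH]; first by rewrite mul0r addr0 expr0.
  rewrite exprS -natr1; have : (1 + a) * (1 + m%:R * a) <= (1 + a) * (1 + a) ^+ m.
    by apply: ler_wpM2l => //; lra.
  apply: le_trans; have : 0 <= m%:R * (a * a) by rewrite !mulr_ge0.
  by move: (m%:R : R) => x; lra.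
have p0 : 0 <= (1 - a) ^+ m by rewrite exprn_ge0// subr_ge0.
apply: (@le_trans _ _ ((1 - a) ^+ m * (1 + a) ^+ m)).
  by apply: ler_wpM2l => //; apply: le_trans h; rewrite lerDr.
rewrite -exprMn; apply: exprn_ile1; [nra|nra].
Qed.

Lemma step_poly_cvg1 (z : R) : 0 <= z -> z < 2^-1 -> step_poly n z @[n --> \oo] --> (1:R).
Proof.
move=> z0 z1.
have h : 1 - (2 * z) ^+ n @[n --> \oo] --> 1 - (0:R).
  apply: cvgB; first exact: cvg_cst.
  by apply: cvg_expr; rewrite ger0_norm; lra.
rewrite subr0 in h.
apply: (squeeze_cvgr _ h (cvg_cst (1:R))); apply: nearW => n.
rewrite step_poly_le1//; last by lra.
have := @bernoulli_le (z ^+ n) (2 ^ n)%N.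
rewrite andbT natrX exprMn; apply; first exact: exprn_ge0.
by apply: exprn_ile1; lra.
Qed.

Lemma step_poly_cvg0 (z : R) : 2^-1 < z -> z <= 1 -> step_poly n z @[n --> \oo] --> (0:R).
Proof.
move=> z0 z1; have zp : 0 < z by lra.
have h : (2 * z)^-1 ^+ n @[n --> \oo] --> (0:R).
  apply: cvg_expr; rewrite ger0_norm; last by rewrite invr_ge0; lra.
  by rewrite invf_lt1; lra.
apply: (squeeze_cvgr _ (cvg_cst (0:R)) h); apply: nearW => n.
rewrite step_poly_ge0//=; last by lra.
have zn0 : 0 <= z ^+ n by rewrite exprn_ge0// ltW.
have zn1 : z ^+ n <= 1 by apply: exprn_ile1 => //; exact: ltW.
have := bernoulli_ge (2 ^ n)%N zn0 zn1.
rewrite natrX -exprMn -/(step_poly n z) exprVn -ler_pdivlMr ?mul1r//.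
by rewrite exprn_gt0// mulr_gt0.
Qed.

Section annihilator.
Variable f : R -> R[i].
Hypotheses (mf : Cmeas f) (cf : Cintble f).
Hypothesis f0 : forall k, circ_int (fun x => f x * fexp k x) = 0.

(** The functions [p] such that [f p] is orthogonal to all exponentials form a
   module over the trigonometric polynomials, which contains 1 when [f] itself is
   orthogonal to them. *)
Definition annihilated (p : R -> R[i]) :=
  [/\ Cmeas p, Cbounded p & forall k, circ_int (fun x => f x * p x * fexp k x) = 0].

Let annihilated_Cintble p k : Cmeas p -> Cbounded p -> Cintble (fun x => f x * p x * fexp k x).
Proof.
move=> mp bp; apply: CintbleM; [exact: CmeasM|exact: CintbleM|exact: Cmeas_fexp|exact: Cbounded_fexp].
Qed.

Lemma annihilatedD p q : annihilated p -> annihilated q -> annihilated (fun x => p x + q x).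
Proof.
move=> [mp [M hM] h1] [mq [N hN] h2]; split; first exact: CmeasD.
  by exists (M + N) => x; apply: le_trans (le_normcD _ _) _; rewrite lerD.
move=> k; rewrite -[RHS](addr0 0) -[X in _ = X + _](h1 k) -[X in _ = _ + X](h2 k).
rewrite -circ_intD; [|by apply: annihilated_Cintble => //;
  exists M|by apply: annihilated_Cintble => //; exists N].
by congr circ_int; apply/funext => x; ring.
Qed.

Lemma annihilatedZ (c : R[i]) p : annihilated p -> annihilated (fun x => c * p x).
Proof.
move=> [mp [M hM] h1]; split; first exact: CmeasZ.
  exists (normc c * M) => x; rewrite normcM; apply: ler_wpM2l (hM x); exact: normc_ge0.
move=> k; rewrite -[RHS](mulr0 c) -(h1 k) -circ_intZ; last by apply: annihilated_Cintble => //;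
  exists M.
by congr circ_int; apply/funext => x; ring.
Qed.

Lemma annihilated_fexp j p : annihilated p -> annihilated (fun x => fexp j x * p x).
Proof.
move=> [mp [M hM] h1]; split; first by apply: CmeasM => //; exact: Cmeas_fexp.
  by exists M => x; rewrite normcM normc_fexp mul1r.
move=> k; rewrite -(h1 (j + k)); congr circ_int; apply/funext => x.
by rewrite fexpD; ring.
Qed.

Lemma annihilated1 : annihilated (fun=> 1).
Proof.
split; [exact: Cmeas_cst|by exists 1 => x; rewrite normc1|move=> k].
by rewrite -(f0 k); congr circ_int; apply/funext => x; rewrite mulr1.
Qed.

Variable b : R.
Hypotheses (b0 : 0 < b) (b1 : b < 1).

(** A trigonometric polynomial that takes values between 0 and 1 and whose points above [1/2] in
   the unit interval are those between 0 and [b]: the product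
   of sines is positive on [0 < x < b] and negative on [b < x < 1]. *)
Definition bump (x : R) : R := 2^-1 + sin (pi * x) * sin (pi * (b - x)) / 2.

(** The coefficient of [fexp 1] in [bump], see [bumpE]. *)
Definition bump_coef : R[i] := (cos (pi * b) / 8) +i* (- (sin (pi * b) / 8)).

Lemma bumpE x : (bump x)%:C = (2^-1 - cos (pi * b) / 4)%:C * 1 +
   bump_coef * (fexp 1 x * 1) + conjc bump_coef * (fexp (-1) x * 1).
Proof.
have e : sin (pi * x) * sin (pi * (b - x)) =
   (cos (pi * b) * cos (2 * (pi * x)) + sin (pi * b) * sin (2 * (pi * x)) - cos (pi * b)) / 2.
  rewrite mulrBr sinB mulr_natl cos_mulr2n sin_mulr2n.
  have := cos2Dsin2 (pi * x); move: (cos (pi * x)) (sin (pi * x)) (cos (pi * b)) (sin (pi *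
    b)) => C S c d h.
  have h2 : C ^+ 2 = 1 - S ^+ 2 by rewrite -h; ring.
  have -> : C ^+ 2 *+ 2 - 1 = 1 - 2 * S ^+ 2 by rewrite h2; ring.
  by field.
rewrite fexpN !mulr1 fexpE /bump e twopiE mulr1 -(mulrA 2 pi x).
apply/eqP; rewrite eq_complex /=; apply/andP; split; apply/eqP; by field.
Qed.

Lemma annihilated_bump p : annihilated p -> annihilated (fun x => (bump x)%:C * p x).
Proof.
move=> h; have := annihilatedD (annihilatedD (annihilatedZ (2^-1 - cos (pi *
  b) / 4)%:C h) (annihilatedZ bump_coef (annihilated_fexp 1 h)))
  (annihilatedZ (conjc bump_coef) (annihilated_fexp (-1) h)).
have -> // : (fun x => (2^-1 - cos (pi * b) / 4)%:C * p x + bump_coef * (fexp 1 x * p x) +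
   bump_coef^*%C * (fexp (-1) x * p x)) = (fun x => (bump x)%:C * p x).
apply/funext => x; rewrite bumpE; ring.
Qed.

Lemma annihilated_bumpX n p : annihilated p -> annihilated (fun x => (bump x)%:C ^+ n * p x).
Proof.
elim: n p => [|n IH] p h; first by under eq_fun do rewrite expr0 mul1r.
by under eq_fun do rewrite exprSr -mulrA; apply: IH; exact: annihilated_bump.
Qed.

Lemma annihilated_step n : annihilated (fun x => (step_poly n (bump x))%:C).
Proof.
have h m : annihilated (fun x => (1 - (bump x)%:C ^+ n) ^+ m * 1).
  elim: m => [|m IH]; first by under eq_fun do rewrite expr0 mul1r; exact: annihilated1.
  have := annihilatedD IH (annihilatedZ (-1) (annihilated_bumpX n IH)).
  congr annihilated; apply/funext => x; rewrite exprS; ring.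
have := h (2 ^ n)%N; congr annihilated; apply/funext => x.
by rewrite /step_poly mulr1 !(rmorphXn, rmorphB, rmorph1) /=.
Qed.

Lemma sinpi_gt0 (y : R) : 0 < y -> y < 1 -> 0 < sin (pi * y).
Proof.
by move=> y0 y1; apply: sin_gt0_pi; rewrite mulr_gt0 ?pi_gt0//= -[ltRHS]mulr1 ltr_pM2l ?pi_gt0.
Qed.

Lemma bump_bounds x : 0 <= bump x <= 1.
Proof.
have := sin_geN1 (pi * x); have := sin_le1 (pi * x).
have := sin_geN1 (pi * (b - x)); have := sin_le1 (pi * (b - x)).
rewrite /bump; move: (sin _) (sin _) => y z *; apply/andP; split; nra.
Qed.

Lemma bump_gt x : 0 < x -> x < b -> 2^-1 < bump x.
Proof.
have b1' := b1; move=> x0 xb; rewrite /bump ltrDl divr_gt0// mulr_gt0// sinpi_gt0//; lra.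
Qed.

Lemma bump_lt x : b < x -> x < 1 -> bump x < 2^-1.
Proof.
have b0' := b0; move=> x0 xb; have h1 : 0 < sin (pi * x) by apply: sinpi_gt0; lra.
have h2 : 0 < sin (pi * (x - b)) by apply: sinpi_gt0; lra.
rewrite /bump -opprB mulrN sinN mulrN mulNr gtrDl oppr_lt0 divr_gt0// mulr_gt0//.
Qed.

Lemma ae_neq (c : R) : \forall x \ae mu, x != c.
Proof.
exists [set c]; split => //; first by rewrite lebesgue_measure_set1.
by move=> x /= /negP; rewrite negbK => /eqP.
Qed.

(** [1 - step_poly n (bump x)] tends to the indicator function of the interval from 0 to [b],
   and dominated convergence passes to the limit. *)
Lemma step_limit (g : R -> R) : measurable_fun setT g -> Rintble g ->
  (forall n, \int[mu]_(x in I01) (g x * step_poly n (bump x)) = 0) ->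
  \int[mu]_(x in I01) g x = 0 ->
  \int[mu]_(x in `[0, b]) g x = 0.
Proof.
move=> mg hg h0 hg0.
have mz : measurable_fun setT bump.
  apply: continuous_measurable_fun => x; apply: cvgD; first exact: cvg_cst.
  apply: cvgM; last exact: cvg_cst.
  apply: cvgM; first exact: continuous_sin_scale.
  have := @continuous_comp _ _ _ (fun y => b - y) (fun y => sin (pi * y)) x.
  by apply; [apply: cvgB; [exact: cvg_cst|exact: cvg_id]|exact: continuous_sin_scale].
have ms n : measurable_fun setT (fun x => step_poly n (bump x)).
  apply: measurable_funX; apply: measurable_funB; first exact: measurable_cst.
  exact: measurable_funX.
have ms' n : measurable_fun setT (fun x => 1 - step_poly n (bump x)).
  by apply: measurable_funB; [exact: measurable_cst|exact: ms].
pose fn n x := (g x * (1 - step_poly n (bump x)))%:E.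
pose fl x := ((g \_ `[0%R, b]) x)%:E.
have mb : measurable (`[0%R, b]%classic : set (measurableTypeR R)) by exact: measurable_itv.
have mgb : measurable_fun setT (g \_ `[0%R, b]).
  by apply/(measurable_restrictT _ _).1 => //; exact: measurable_funTS.
have [] := @dominated_convergence _ _ _ mu I01 measurable_I01 fn fl (fun x => `|g x|%:E).
- move=> n; apply/measurable_EFinP/measurable_funTS/measurable_funM => //; exact: ms'.
- exact/measurable_EFinP/measurable_funTS.
- apply: ae_imply2 (ae_neq b) _ => [x xb|]; last first.
    apply: ae_imply2 (ae_neq 0) (ae_neq 1) => x x0 x1; exact: conj x0 x1.
  move=> [x0 x1]; rewrite /= in_itv /= => /andP[xg0 xl1].
  have {x0 xg0}x0 : 0 < x by rewrite lt_neqAle eq_sym x0.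
  have {x1 xl1}x1 : x < 1 by rewrite lt_neqAle x1.
  have /andP[z0 z1] := bump_bounds x.
  apply/cvg_EFin; first by apply: nearW.
  rewrite /fn /fl /comp /= patchE.
  case: (ltgtP x b) xb => // xb _.
  + rewrite ifT ?inE/= ?in_itv/= ?(ltW x0) ?(ltW xb)// -[X in _ --> X]mulr1.
    apply: cvgM; first exact: cvg_cst.
    rewrite -[X in _ --> X]subr0; apply: cvgB; first exact: cvg_cst.
    by apply: step_poly_cvg0 => //; exact: bump_gt.
  + rewrite ifF; last by apply/negbTE; rewrite notin_setE /= in_itv /= => /andP[_]; rewrite leNgt xb.
    rewrite -[X in _ --> X](mulr0 (g x)); apply: cvgM; first exact: cvg_cst.
    rewrite -(subrr 1); apply: cvgB; first exact: cvg_cst.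
    by apply: step_poly_cvg1 => //; exact: bump_lt.
- exact: integrable_norm.
- apply: ae_imply1 (ae_neq 0) => x _ n _; rewrite /fn /= lee_fin normrM.
  have /andP[z0 z1] := bump_bounds x.
  have s0 := step_poly_ge0 n z0 z1; have s1 := step_poly_le1 n z0 z1.
  rewrite -[leRHS]mulr1; apply: ler_wpM2l => //.
  rewrite ger0_norm; lra.
move=> ifl _ hlim.
have hs n : Rintble (fun x => g x * step_poly n (bump x)).
  have hng : Rintble (fun x => `|g x|) by exact: integrable_norm.
  apply: Rintble_dom hng _; first exact: measurable_funM.
  move=> x _; have /andP[z0 z1] := bump_bounds x.
  have s0 := step_poly_ge0 n z0 z1; have s1 := step_poly_le1 n z0 z1.
  rewrite normrM -[leRHS]mulr1; apply: ler_wpM2l => //; rewrite ger0_norm//.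
have e0 n : (\int[mu]_(x in I01) fn n x = 0)%E.
  have hr : Rintble (fun x => g x * (1 - step_poly n (bump x))).
    by under eq_fun do rewrite mulrBr mulr1; exact: RintbleB.
  rewrite -[LHS]fineK; last exact: integrable_fin_num hr.
  congr (_%:E); rewrite -[LHS]/(\int[mu]_(x in I01) (g x * (1 - step_poly n (bump x)))).
  under eq_Rintegral do rewrite mulrBr mulr1.
  rewrite (RintegralB measurable_I01 hg (hs n)); apply/eqP; rewrite subr_eq0; apply/eqP.
  by transitivity (0 : R); [exact: hg0|exact/esym/h0].
have e1 : (\int[mu]_(x in I01) fl x = 0)%E.
  move: hlim; under eq_fun do rewrite e0; move=> h.
  by have := cvg_unique _ h (cvg_cst 0%E); apply.
have -> : \int[mu]_(x in `[0, b]) g x = \int[mu]_(x in I01) (g \_ `[0%R, b]) x.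
  rewrite -Rintegral_mkcondr; congr Rintegral; apply/seteqP; split => x /=.
    by rewrite !in_itv /= => /andP[-> h]; rewrite h (le_trans h (ltW b1)).
  by case.
by rewrite /Rintegral -/fl e1.
Qed.

(** The step polynomials are annihilated, so [step_limit] applies to both parts of [f]. *)
Lemma annihilated_primitive :
  \int[mu]_(x in `[0, b]) complex.Re (f x) = 0 /\ \int[mu]_(x in `[0, b]) complex.Im (f x) = 0.
Proof.
have h n := let: And3 _ _ h := annihilated_step n in h 0.
have h1 := let: And3 _ _ h := annihilated1 in h 0.
split; apply: step_limit; try exact: cf.1; try exact: cf.2; try exact: mf.1; try exact: mf.2.
- move=> n; have e := congr1 (@complex.Re R) (h n); rewrite /circ_int /= in e.
  by apply: etrans e; apply: eq_Rintegral => x _; rewrite fexp0 mulr1 ReM /= mulr0 subr0.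
- have e := congr1 (@complex.Re R) h1; rewrite /circ_int /= in e.
  by apply: etrans e; apply: eq_Rintegral => x _; rewrite fexp0 !mulr1.
- move=> n; have e := congr1 (@complex.Im R) (h n); rewrite /circ_int /= in e.
  by apply: etrans e; apply: eq_Rintegral => x _; rewrite fexp0 mulr1 ImM /= mulr0 add0r.
- have e := congr1 (@complex.Im R) h1; rewrite /circ_int /= in e.
  by apply: etrans e; apply: eq_Rintegral => x _; rewrite fexp0 !mulr1.
Qed.

End annihilator.

(** Lebesgue's differentiation theorem. *)
Lemma primitive0_ae (g : R -> R) : measurable_fun setT g -> Rintble g ->
  (forall b, 0 < b -> b < 1 -> \int[mu]_(x in `[0, b]) g x = 0) ->
  \forall x \ae mu, 0 < x -> x < 1 -> g x = 0.
Proof.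
move=> mg hg h0.
have hl := lebesgue_differentiation (integrable_locally_restrict measurable_I01 hg).
apply: ae_imply1 hl => x hx x0 x1.
have hr : mu.-integrable [set` `[0%R, 1%R]] (EFin \o (g \_ I01)).
  rewrite -restrict_EFin; apply/(integrable_restrict mu _ _ _).1 => //.
  by rewrite setIid.
have hb : (BLeft (0%R : R) < BRight x)%E by rewrite /= lte_fin.
have [_] := FTC1_lebesgue_pt x1 hr hb hx.
rewrite patchE ifT ?inE/= ?in_itv/= ?(ltW x0) ?(ltW x1)// => <-.
rewrite derive1E.
have hn : \forall y \near x, \int[mu]_(t in `[0, y]) (g \_ I01) t = (fun=> 0) y.
  near=> y.
  have y0 : 0 < y by near: y; exact: lt_nbhsr.
  have y1 : y < 1 by near: y; exact: lt_nbhsl.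
  apply: etrans (h0 y y0 y1); apply: eq_Rintegral => t; rewrite inE /= in_itv /= => /andP[t0 ty].
  by rewrite patchE ifT// inE /= in_itv /= t0 (le_trans ty (ltW y1)).
by rewrite (near_eq_derive _ hn) derive_cst.
Unshelve. all: by end_near. Qed.

Lemma measurable_subr (c : R) :
  measurable_fun setT ((fun x => x - c) : measurableTypeR R -> measurableTypeR R).
Proof.
apply: continuous_measurable_fun => x; apply: cvgB; [exact: cvg_id|exact: cvg_cst].
Qed.

Lemma lebesgue_measure_shift (c : R) (A : set R) : measurable (A : set (measurableTypeR R)) ->
  pushforward mu ((fun x => x - c) : measurableTypeR R -> measurableTypeR R) A = mu A.
Proof.
move=> mA; apply/esym/lebesgue_measure_unique => //=; first exact: measurable_subr.
move=> mf _ [[a b]] _ <-; rewrite /pushforward.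
rewrite [X in _ = mu X](_ : _ = `]a + c, b + c]%classic); last first.
  by apply/seteqP; split => x /=; rewrite !in_itv /= ltrBrDr lerBlDr.
rewrite !lebesgue_measure_itv/= !lte_fin ltrD2r.
by case: ifP => // _; rewrite -!EFinB opprD addrACA subrr addr0.
Qed.

Lemma negligible_shift (A : set R) (c : R) : mu.-negligible A ->
  mu.-negligible [set x | A (x - c)].
Proof.
move=> [B [mB B0 AB]]; exists [set x | B (x - c)]; split.
- by rewrite -[X in measurable X]setTI; apply: measurable_subr.
- by rewrite -B0 -(lebesgue_measure_shift c mB).
- by move=> x /= /AB.
Qed.

Lemma periodicZ (T : Type) (f : R -> T) (k : int) x : (forall x, f (x + 1) = f x) ->
  f (x + k%:~R) = f x.
Proof.
move=> h; have hn n y : f (y + n%:R) = f y.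
  elim: n => [|n IH]; first by rewrite addr0.
  by rewrite -natr1 addrA h.
case: k => n; first by rewrite -pmulrn hn.
by rewrite NegzE intrN -pmulrn -(hn n.+1 (x - n.+1%:R)) subrK.
Qed.

(** The real line is covered by the integer translates of the open unit interval and the
   integers, and the measure is invariant under translation. *)
Lemma ae0_periodic (P : R -> Prop) : (forall x, P (x + 1) = P x) ->
  (\forall x \ae mu, 0 < x -> x < 1 -> P x) -> \forall x \ae mu, P x.
Proof.
move=> hP h.
have hk k : \forall x \ae mu, k%:~R < x -> x < k%:~R + 1 -> P x.
  have := negligible_shift k%:~R h; apply: negligibleS => x /= hx hh; apply: hx => h1 h2.
  have := hh; rewrite -(periodicZ (- k) x hP) intrN; apply; lra.
have hn k : \forall x \ae mu, x != k%:~R by exact: ae_neq.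
(* a countable union, enumerated through the encoding of integers by naturals *)
have hall : \forall x \ae mu, forall k : int, (k%:~R < x -> x < k%:~R + 1 -> P x) /\ x != k%:~R.
  have : mu.-negligible (\bigcup_n (~` [set x | (forall k : int, unpickle n = Some k ->
    (k%:~R < x -> x < k%:~R + 1 -> P x) /\ x != k%:~R)])).
    apply: negligible_bigcup => n; case e : (unpickle n : option int) => [k|].
      have := ae_imply2 (fun x => @conj _ _) (hk k) (hn k).
      by apply: ae_imply1 => x hx k' [<-].
    by apply: ae_imply1 (hn 0) => x _ k.
  apply: negligibleS => x /= hx; apply: contrapT => hx2; apply: hx => k.
  apply: contrapT => hk2; apply: hx2; exists (pickle k) => //= h3; apply: hk2.
  by apply: h3; rewrite pickleK.
apply: ae_imply1 hall => x hx.
have [h1 _] := hx (Num.floor x).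
have [_ h2] := hx (Num.floor x).
apply: h1; last by rewrite -[X in _ + X]/(1%:~R) -intrD floorD1_gt.
by rewrite lt_neqAle eq_sym h2 floor_le.
Qed.

(** Approximating indicator functions of intervals by trigonometric polynomials shows that
   all primitives of [f] vanish; differentiation and periodicity conclude. *)
Lemma fcoef0_ae f : periodic f 1 -> Cmeas f -> Cintble f -> (forall k, fcoef f k = 0) ->
  f = (fun=> 0) %[ae mu].
Proof.
move=> pf mf cf h.
have h0 k : circ_int (fun x => f x * fexp k x) = 0.
  by rewrite -(opprK k); exact: h.
have hr := primitive0_ae mf.1 cf.1 (fun b b0 b1 => (annihilated_primitive mf cf h0 b0 b1).1).
have hi := primitive0_ae mf.2 cf.2 (fun b b0 b1 => (annihilated_primitive mf cf h0 b0 b1).2).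
have : \forall x \ae mu, 0 < x -> x < 1 -> f x = 0.
  apply: ae_imply2 hr hi => x h1 h2 x0 x1.
  by apply/eqP; rewrite eq_complex h1// h2// !eqxx.
move=> /(ae0_periodic (fun x => congr1 (fun z => z = 0) (pf x))).
by apply: ae_imply1.
Qed.

End Completeness.

(** * Operations on functions and on their Fourier coefficients *)

Section Coefficients.
Context {R : realType}.
Implicit Types (k j l : int) (f g : R -> R[i]) (a b : int -> R[i]).
Local Notation mu := (@lebesgue_measure R).
Local Notation I01 := (`[0%R, 1%R]%classic : set R).

Lemma expwD (d e : R) k : expw (d + e) k = expw d k * expw e k.
Proof. by rewrite /expw -expRD; congr expR; ring. Qed.

Lemma bracketX_expw (n : nat) (d : R) : 0 < d -> exists2 C : R, 0 < C & forall k,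
  bracket k ^+ n * expw d k <= C.
Proof.
move=> d0; case: n => [|n].
  by exists 1 => // k; rewrite expr0 mul1r expw_le1// ltW.
(* one share of the exponential weight for each of the [n+1] brackets *)
pose g : R := twopi * d / n.+1%:R.
have g0 : 0 < g by rewrite divr_gt0 ?ltr0n// mulr_gt0// twopi_gt0.
have C0 : 0 < 1 + g^-1 by rewrite addr_gt0// invr_gt0.
exists ((1 + g^-1) ^+ n.+1); first exact: exprn_gt0.
move=> k; have -> : expw d k = expR (- (g * absr k)) ^+ n.+1.
  rewrite -expRM_natl /expw; congr expR; rewrite /g; field.
  by rewrite addrC natr1 pnatr_eq0.
rewrite -exprMn; apply: lerXn2r; rewrite ?nnegrE ?(ltW C0) ?mulr_ge0 ?expR_ge0 ?(ltW (bracket_gt0 _))//.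
exact: bracket_loss.
Qed.

(** The radius is existential: in this part only qualitative closure properties matter. *)
Definition exp_decay a := exists d A, 0 < d /\ forall k, normc (a k) <= A * expw d k.

Lemma exp_decay_bracket n a : exp_decay a -> exists d A, [/\ 0 < d, 0 <= A &
  forall k, normc (a k) <= A * bracket k ^- n * expw d k].
Proof.
move=> [d [A [d0 h]]]; have d2 : 0 < d / 2 by rewrite divr_gt0.
have [C C0 hC] := bracketX_expw n d2.
have A0 : 0 <= A.
  have := le_trans (normc_ge0 _) (h 0); by rewrite pmulr_lge0// expw_gt0.
exists (d / 2), (A * C); split => //; first by rewrite mulr_ge0// ltW.
move=> k; apply: le_trans (h k) _; rewrite -!mulrA; apply: ler_wpM2l => //.
rewrite {1}(splitr d) expwD.
rewrite mulrA; apply: ler_wpM2r; first exact/ltW/expw_gt0.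
by rewrite ler_pdivlMr ?exprn_gt0 ?bracket_gt0// mulrC.
Qed.

Lemma wbound_exp_decay (d A : R) a : 0 < d -> wbound d A a -> exp_decay a.
Proof.
move=> d0 h; exists d, A; split => // k; apply: le_trans (h k) _.
rewrite /wgt mulrA; apply: ler_wpM2r; first exact/ltW/expw_gt0.
rewrite -[leRHS]mulr1; apply: ler_wpM2l; [exact: wbound_ge0 h|exact: bracketXV_le1].
Qed.

Lemma exp_decay_zasum a : exp_decay a -> exists M, zasum a M.
Proof.
move=> /(exp_decay_bracket 2) [d [A [d0 A0 h]]]; exists (A * 3) => s us.
apply: (@le_trans _ _ (\sum_(j <- s) A * bracket j ^- 2)).
  apply: ler_sum => j _; apply: le_trans (h j) _; rewrite -[leRHS]mulr1.
  apply: ler_wpM2l; first by rewrite mulr_ge0// bracketXV_ge0.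
  by rewrite expw_le1// ltW.
by rewrite -mulr_sumr; apply: ler_wpM2l (sum_bracketV2 us).
Qed.

Lemma exp_decayW a b (C : R) : 0 <= C -> exp_decay a -> (forall k, normc (b k) <= C *
  normc (a k)) -> exp_decay b.
Proof.
move=> C0 [d [A [d0 h]]] hb; exists d, (C * A); split => // k.
by apply: le_trans (hb k) _; rewrite -mulrA; apply: ler_wpM2l.
Qed.

Lemma exp_decayD a b : exp_decay a -> exp_decay b -> exp_decay (fun k => a k + b k).
Proof.
move=> [d [A [d0 h]]] [e [B [e0 hB]]].
have A0 : 0 <= A by have := le_trans (normc_ge0 _) (h 0); rewrite pmulr_lge0// expw_gt0.
have B0 : 0 <= B by have := le_trans (normc_ge0 _) (hB 0); rewrite pmulr_lge0// expw_gt0.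
exists (Num.min d e), (A + B); split; first by rewrite lt_min d0.
move=> k; apply: le_trans (le_normcD _ _) _; rewrite mulrDl; apply: lerD.
- by apply: le_trans (h k) _; apply: ler_wpM2l => //; apply: expw_anti; rewrite ge_min lexx.
- by apply: le_trans (hB k) _; apply: ler_wpM2l => //; apply: expw_anti; rewrite ge_min lexx orbT.
Qed.

Lemma exp_decayZ (c : R[i]) a : exp_decay a -> exp_decay (fun k => c * a k).
Proof.
move=> h; apply: (@exp_decayW _ _ (normc c) (normc_ge0 _) h) => k; by rewrite normcM.
Qed.

Lemma exp_decay_dx a : exp_decay a -> exp_decay (dx_coef a).
Proof.
move=> /(exp_decay_bracket 1) [d [A [d0 A0 h]]]; exists d, (twopi * A); split => // k.
by have := dx_coef_est A0 h k; rewrite expr0 invr1 mulr1.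
Qed.

Lemma normc_Ainv_symbol k : normc (Ainv_symbol k : R[i]) <= 1.
Proof.
rewrite /Ainv_symbol; case: eqP => [_|k0]; first by rewrite normc1.
have az1 : 1 <= absr k :> R by rewrite /absr -[1]/(1%:R) ler_nat lt0n absz_eq0; apply/eqP.
have h : 1 <= (twopi * absr k) ^+ 2 :> R.
  by apply: exprn_ege1; have := @twopi_ge1 R; nra.
by rewrite normcV normcR ger0_norm ?invf_le1//; lra.
Qed.

Lemma exp_decay_Ainv a : exp_decay a -> exp_decay (fun k => Ainv_symbol k * a k).
Proof.
move=> h; apply: (exp_decayW ler01 h) => k; rewrite normcM; apply: ler_wpM2r (normc_Ainv_symbol k).
exact: normc_ge0.
Qed.

Lemma conv_zasum a b : exp_decay a -> exp_decay b -> exists d M, 0 < d /\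
  forall k, zasum (fun j => a j * b (k - j)) (M * expw d k).
Proof.
move=> /(exp_decay_bracket 2) [d [A [d0 A0 h]]] /(exp_decay_bracket 2) [e [B [e0 B0 hB]]].
have m0 : 0 < Num.min d e by rewrite lt_min d0.
exists (Num.min d e), (6 * (A * B)); split => // k.
apply: (conv_est (f := fun j => A * bracket j ^- 2) (g := fun j => B * bracket j ^- 2)) => //.
- exact: ltW.
- exact: mulr_ge0.
- by move=> j; rewrite mulr_ge0// bracketXV_ge0.
- by move=> j; rewrite mulr_ge0// bracketXV_ge0.
- move=> j; apply: le_trans (h j) _; apply: ler_wpM2l; first by rewrite mulr_ge0// bracketXV_ge0.
  by apply: expw_anti; rewrite ge_min lexx.
- move=> j; apply: le_trans (hB j) _; apply: ler_wpM2l; first by rewrite mulr_ge0// bracketXV_ge0.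
  by apply: expw_anti; rewrite ge_min lexx orbT.
- move=> j; rewrite mulrACA; apply: ler_wpM2l; first exact: mulr_ge0.
  have := bracketXV_ge0 j 2 (R := R); have := bracketXV_ge0 (k - j) 2 (R := R).
  have := bracketXV_le1 (k - j) 2 (R := R).
  by move: (bracket j ^- 2) (bracket (k - j) ^- 2) => x y; nra.
Qed.

Lemma exp_decay_conv a b : exp_decay a -> exp_decay b -> exp_decay (conv a b).
Proof.
move=> ha hb; have [d [M [d0 h]]] := conv_zasum ha hb.
by exists d, M; split => // k; exact: zsum_le.
Qed.

(** * Functions with given coefficients *)

(** Equality holds almost everywhere only, because [dx] picks an arbitrary representative of
   the weak derivative. *)
Definition has_coefs f a := [/\ Cmeas f, f = synth a %[ae mu] & exp_decay a].

Lemma ae_forall (P : R -> Prop) : (forall x, P x) -> \forall x \ae mu, P x.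
Proof. by move=> h; apply: (@filterE _ _ (ae_filter_ringOfSetsType mu)). Qed.

Lemma has_coefs_Cmeas f a : has_coefs f a -> Cmeas f. Proof. by case. Qed.
Lemma has_coefs_decay f a : has_coefs f a -> exp_decay a. Proof. by case. Qed.

Lemma has_coefs_synth a : exp_decay a -> has_coefs (synth a) a.
Proof.
move=> h; split => //; last exact: ae_forall.
by have [M hM] := exp_decay_zasum h; exact: Cmeas_synth hM.
Qed.

Lemma fcoef_ae f g k : Cmeas f -> Cmeas g -> f = g %[ae mu] -> fcoef f k = fcoef g k.
Proof.
move=> mf mg h; apply: circ_int_ae; try by apply: CmeasM => //; exact: Cmeas_fexp.
by apply: ae_imply1 h => x /= h _; rewrite h.
Qed.

Lemma has_coefs_fcoef f a k : has_coefs f a -> fcoef f k = a k.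
Proof.
move=> [mf h e]; have [M hM] := exp_decay_zasum e.
by rewrite (fcoef_ae _ mf (Cmeas_synth hM) h) (fcoef_synth _ hM).
Qed.

Lemma L2_Cintble f : L2circle f -> Cintble f.
Proof.
move=> [_ mr mi h]; have mf : Cmeas f by [].
have hr : Rintble (fun x => normc (f x) ^+ 2).
  apply/integrableP; split.
    apply/measurable_EFinP/measurable_funTS/measurable_funX; exact: measurable_normc.
  apply: le_lt_trans h; rewrite le_eqVlt; apply/orP; left; apply/eqP.
  apply: eq_integral => x _ /=.
  by rewrite ger0_norm// exprn_ge0// normc_ge0.
apply: (Cintble_dom mf (RintbleD (Rintble_cst 1) hr)) => x _.
have := normc_ge0 (f x); move: (normc _) => y y0; nra.
Qed.

Lemma bounded_L2 f : periodic f 1 -> Cmeas f -> Cbounded f -> L2circle f.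
Proof.
move=> pf [mr mi] [M h]; split => //.
have M0 : 0 <= M by apply: le_trans (h 0); exact: normc_ge0.
have hr : Rintble (fun x => normc (f x) ^+ 2).
  apply: (@Rintble_bounded R _ (M ^+ 2)); first by apply: measurable_funX; exact: measurable_normc.
  move=> x _; rewrite ger0_norm ?exprn_ge0 ?normc_ge0//.
  by apply: lerXn2r; rewrite ?nnegrE ?normc_ge0.
have := integrable_lty measurable_I01 hr; by [].
Qed.

(** Completeness of the exponentials, applied to the difference with the sum of the series. *)
Lemma L2_has_coefs f a : L2circle f -> (forall k, fcoef f k = a k) -> exp_decay a -> has_coefs f a.
Proof.
move=> Lf hf e; have [M hM] := exp_decay_zasum e.
have [pf mr mi _] := Lf; have mf : Cmeas f by [].
split => //.
have ms := Cmeas_synth hM; have cs := Cintble_bounded ms (Cbounded_synth hM).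
have cf := L2_Cintble Lf.
have : (fun x => f x - synth a x) = (fun=> 0) %[ae mu].
  apply: fcoef0_ae.
  - by move=> x; rewrite pf (synth_periodic a x).
  - exact: CmeasB.
  - have : Cintble (fun x => f x + (-1) * synth a x) by apply: CintbleD => //; exact: CintbleZ.
    by under eq_fun do rewrite mulN1r.
  - move=> k; rewrite -(subrr (a k)) -{1}hf -(fcoef_synth k hM) /fcoef -circ_intB.
    + by congr circ_int; apply/funext => x; rewrite mulrBl.
    + by apply: CintbleM => //; [exact: Cmeas_fexp|exact: Cbounded_fexp].
    + by apply: CintbleM => //; [exact: Cmeas_fexp|exact: Cbounded_fexp].
by apply: ae_imply1 => x h _; apply/eqP; rewrite -subr_eq0; apply/eqP; exact: h.
Qed.

Lemma has_coefsD f g a b : has_coefs f a -> has_coefs g b -> has_coefs (fun x => f x +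
  g x) (fun k => a k + b k).
Proof.
move=> [mf hf ea] [mg hg eb]; split; [exact: CmeasD| |exact: exp_decayD].
have [M hM] := exp_decay_zasum ea; have [N hN] := exp_decay_zasum eb.
apply: ae_imply2 hf hg => x h1 h2 _; rewrite h1// h2//.
rewrite /synth -(zsumD (zasum_fexp hM x) (zasum_fexp hN x)).
by congr zsum; apply/funext => k; rewrite mulrDl.
Qed.

Lemma has_coefsZ (c : R[i]) f a : has_coefs f a -> has_coefs (fun x => c * f x) (fun k => c * a k).
Proof.
move=> [mf hf ea]; split; [exact: CmeasZ| |exact: exp_decayZ].
have [M hM] := exp_decay_zasum ea.
apply: ae_imply1 hf => x h1 _; rewrite h1//.
rewrite /synth -(zsumZ c (zasum_fexp hM x)).
by congr zsum; apply/funext => k; rewrite mulrA.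
Qed.

Lemma has_coefsB f g a b : has_coefs f a -> has_coefs g b -> has_coefs (fun x => f x - g x)
  (fun k => a k - b k).
Proof.
move=> hf /(has_coefsZ (-1)) hg; have := has_coefsD hf hg.
by under eq_fun do rewrite mulN1r; under [X in has_coefs _ X]eq_fun do rewrite mulN1r.
Qed.

(** Integrating the first series term by term against the second one. *)
Lemma has_coefsM f g a b : has_coefs f a -> has_coefs g b -> has_coefs (fun x => f x * g x) (conv a b).
Proof.
move=> [mf hf ea] [mg hg eb].
have [M hM] := exp_decay_zasum ea; have [N hN] := exp_decay_zasum eb.
have ma := Cmeas_synth hM; have mb := Cmeas_synth hN.
have h : has_coefs (fun x => synth a x * synth b x) (conv a b).
  apply: L2_has_coefs (exp_decay_conv ea eb).
  - apply: bounded_L2.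
    + by move=> x; rewrite (synth_periodic a x) (synth_periodic b x).
    + exact: CmeasM.
    + exists (M * N) => x; rewrite normcM; apply: ler_pM; rewrite ?normc_ge0//.
        exact: normc_synth_le.
      exact: normc_synth_le.
  - move=> k; rewrite /fcoef; under eq_fun do rewrite -mulrA.
    have mbk : Cmeas (fun x => synth b x * fexp (- k) x) by apply: CmeasM => //; exact: Cmeas_fexp.
    have cbk : Cintble (fun x => synth b x * fexp (- k) x).
      by apply: CintbleM => //; [exact: Cintble_bounded mb
        (Cbounded_synth hN)|exact: Cmeas_fexp|exact: Cbounded_fexp].
    rewrite (circ_int_synth hM mbk cbk) /conv; congr zsum; apply/funext => j; congr (_ * _).
    rewrite -(fcoef_synth (k - j) hN) /fcoef; congr circ_int; apply/funext => x.
    by rewrite mulrCA -fexpD opprB.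
case: h => mh h eh; split => //; first exact: CmeasM.
by have := ae_imply2 (fun x => @conj _ _) hf hg; apply: ae_imply2 h => x h1 [h2 h3] _;
  rewrite h2// h3// h1.
Qed.

(** * Weak derivatives and the equation *)

Lemma trig_derive1n (c A B : R) n : exists A' B', derive1n n (fun x => A * cos (c * x) +
  B * sin (c * x)) =
  (fun x => A' * cos (c * x) + B' * sin (c * x)).
Proof.
elim: n => [|n [A' [B' IH]]]; first by exists A, B.
exists (c * B'), (- c * A'); rewrite /derive1n iterS -/(derive1n n _) IH.
apply/funext => x; rewrite derive1E.
have [_ ->] := is_deriveD (is_deriveZ A' (is_derive_cos_scale c x)) (is_deriveZ B'
  (is_derive_sin_scale c x)).
by rewrite /GRing.scale /=; ring.
Qed.

Lemma trig_test_function (A B : R) k : test_function (fun x => A * cos (twopi * k%:~R * x) +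
  B * sin (twopi * k%:~R * x)).
Proof.
split=> [x|n x].
  have := @fexp_periodic R k x; rewrite !fexpE => -[-> ->]//.
have [A' [B' ->]] := trig_derive1n (twopi * k%:~R) A B n.
by have [] := is_deriveD (is_deriveZ A' (is_derive_cos_scale (twopi * k%:~R) x)) (is_deriveZ B'
  (is_derive_sin_scale (twopi * k%:~R) x)).
Qed.

Lemma trig_derive1 (c A B x : R) : derive1 (fun x => A * cos (c * x) + B * sin (c * x)) x =
  - c * A * sin (c * x) + c * B * cos (c * x).
Proof.
rewrite derive1E.
have [_ ->] := is_deriveD (is_deriveZ A (is_derive_cos_scale c x)) (is_deriveZ B
  (is_derive_sin_scale c x)).
by rewrite /GRing.scale /=; ring.
Qed.

Lemma test_function_continuous phi : test_function phi -> continuous phi /\ continuous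
  (derive1 phi : R -> R).
Proof.
move=> [_ h]; split => x; apply/differentiable_continuous/derivable1_diffP.
- exact: (h 0%N x).
- exact: (h 1%N x).
Qed.

Lemma continuous_Rintble (phi : R -> R) : continuous phi -> Rintble phi.
Proof.
move=> h; apply: continuous_compact_integrable; first exact: segment_compact.
exact: continuous_subspaceT.
Qed.

Lemma continuous_realfun (phi : R -> R) : continuous phi -> Cmeas (fun x => (phi x)%:C) /\ Cintble
  (fun x => (phi x)%:C).
Proof.
move=> h; split; split => /=.
- exact: continuous_measurable_fun.
- exact: measurable_cst.
- exact: continuous_Rintble.
- exact: Rintble_cst.
Qed.

Lemma circ_int_by_parts_fexp k (phi : R -> R) : test_function phi ->
  circ_int (fun x => fexp k x * (derive1 phi x)%:C) = - (dx_symbol k *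
    circ_int (fun x => fexp k x * (phi x)%:C)).
Proof.
move=> ht; have [c0 c1] := test_function_continuous ht.
have [m0 i0] := continuous_realfun c0; have [m1 i1] := continuous_realfun c1.
have cE (psi : R -> R) : continuous psi -> Cintble (fun x => fexp k x * (psi x)%:C).
  move=> /continuous_realfun [m i]; under eq_fun do rewrite mulrC.
  by apply: CintbleM => //; [exact: Cmeas_fexp|exact: Cbounded_fexp].
apply/eqP; rewrite -subr_eq0 opprK -circ_intZ; last exact: cE.
rewrite -circ_intD; [|exact: cE|by apply: CintbleZ; exact: cE].
have [pp hd] := ht.
have dphi (x : R) : is_derive x (1 : R) phi (derive1 phi x).
  by rewrite derive1E; apply: derivableP; exact: (hd 0%N x).
set c : R := twopi * k%:~R.
have e1 : phi 1 = phi 0 by rewrite -[1]add0r pp.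
have := @fexp_at1 R k; rewrite fexpE mulr1 -/c => -[hc hs].
have dc1 (x : R) : is_derive x (1 : R) (fun x => cos (c * x) * phi x) (cos (c * x) *
  derive1 phi x - c * sin (c * x) * phi x).
  have := is_deriveM (is_derive_cos_scale c x) (dphi x).
  by move=> h; apply: is_derive_eq; rewrite /GRing.scale /=; ring.
have ds1 (x : R) : is_derive x (1 : R) (fun x => sin (c * x) * phi x) (sin (c * x) *
  derive1 phi x + c * cos (c * x) * phi x).
  have := is_deriveM (is_derive_sin_scale c x) (dphi x).
  by move=> h; apply: is_derive_eq; rewrite /GRing.scale /=; ring.
have k1 : continuous (fun x : R => cos (c * x) * derive1 phi x - c * sin (c * x) * phi x).
  move=> x; apply: cvgB.
    by apply: cvgM; [exact: continuous_cos_scale|exact: c1].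
  by apply: cvgM; [apply: cvgM; [exact: cvg_cst|exact: continuous_sin_scale]|exact: c0].
have k2 : continuous (fun x : R => sin (c * x) * derive1 phi x + c * cos (c * x) * phi x).
  move=> x; apply: cvgD.
    by apply: cvgM; [exact: continuous_sin_scale|exact: c1].
  by apply: cvgM; [apply: cvgM; [exact: cvg_cst|exact: continuous_cos_scale]|exact: c0].
have r1 := integral_of_derivative dc1 k1; have r2 := integral_of_derivative ds1 k2.
rewrite !mulr1 !mulr0 hc hs cos0 sin0 e1 !mul1r !mul0r !subrr in r1 r2.
have e0 : (0 : R[i]) = 0 +i* 0 by [].
rewrite /circ_int e0; apply/eqP; congr (_ +i* _).
- apply: etrans r1; apply: eq_Rintegral => x _; rewrite fexpE -/c /dx_symbol -/c /=; ring.
- apply: etrans r2; apply: eq_Rintegral => x _; rewrite fexpE -/c /dx_symbol -/c /=; ring.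
Qed.

Lemma weak_derivative_synth f a : has_coefs f a -> weak_derivative f (synth (dx_coef a)).
Proof.
move=> [mf hf ea]; have ed1 := exp_decay_dx ea.
have [M hM] := exp_decay_zasum ea; have [N hN] := exp_decay_zasum ed1.
split.
  apply: bounded_L2; [exact: synth_periodic|exact: Cmeas_synth hN|exact: Cbounded_synth hN].
move=> phi ht; have [c0 c1] := test_function_continuous ht.
have [m0 i0] := continuous_realfun c0; have [m1 i1] := continuous_realfun c1.
have -> : circ_int (fun x => f x * (derive1 phi x)%:C) = circ_int (fun x => synth a x *
  (derive1 phi x)%:C).
  apply: circ_int_ae; [exact: CmeasM|apply: CmeasM => //; exact: Cmeas_synth hM|].
  by apply: ae_imply1 hf => x h _; rewrite h.
rewrite (circ_int_synth hM m1 i1) (circ_int_synth hN m0 i0) -[RHS]mulN1r.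
have hz : zasum (fun k => dx_coef a k * circ_int (fun x => fexp k x * (phi x)%:C))
   (2 * (1 * \int[mu]_(x in I01) normc (phi x)%:C) * N).
  move=> s us; apply: (@le_trans _ _ (\sum_(k <- s) 2 * (1 * \int[mu]_(x in I01) normc
    (phi x)%:C) * normc (dx_coef a k))).
    apply: ler_sum => k _; rewrite normcM mulrC; apply: ler_wpM2r; first exact: normc_ge0.
    apply: circ_int_le.
    + by apply: CmeasM => //; exact: Cmeas_fexp.
    + exact: Rintble_normc.
    + by move=> x _; rewrite normcM normc_fexp.
  rewrite -mulr_sumr; apply: ler_wpM2l; last exact: hN.
  by rewrite mul1r mulr_ge0// Rintegral_ge0// => x _; exact: normc_ge0.
rewrite -(zsumZ (-1) hz); congr zsum; apply/funext => k.
by rewrite (circ_int_by_parts_fexp k ht) /dx_coef; ring.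
Qed.

(** The real and imaginary parts of an exponential are test functions, since test functions
   are real-valued. *)
Lemma weak_derivative_fcoef f g k : Cmeas f -> Cintble f -> weak_derivative f g ->
  fcoef g k = dx_symbol k * fcoef f k.
Proof.
move=> mf cf [Lg hw]; have [_ mgr mgi _] := Lg; have mg : Cmeas g by [].
have cg := L2_Cintble Lg.
set c : R := twopi * k%:~R.
have cosT := hw _ (trig_test_function 1 0 k); have sinT := hw _ (trig_test_function 0 1 k).
have cE (h : R -> R[i]) (psi : R -> R) M : Cmeas h -> Cintble h -> continuous psi ->
  (forall x, `|psi x| <= M) ->
    Cintble (fun x => h x * (psi x)%:C).
  move=> mh ch /continuous_realfun [m i] hM; apply: CintbleM => //.
  by exists M => x; rewrite normcR.
have cc : continuous (fun x => 1 * cos (c * x) + 0 * sin (c * x)).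
  by under eq_fun do rewrite mul1r mul0r addr0; exact: continuous_cos_scale.
have cs : continuous (fun x => 0 * cos (c * x) + 1 * sin (c * x)).
  by under eq_fun do rewrite mul1r mul0r add0r; exact: continuous_sin_scale.
have bc x : `|1 * cos (c * x) + 0 * sin (c * x)| <= 1.
  by rewrite mul1r mul0r addr0 ler_norml cos_geN1 cos_le1.
have bs x : `|0 * cos (c * x) + 1 * sin (c * x)| <= 1.
  by rewrite mul1r mul0r add0r ler_norml sin_geN1 sin_le1.
have I1 := cE g _ _ mg cg cc bc; have I2 := cE g _ _ mg cg cs bs.
have J1 := cE f _ _ mf cf cc bc; have J2 := cE f _ _ mf cf cs bs.
have -> : fcoef g k = circ_int (fun x => g x * (1 * cos (c * x) + 0 * sin (c * x))%:C) +
   (- 'i%C) * circ_int (fun x => g x * (0 * cos (c * x) + 1 * sin (c * x))%:C).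
  rewrite -circ_intZ// -circ_intD//; last exact: CintbleZ.
  rewrite /fcoef; congr circ_int; apply/funext => x; rewrite fexpN fexpE -/c /=.
  by case: (g x) => p q; apply/eqP; rewrite eq_complex /=; apply/andP; split; apply/eqP; ring.
have -> : fcoef f k = circ_int (fun x => f x * (1 * cos (c * x) + 0 * sin (c * x))%:C) +
   (- 'i%C) * circ_int (fun x => f x * (0 * cos (c * x) + 1 * sin (c * x))%:C).
  rewrite -circ_intZ// -circ_intD//; last exact: CintbleZ.
  rewrite /fcoef; congr circ_int; apply/funext => x; rewrite fexpN fexpE -/c /=.
  by case: (f x) => p q; apply/eqP; rewrite eq_complex /=; apply/andP; split; apply/eqP; ring.
have e1 : circ_int (fun x => f x * (derive1 (fun x => 1 * cos (c * x) + 0 * sin (c * x)) x)%:C) =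
   (- c)%:C * circ_int (fun x => f x * (0 * cos (c * x) + 1 * sin (c * x))%:C).
  rewrite -circ_intZ//; congr circ_int; apply/funext => x; rewrite trig_derive1.
  by case: (f x) => p q; apply/eqP; rewrite eq_complex /=; apply/andP; split; apply/eqP; ring.
have e2 : circ_int (fun x => f x * (derive1 (fun x => 0 * cos (c * x) + 1 * sin (c * x)) x)%:C) =
   c%:C * circ_int (fun x => f x * (1 * cos (c * x) + 0 * sin (c * x))%:C).
  rewrite -circ_intZ//; congr circ_int; apply/funext => x; rewrite trig_derive1.
  by case: (f x) => p q; apply/eqP; rewrite eq_complex /=; apply/andP; split; apply/eqP; ring.
rewrite -/c e1 in cosT; rewrite -/c e2 in sinT.
move/(congr1 (fun z => - z)): cosT; rewrite opprK => <-.
move/(congr1 (fun z => - z)): sinT; rewrite opprK => <-.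
rewrite /dx_symbol -/c; move: (circ_int _) (circ_int _) => [p q] [p' q'].
by apply/eqP; rewrite eq_complex /=; apply/andP; split; apply/eqP; ring.
Qed.

Lemma has_coefs_Cintble f a : has_coefs f a -> Cintble f.
Proof.
move=> [mf hf ea]; have [M hM] := exp_decay_zasum ea.
have ms := Cmeas_synth hM; have [cr ci] := Cintble_bounded ms (Cbounded_synth hM).
have gen (p q : R -> R) : measurable_fun setT p -> Rintble q -> p = q %[ae mu] -> Rintble p.
  move=> mp hq hpq; have /integrableP [mq iq] := hq.
  have mpE : measurable_fun I01 (EFin \o p) by exact/measurable_EFinP/measurable_funTS.
  apply/integrableP; split => //; apply: le_lt_trans iq.
  rewrite le_eqVlt; apply/orP; left; apply/eqP; apply: ae_eq_integral => //.
  - exact: measurableT_comp.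
  - exact: measurableT_comp.
  - by apply: ae_imply1 hpq => x h _; rewrite /= h.
split; [apply: gen cr _|apply: gen ci _]; try exact: mf.1; try exact: mf.2;
by apply: ae_imply1 hf => x h _; rewrite h.
Qed.

(** The sum of the differentiated series is a weak derivative, hence [dx] is one too, and weak
   derivatives have the expected Fourier coefficients. *)
Lemma has_coefs_dx f a : has_coefs f a -> has_coefs (dx f) (dx_coef a).
Proof.
move=> h; have hw : weak_derivative f (dx f).
  have := @xgetPex _ (fun=> 0) [set g | weak_derivative f g]; apply.
  by exists (synth (dx_coef a)); exact: weak_derivative_synth.
have [Lg _] := hw.
apply: L2_has_coefs => //; last exact: exp_decay_dx (has_coefs_decay h).
move=> k; rewrite (weak_derivative_fcoef k (has_coefs_Cmeas h) (has_coefs_Cintble h) hw) /dx_coef.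
by rewrite (has_coefs_fcoef k h).
Qed.

(** The partial sums in the definition of [Ainv] are those of the series over windows. *)
Lemma AinvE f : exp_decay (fcoef f) -> Ainv f = synth (fun k => Ainv_symbol k * fcoef f k).
Proof.
move=> h; have [M hM] := exp_decay_zasum (exp_decay_Ainv h).
apply/funext => x; have hc := synth_cvg hM x.
have hp : cvgc (Ainv_psum f x) (synth (fun k => Ainv_symbol k * fcoef f k) x).
  (* the partial sum of index [N] in [Ainv_psum] includes the shell of [N] *)
  have : cvgc (fun N => \sum_(k <- window N.+1) Ainv_symbol k * fcoef f k *
    fexp k x) (synth (fun k => Ainv_symbol k * fcoef f k) x).
    by move: hc; rewrite /cvgc -(cvg_shiftS (fun N => normc _)).
  apply: eq_cvgc => // N; rewrite -shell_sum_window -(big_mkord xpredT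
    (fun n => \sum_(j <- shell n) Ainv_symbol j * fcoef f j * fexp j x)).
  rewrite big_ltn// /Ainv_psum big_seq1 /Ainv_symbol eqxx mul1r fexp0 mulr1; congr (_ + _).
  apply: eq_big_nat => -[//|n] _ /=; rewrite !big_cons big_nil addr0 oppr_eq0 /=.
  have -> : 2 * pi * n.+1%:R = twopi * absr n.+1%:Z :> R by rewrite twopiE.
  rewrite absrN; ring.
have [h1 h2] := cvgc_ReIm hp.
by rewrite /Ainv (cvg_lim _ h1)// (cvg_lim _ h2)//.
Qed.

Lemma has_coefs_Ainv f a : has_coefs f a -> has_coefs (Ainv f) (fun k => Ainv_symbol k * a k).
Proof.
move=> h; have -> : a = fcoef f by apply/funext => k; rewrite (has_coefs_fcoef k h).
have e : exp_decay (fcoef f) by have -> : fcoef f = a; [apply/funext => k;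
  exact: has_coefs_fcoef|exact: has_coefs_decay h].
by rewrite AinvE//; apply: has_coefs_synth; exact: exp_decay_Ainv.
Qed.

Lemma has_coefs_eq f a b : has_coefs f a -> (forall k, a k = b k) -> has_coefs f b.
Proof. by move=> h /funext <-. Qed.

Lemma eq_has_coefs f g a : has_coefs f a -> (forall x, f x = g x) -> has_coefs g a.
Proof. by move=> h /funext <-. Qed.

(** This identifies the nonlinear terms of the equation with [Q]. *)
Lemma has_coefs_equation v a : has_coefs v a ->
  has_coefs (fun x => v x * dx v x + dx (Ainv (Ainv (nonlocal_arg v))) x) (fun k => - Q a a k).
Proof.
move=> h; have h1 := has_coefs_dx h; have h2 := has_coefs_dx h1; have h3 := has_coefs_dx h2.
have hn : has_coefs (nonlocal_arg v) (nonlocal_coef a a).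
  have := has_coefsB (has_coefsB (has_coefsD (has_coefsZ (2 * a 0) h) (has_coefsZ (1 / 2)
    (has_coefsM h1 h1)))
     (has_coefsZ 3 (has_coefsM h1 h3))) (has_coefsZ (7 / 2) (has_coefsM h2 h2)).
  move=> hh; apply: eq_has_coefs hh _ => x; rewrite /nonlocal_arg.
  have -> : circ_int v = a 0.
    rewrite -(has_coefs_fcoef 0 h) /fcoef; congr circ_int; apply/funext => y.
    by rewrite oppr0 fexp0 mulr1.
  by rewrite !expr2 !mulrA.
have := has_coefsD (has_coefsM h h1) (has_coefs_dx (has_coefs_Ainv (has_coefs_Ainv hn))).
by move=> hh; apply: has_coefs_eq hh _ => k; rewrite /Q opprK.
Qed.

Lemma has_coefs0_ae f a : has_coefs f a -> (forall k, a k = 0) -> f = (fun=> 0) %[ae mu].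
Proof.
move=> [_ h _] /funext e; apply: ae_imply1 h => x h hx; rewrite h// e /synth.
have -> : (fun k => 0 * fexp k x) = (fun=> 0) by apply/funext => k; rewrite mul0r.
by rewrite zsum0.
Qed.

Lemma ae0_has_coefs f a k : has_coefs f a -> f = (fun=> 0) %[ae mu] -> a k = 0.
Proof.
move=> h hf; rewrite -(has_coefs_fcoef k h) (fcoef_ae k (has_coefs_Cmeas h) (Cmeas_cst 0) hf).
rewrite /fcoef; under eq_fun do rewrite mul0r; exact: circ_int0.
Qed.

End Coefficients.

(** * The norms and the coefficients *)

Section NormsUniqueness.
Context {R : realType}.
Implicit Types (k j l : int) (f g : R -> R[i]) (a b : int -> R[i]).
Local Notation mu := (@lebesgue_measure R).

Lemma japanese_le k : japanese k <= bracket k :> R.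
Proof.
have b0 : 0 <= bracket k :> R by exact/ltW/bracket_gt0.
rewrite /japanese -[leRHS]ger0_norm// -sqrtr_sqr ler_sqrt ?exprn_ge0//.
rewrite -real_normK ?num_real// normr_intr bracketE.
by have := absr_ge0 k (R := R); move: (absr k) => x; nra.
Qed.

Lemma japanese_ge k : bracket k / 2 <= japanese k :> R.
Proof.
have b0 : 0 <= bracket k / 2 :> R by rewrite divr_ge0// ltW// bracket_gt0.
rewrite /japanese -[leLHS]ger0_norm// -sqrtr_sqr ler_sqrt ?addr_ge0 ?sqr_ge0//.
rewrite -[X in _ <= 1 + X]real_normK ?num_real// normr_intr bracketE.
by have := absr_ge0 k (R := R); move: (absr k) => x; nra.
Qed.

Lemma japanese_ge1 k : 1 <= japanese k :> R.
Proof.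
by rewrite -[leLHS]sqrtr1 /japanese ler_sqrt ?addr_ge0 ?sqr_ge0// lerDl sqr_ge0.
Qed.

Definition Gnorm_term (d s : R) f k : R :=
  japanese k `^ (2 * s) * expR (4 * pi * d * `|k%:~R|) * normc (fcoef f k) ^+ 2.

Lemma Gnorm_term_ge0 d s f k : 0 <= Gnorm_term d s f k.
Proof. by rewrite !mulr_ge0 ?powR_ge0 ?expR_ge0 ?exprn_ge0 ?normc_ge0. Qed.

Lemma expR_4pi d k : expR (4 * pi * d * `|k%:~R|) = expR (twopi * d * absr k) ^+ 2 :> R.
Proof. by rewrite normr_intr -expRM_natl twopiE; congr expR; ring. Qed.

(** Each term of the series is bounded by its sum.  The exponent [s >= 3] gives the cubic
   factor, and [8 = 2^3] comes from comparing the two brackets. *)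
Lemma Gnorm_wbound (d s e : R) f : 3 <= s -> (Gnorm d s f <= e%:E)%E -> wbound d (8 * e) (fcoef f).
Proof.
move=> s3; rewrite /Gnorm => h k.
have hk : ((Gnorm_term d s f k)%:E <= \esum_(k in [set: int]) (Gnorm_term d s f k)%:E)%E.
  apply: esum_ge; exists [set k]; first by split.
  by rewrite fsbig_set1.
have hs : (((Gnorm_term d s f k) `^ 2^-1)%:E <= e%:E)%E.
  apply: le_trans h; rewrite -poweR_EFin; apply: gt0_ler_poweR => //.
  - by rewrite in_itv /= lee_fin Gnorm_term_ge0 leey.
  - by rewrite in_itv /= leey andbT; apply: esum_ge0 => ? _; rewrite lee_fin Gnorm_term_ge0.
rewrite lee_fin powR12_sqrt ?Gnorm_term_ge0// in hs.
have b0 := bracket_gt0 k (R := R).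
pose y := normc (fcoef f k) * (bracket k / 2) ^+ 3 * expR (twopi * d * absr k).
have y0 : 0 <= y by rewrite !mulr_ge0 ?normc_ge0 ?expR_ge0 ?exprn_ge0 ?divr_ge0// ltW.
have hy : y <= e.
  apply: le_trans hs; rewrite -[leLHS]ger0_norm// -sqrtr_sqr ler_sqrt ?Gnorm_term_ge0//.
  rewrite /y /Gnorm_term expR_4pi [leLHS](_ : _ = ((bracket k / 2) ^+ 6) * expR (twopi * d *
    absr k) ^+ 2 * normc (fcoef f k) ^+ 2); last by ring.
  apply: ler_wpM2r; first by rewrite exprn_ge0// normc_ge0.
  apply: ler_wpM2r; first by rewrite exprn_ge0// expR_ge0.
  apply: (@le_trans _ _ (japanese k ^+ 6)).
    apply: lerXn2r; rewrite ?nnegrE ?japanese_ge//; first by rewrite divr_ge0// ltW.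
    by apply: le_trans (japanese_ge1 k).
  rewrite -powR_mulrn; last by apply: le_trans (japanese_ge1 k).
  apply: ler_powR; [exact: japanese_ge1|lra].
have -> : normc (fcoef f k) = 8 * y * wgt d k.
  rewrite /y /wgt /expw expRN; field.
  by rewrite !gt_eqF ?expR_gt0.
apply: ler_wpM2r; first exact/ltW/wgt_gt0.
by rewrite ler_pM2l.
Qed.

Lemma Gnorm_ge0 (d s : R) f : (0 <= Gnorm d s f)%E.
Proof. exact: poweR_ge0. Qed.

(** A little more radius dominates every power of the bracket and leaves a summable series. *)
Lemma Gnorm_le (d s d1 : R) : d < d1 -> exists2 C : R, 0 < C &
  forall f A, 0 <= A -> (forall k, normc (fcoef f k) <= A * expw d1 k) ->
  (Gnorm d s f <= (C * A)%:E)%E.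
Proof.
move=> dd; pose m := Num.bound (`|2 * s|).
have hm : 2 * s <= m%:R.
  by apply: le_trans (ler_norm _) _; apply: ltW; exact: archi_boundP.
have g0 : 0 < 2 * (d1 - d) by lra.
have [C0 C0p hC] := bracketX_expw (m + 2) g0.
exists (Num.sqrt (C0 * 3)); first by rewrite sqrtr_gt0; lra.
move=> f A A0 hA.
have ht k : Gnorm_term d s f k <= C0 * A ^+ 2 * bracket k ^- 2.
  have j1 := japanese_ge1 k.
  have hj : japanese k `^ (2 * s) <= bracket k ^+ m :> R.
    apply: (@le_trans _ _ (japanese k `^ m%:R)); first exact: ler_powR.
    rewrite powR_mulrn; last by apply: le_trans j1.
    by apply: lerXn2r; rewrite ?nnegrE ?japanese_le ?(ltW (bracket_gt0 _))//; apply: le_trans j1.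
  have hf : normc (fcoef f k) ^+ 2 <= A ^+ 2 * expw d1 k ^+ 2.
    rewrite -exprMn; apply: lerXn2r; rewrite ?nnegrE ?normc_ge0 ?mulr_ge0 ?(ltW (expw_gt0 _ _))//.
  apply: (@le_trans _ _ (bracket k ^+ m * expR (twopi * d * absr k) ^+ 2 * (A ^+ 2 * expw d1 k ^+ 2))).
    rewrite /Gnorm_term expR_4pi; apply: ler_pM => //.
    - by rewrite mulr_ge0 ?powR_ge0 ?exprn_ge0 ?expR_ge0.
    - by rewrite exprn_ge0 ?normc_ge0.
    - by apply: ler_wpM2r hj; rewrite exprn_ge0 ?expR_ge0.
  have -> : bracket k ^+ m * expR (twopi * d * absr k) ^+ 2 * (A ^+ 2 * expw d1 k ^+ 2) =
     A ^+ 2 * (bracket k ^+ (m + 2) * expw (2 * (d1 - d)) k) * bracket k ^- 2.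
    have -> : expw (2 * (d1 - d)) k = expR (twopi * d * absr k) ^+ 2 * expw d1 k ^+ 2.
      by rewrite /expw -!expRM_natl -expRD; congr expR; ring.
    by rewrite exprD; field; rewrite gt_eqF// bracket_gt0.
  apply: ler_wpM2r; first exact: bracketXV_ge0.
  by rewrite [leRHS]mulrC; apply: ler_wpM2l (hC k); exact: exprn_ge0.
have hsum : (\esum_(k in [set: int]) (Gnorm_term d s f k)%:E <= (C0 * A ^+ 2 * 3)%:E)%E.
  apply: ge_ereal_sup => _ [F [finF _] <-].
  rewrite fsbig_finite//= sumEFin lee_fin.
  apply: (@le_trans _ _ (\sum_(k <- finmap.enum_fset (fset_set F)) C0 * A ^+ 2 * bracket k ^- 2)).
    by apply: ler_sum => k _; exact: ht.
  rewrite -mulr_sumr; apply: ler_wpM2l; first by rewrite mulr_ge0 ?exprn_ge0// ltW.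
  by apply: sum_bracketV2; exact: finmap.fset_uniq.
rewrite /Gnorm -/(Gnorm_term d s f).
apply: (@le_trans _ _ ((C0 * A ^+ 2 * 3)%:E `^ 2^-1)%E).
  apply: gt0_ler_poweR => //.
  - by rewrite in_itv /= leey andbT; apply: esum_ge0 => ? _; rewrite lee_fin Gnorm_term_ge0.
  - by rewrite in_itv /= leey andbT lee_fin !mulr_ge0 ?exprn_ge0// ltW.
rewrite poweR_EFin lee_fin powR12_sqrt; last by rewrite !mulr_ge0 ?exprn_ge0// ltW.
rewrite mulrAC sqrtrM; last by rewrite mulr_ge0// ltW.
by rewrite sqrtr_sqr ger0_norm.
Qed.

Lemma inG_has_coefs (d s : R) f : 0 < d -> 3 <= s -> inG d s f -> exists2 A, wbound d A (fcoef f) &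
  has_coefs f (fcoef f).
Proof.
move=> d0 s3 [L2 hG].
have hf : Gnorm d s f \is a fin_num by rewrite ge0_fin_numE// Gnorm_ge0.
have h := @Gnorm_wbound d s (fine (Gnorm d s f)) f s3.
rewrite fineK// in h; have {}h := h (lexx _).
exists (8 * fine (Gnorm d s f)) => //.
by apply: L2_has_coefs => //; exact: wbound_exp_decay h.
Qed.

(** * Uniqueness *)

(** What a holomorphic solution provides on the side of coefficients: bounds, and
   differentiability with derivative [Q] in the weighted supremum norm. *)
Definition coef_solution (d p : R) (V : R[i] -> int -> R[i]) := forall t, normc t < p ->
  [/\ exists A, wbound d A (V t), exists A, wbound d A (Q (V t) (V t)) &
    forall e, 0 < e -> exists2 c : R, 0 < c & forall h, h != 0 -> normc h < c ->
      wbound d e (fun k => h^-1 * (V (t + h) k - V t k) - Q (V t) (V t) k)].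

Lemma solution_coef (d s p : R) u0 v : 0 < d -> 3 <= s -> holomorphic_solution d s p u0 v ->
  coef_solution d p (fun t => fcoef (v t)).
Proof.
move=> d0 s3 [hh [_ hv]] t ht.
have [vt hvt eqv] := hv t ht.
have [inv _] := hh t ht.
have [invt hlim] := hvt.
have [A hA rA] := inG_has_coefs d0 s3 inv.
have [B hB rB] := inG_has_coefs d0 s3 invt.
have eQ k : fcoef vt k = Q (fcoef (v t)) (fcoef (v t)) k.
  have hr := has_coefsD rB (has_coefs_equation rA).
  have hr' : has_coefs (fun x => vt x + v t x * dx (v t) x + dx (Ainv (Ainv (nonlocal_arg (v t)))) x)
     (fun k => fcoef vt k + - Q (fcoef (v t)) (fcoef (v t)) k).
    by apply: eq_has_coefs hr _ => x; rewrite addrA.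
  by have := ae0_has_coefs k hr' eqv => /eqP; rewrite subr_eq0 => /eqP.
split; first by exists A.
  by exists B => k; rewrite -eQ; exact: hB.
move=> e e0; have e8 : 0 < e / 8 by rewrite divr_gt0.
have [c c0 hc] := hlim _ e8.
exists (Num.min c (p - normc t)); first by rewrite lt_min c0 subr_gt0.
move=> h h0; rewrite lt_min => /andP[hc1 hc2].
have hth : normc (t + h) < p by apply: le_lt_trans (le_normcD _ _) _; lra.
have [inh _] := hh _ hth.
have [Ah hAh rAh] := inG_has_coefs d0 s3 inh.
have := Gnorm_wbound s3 (ltW (hc h h0 hc1)).
rewrite mulrCA divff ?mulr1//; move=> hb k; have := hb k.
have hr := has_coefsB (has_coefsZ h^-1 (has_coefsB rAh rA)) rB.
by rewrite (has_coefs_fcoef k hr) eQ.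
Qed.

Lemma is_derive_epsilon (f : R -> R) (x l : R) :
  (forall e, 0 < e -> exists2 c : R, 0 < c & forall h, h != 0 -> `|h| < c ->
    `|h^-1 * (f (x + h) - f x) - l| <= e) -> is_derive x (1 : R) f l.
Proof.
move=> H; have hc : h^-1 *: (f (h *: (1 : R) + x) - f x) @[h --> 0^'] --> l.
  apply/cvgrPdist_le => e e0; have [c c0 hc] := H e e0.
  near=> h; rewrite distrC /GRing.scale /= mulr1 [h + x]addrC; apply: hc.
    by near: h; exact: nbhs_dnbhs_neq.
  by near: h; apply: dnbhs0_lt.
apply: DeriveDef; first by apply/cvg_ex; exists l.
by apply/cvg_lim.
Unshelve. all: by end_near. Qed.

(** Monotonicity of [f y - B (y - x0)^(n+1)], by the mean value theorem. *)
Lemma growth_from_derivative (f df : R -> R) (x0 x : R) n (B : R) : x0 <= x ->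
  (forall y, x0 <= y -> y <= x -> is_derive y (1 : R) f (df y)) ->
  (forall y, x0 <= y -> y <= x -> df y <= B * (n.+1%:R * (y - x0) ^+ n)) -> f x0 = 0 ->
  f x <= B * (x - x0) ^+ n.+1.
Proof.
move=> xx hd hb f0.
pose g y := f y - B * (y - x0) ^+ n.+1.
have dg y : x0 <= y -> y <= x -> is_derive y (1 : R) g (df y - B * (n.+1%:R * (y - x0) ^+ n)).
  move=> h1 h2.
  have hx : is_derive y (1 : R) (fun y => y - x0) 1.
    by have := is_deriveB (is_derive_id y (1:R)) (is_derive_cst x0 y (1 : R)); rewrite subr0.
  have hX := is_deriveX n.+1 hx.
  have hg := is_deriveB (hd y h1 h2) (is_deriveZ B hX).
  rewrite (_ : g = f - B \*: (fun y => y - x0) ^+ n.+1).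
    by apply: is_derive_eq hg _; rewrite /GRing.scale /= mulr1.
  by apply/funext => z; rewrite /g !fctE.
have [||c] := @MVT_segment R g (fun y => df y - B * (n.+1%:R * (y - x0) ^+ n)) x0 x xx.
- by move=> y; rewrite in_itv /= => /andP[h1 h2]; apply: dg; exact: ltW.
- apply: derivable_within_continuous => y; rewrite in_itv /= => /andP[h1 h2].
  by case: (dg y h1 h2).
rewrite in_itv /= => /andP[h1 h2].
rewrite /g f0 subrr expr0n /= mulr0 !subr0 => e.
have : f x - B * (x - x0) ^+ n.+1 <= 0.
  by rewrite e; apply: mulr_le0_ge0; rewrite ?subr_ge0// subr_le0; exact: hb.
by rewrite subr_le0.
Qed.

Lemma norm_growth_from_derivative (f df : R -> R) (x0 x : R) n (B : R) : x0 <= x ->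
  (forall y, x0 <= y -> y <= x -> is_derive y (1 : R) f (df y)) ->
  (forall y, x0 <= y -> y <= x -> `|df y| <= B * (n.+1%:R * (y - x0) ^+ n)) -> f x0 = 0 ->
  `|f x| <= B * (x - x0) ^+ n.+1.
Proof.
move=> xx hd hb f0; rewrite ler_norml; apply/andP; split; last first.
  apply: (growth_from_derivative xx hd) => // y h1 h2; apply: le_trans (ler_norm _) (hb y h1 h2).
rewrite lerNl; apply: (@growth_from_derivative (fun y => - f y) (fun y => - df y)) => //.
- by move=> y h1 h2; apply: is_deriveN; exact: hd.
- by move=> y h1 h2; apply: le_trans (hb y h1 h2); rewrite -normrN; exact: ler_norm.
- by rewrite f0 oppr0.
Qed.

Section uniqueness.
Variables (d p : R) (V W : R[i] -> int -> R[i]) (t : R[i]).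
Hypotheses (d0 : 0 < d) (d1 : d <= 1) (sV : coef_solution d p V) (sW : coef_solution d p W).
Hypotheses (ht : normc t < p) (t0 : t != 0) (V0 : V 0 = W 0).

(** Restricting a function of the complex time to a segment makes real calculus available. *)
Definition along (U : R[i] -> int -> R[i]) (x : R) := U (x%:C * t).

Lemma normc_along (x : R) : normc (x%:C * t) = `|x| * normc t.
Proof. by rewrite normcM normcR. Qed.

Lemma along_deriv U x k (z : R[i]) : coef_solution d p U -> normc (x%:C * t) < p ->
  is_derive x (1 : R) (fun y => complex.Re (z * along U y k))
    (complex.Re (z * (t * Q (along U x) (along U x) k))).
Proof.
move=> sU hx; have [_ _ hd] := sU _ hx.
apply: is_derive_epsilon => e e0.
have w0 := wgt_gt0 d k; have tn : 0 < normc t by rewrite normc_gt0.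
pose B := normc z * normc t * wgt d k.
have B0 : 0 <= B.
  by rewrite /B; apply: mulr_ge0; [apply: mulr_ge0; exact: normc_ge0|exact: ltW].
have e1 : 0 < e / (B + 1) by rewrite divr_gt0// ltr_wpDl.
have [c c0 hc] := hd _ e1.
exists (c / normc t); first by rewrite divr_gt0.
move=> h h0 hh.
have H0 : h%:C * t != 0 by rewrite mulf_neq0// eq_complex /= eqxx andbT.
have H1 : normc (h%:C * t) < c by rewrite normc_along -ltr_pdivlMr.
have := hc _ H0 H1 k; rewrite /along.
have -> : x%:C * t + h%:C * t = (x + h)%:C * t by rewrite -mulrDl rmorphD.
set Q0 := Q _ _ k => hb.
have hn : normc (z * (h%:C^-1 * (U ((x + h)%:C * t) k - U (x%:C * t) k) - t * Q0)) <= e.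
  have -> : z * (h%:C^-1 * (U ((x + h)%:C * t) k - U (x%:C * t) k) - t * Q0) =
    z * (t * ((h%:C * t)^-1 * (U ((x + h)%:C * t) k - U (x%:C * t) k) - Q0)).
    by field; rewrite t0 /= eq_complex /= eqxx andbT h0.
  rewrite normcM normcM mulrA.
  apply: le_trans (ler_wpM2l _ hb) _; first by rewrite mulr_ge0 ?normc_ge0.
  have -> : normc z * normc t * (e / (B + 1) * wgt d k) = B * (e / (B + 1)) by rewrite /B; ring.
  rewrite mulrCA -[leRHS]mulr1; apply: ler_wpM2l; first exact: ltW.
  by rewrite ler_pdivrMr ?mul1r ?lerDl ?ltr_wpDl.
apply: le_trans hn; apply: le_trans _ (Re_le_normc _).
rewrite le_eqVlt; apply/orP; left; apply/eqP; congr (`|_|).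
have -> : h%:C^-1 = (h^-1)%:C by rewrite fmorphV.
have -> : z * ((h^-1)%:C * (U ((x + h)%:C * t) k - U (x%:C * t) k) - t * Q0) =
  (h^-1)%:C * (z * U ((x + h)%:C * t) k - z * U (x%:C * t) k) - z * (t * Q0) by ring.
move: (z * U ((x + h)%:C * t) k) (z * U (x%:C * t) k) (z * (t * Q0)) => [p1 p2] [q1 q2] [r1 r2].
by rewrite /=; ring.
Qed.

Let tn : 0 < normc t. Proof. by rewrite normc_gt0. Qed.

(** The rate at which differences of solutions bounded by [M] can grow; adding 1 keeps it
   positive. *)
Definition gap_rate (M : R) : R := 8 * normc t * Qconst * M * expR 1 + 1.

Lemma gap_rate_gt0 M : 0 <= M -> 0 < gap_rate M.
Proof.
move=> M0; rewrite /gap_rate ltr_wpDl// !mulr_ge0 ?normc_ge0 ?expR_ge0//.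
by apply: le_trans (@Qconst_ge1 R).
Qed.

(** Induction on [n]: the difference [D] of two solutions has derivative [Q V D + Q D W] up to
   the factor [t], which is estimated by the previous bound at the intermediate radius of
   [shrink_radius].  Integration contributes [1/(n+1)], which compensates the loss
   [n+1]. *)
Lemma gap_iterate (x0 x1 M : R) n : 0 <= M ->
  (forall x, x0 <= x -> x <= x1 -> [/\ normc (x%:C * t) < p, wbound d M (along V x) &
    wbound d M (along W x)]) ->
  along V x0 = along W x0 ->
  forall d', 0 <= d' -> d' < d -> forall x, x0 <= x -> x <= x1 ->
  wbound d' (2 * M * (gap_rate M * (x - x0) / (d - d')) ^+ n) (fun k => along V x k - along W x k).
Proof.
move=> M0 hM h0; elim: n => [|n IH] d' d'0 dd' x hx0 hx1.
  have [_ hV hW] := hM x hx0 hx1; rewrite expr0 mulr1.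
  move=> k; apply: le_trans (normcB _ _) _.
  have -> : 2 * M * wgt d' k = M * wgt d' k + M * wgt d' k by ring.
  by apply: lerD; [apply: (wboundW (ltW dd') (lexx M) hV)|apply: (wboundW (ltW dd') (lexx M) hW)].
pose g := d - d'; have g0 : 0 < g by rewrite /g subr_gt0.
have n1 : 0 < n.+1%:R :> R by rewrite ltr0n.
have n2 : 0 < n.+2%:R :> R by rewrite ltr0n.
have e2 : n.+2%:R = n.+1%:R + 1 :> R by rewrite -natr1.
(* spend the fraction [1 / (n+2)] of the radius between [d'] and [d] *)
pose d2 := d' + g / n.+2%:R.
have E1 : d2 - d' = g / n.+2%:R by rewrite /d2; ring.
have E2 : d - d2 = g * n.+1%:R / n.+2%:R.
  rewrite /d2 /g e2; move: (n.+1%:R) n1 => y y0.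
  by field; apply: lt0r_neq0; lra.
have hd2 : d' < d2 by rewrite -subr_gt0 E1 divr_gt0.
have hd3 : d2 < d by rewrite -subr_gt0 E2 divr_gt0// mulr_gt0.
have hd20 : 0 <= d2 by apply: le_trans (ltW hd2).
have KQ0 : 0 <= Qconst :> R by exact: Qconst_ge0.
have L0 := gap_rate_gt0 M0.
have e0 := expR_gt0 (1 : R).
move=> k; have w0 := wgt_gt0 d' k.
pose B := gap_rate M ^+ n.+1 * M * g ^- n.+1 * wgt d' k.
have B0 : 0 <= B.
  apply: mulr_ge0; last exact: ltW.
  apply: mulr_ge0; last by rewrite invr_ge0 exprn_ge0 ?ltW.
  by apply: mulr_ge0 => //; rewrite exprn_ge0 ?ltW.
have hder y : x0 <= y -> y <= x ->
  normc (t * Q (along V y) (along V y) k - t * Q (along W y) (along W y) k) <=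
  B * (n.+1%:R * (y - x0) ^+ n).
  move=> hy0 hy1; have hyx1 := le_trans hy1 hx1; have [_ hV hW] := hM y hy0 hyx1.
  have D2 := IH d2 hd20 hd3 y hy0 hyx1.
  have hV2 := wboundW (ltW hd3) (lexx M) hV; have hW2 := wboundW (ltW hd3) (lexx M) hW.
  have dV := wbound_decay (ltW d0) hV; have dW := wbound_decay (ltW d0) hW.
  set D := fun k => along V y k - along W y k in D2.
  have -> : t * Q (along V y) (along V y) k - t * Q (along W y) (along W y) k =
     t * (Q (along V y) D k + Q D (along W y) k).
    by rewrite QBr// QBl//; ring.
  have d21 : d2 <= 1 by apply: le_trans (ltW hd3) d1.
  have q1 := Q_wbound d'0 hd2 d21 hV2 D2 k.
  have q2 := Q_wbound d'0 hd2 d21 D2 hW2 k.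
  rewrite normcM; apply: le_trans (ler_wpM2l (normc_ge0 _) (le_trans (le_normcD _ _) (lerD q1 q2))) _.
  have hs := shrink_radius n g0.
  have yx : 0 <= y - x0 by rewrite subr_ge0.
  have -> : normc t * (Qconst / (d2 - d') * (M * (2 * M * (gap_rate M *
    (y - x0) / (d - d2)) ^+ n)) * wgt d' k +
     Qconst / (d2 - d') * (2 * M * (gap_rate M * (y - x0) / (d - d2)) ^+ n * M) * wgt d' k) =
    4 * normc t * Qconst * M ^+ 2 * wgt d' k * (gap_rate M * (y - x0)) ^+ n * ((d2 - d') *
      (d - d2) ^+ n)^-1.
    by rewrite expr_div_n invfM; ring.
  rewrite E1 E2; apply: le_trans (ler_wpM2l _ hs) _.
    apply: mulr_ge0; last by rewrite exprn_ge0 ?mulr_ge0// ltW.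
    apply: mulr_ge0; last exact: ltW.
    by rewrite mulr_ge0 ?exprn_ge0// !mulr_ge0 ?normc_ge0.
  have -> : 4 * normc t * Qconst * M ^+ 2 * wgt d' k * (gap_rate M * (y - x0)) ^+ n * (2 * expR 1 *
    n.+1%:R * g ^- n.+1) =
    (8 * normc t * Qconst * M * expR 1) * (gap_rate M ^+ n * M * g ^- n.+1 * wgt d' k * (n.+1%:R *
      (y - x0) ^+ n)).
    by rewrite (exprMn _ (gap_rate M)); ring.
  have -> : B * (n.+1%:R * (y - x0) ^+ n) = gap_rate M * (gap_rate M ^+ n * M * g ^- n.+1 *
    wgt d' k * (n.+1%:R * (y - x0) ^+ n)).
    by rewrite /B exprS; ring.
  apply: ler_wpM2r; last by rewrite /gap_rate lerDl.
  apply: mulr_ge0; last by rewrite mulr_ge0 ?exprn_ge0// ltW.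
  apply: mulr_ge0; last exact: ltW.
  apply: mulr_ge0; last by rewrite invr_ge0 exprn_ge0// ltW.
  by rewrite mulr_ge0// exprn_ge0// ltW.
(* real calculus applies to the real part of a unimodular multiple of the difference;
   [z = 1] and [z = - 'i] then give its real and imaginary parts *)
have hz (z : R[i]) : normc z = 1 -> `|complex.Re (z * (along V x k - along W x k))| <= B *
  (x - x0) ^+ n.+1.
  move=> z1.
  have := @norm_growth_from_derivative (fun y => complex.Re (z * along V y k) - complex.Re (z *
    along W y k))
    (fun y => complex.Re (z * (t * Q (along V y) (along V y) k)) - complex.Re (z * (t *
      Q (along W y) (along W y) k))) x0 x n B hx0.
  rewrite mulrBr ReD ReN; apply.
  - move=> y hy0 hy1; have [hy _ _] := hM y hy0 (le_trans hy1 hx1).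
    by apply: is_deriveB; apply: along_deriv.
  - move=> y hy0 hy1; apply: le_trans (hder y hy0 hy1).
    rewrite -ReN -ReD -mulrBr; apply: le_trans (Re_le_normc _) _.
    by rewrite normcM z1 mul1r.
  - by rewrite h0 subrr.
have h1 := hz 1 (normc1 _); have h2 := hz (- 'i%C).
rewrite mul1r in h1.
have hi : normc (- 'i%C : R[i]) = 1 by rewrite normcN /normc expr0n expr1n add0r sqrtr1.
have {}h2 := h2 hi.
have e3 : complex.Re (- 'i%C * (along V x k - along W x k)) = complex.Im (along V x k - along W x k).
  by case: (along V x k - along W x k) => q r /=; ring.
rewrite e3 in h2.
apply: le_trans (normc_le_ReIm _) _; apply: le_trans (lerD h1 h2) _.
rewrite le_eqVlt; apply/orP; left; apply/eqP.
by rewrite -/g expr_div_n (exprMn _ (gap_rate M)) /B; ring.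
Qed.

(** The bound of [gap_iterate] at radius 0 tends to 0 when [n] grows, if
   [gap_rate M * (x - x0) / d <= 1/2]. *)
Lemma unique_nearby (x0 x1 M : R) : 0 <= M ->
  (forall x, x0 <= x -> x <= x1 -> [/\ normc (x%:C * t) < p, wbound d M (along V x) &
    wbound d M (along W x)]) ->
  along V x0 = along W x0 ->
  forall x, x0 <= x -> x <= x1 -> x <= x0 + d / (2 * gap_rate M) -> along V x = along W x.
Proof.
move=> M0 hM h0 x hx0 hx1 hx2; apply/funext => k.
have L0 := gap_rate_gt0 M0.
have hr : 0 <= gap_rate M * (x - x0) / d by rewrite !mulr_ge0 ?invr_ge0 ?subr_ge0// ltW.
have hr2 : gap_rate M * (x - x0) / d <= 2^-1.
  rewrite ler_pdivrMr// -(ler_pM2l (ltr0n _ 2)) mulrA.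
  have : x - x0 <= d / (2 * gap_rate M) by lra.
  by rewrite ler_pdivlMr ?mulr_gt0//; move: (gap_rate M) => L; nra.
apply/eqP; rewrite -subr_eq0 -normc_eq0 eq_le normc_ge0 andbT.
have hc : 2 * M * (gap_rate M * (x - x0) / d) ^+ n @[n --> \oo] --> 2 * M * (0 : R).
  apply: cvgM; first exact: cvg_cst.
  by apply: cvg_expr; rewrite ger0_norm//; lra.
rewrite mulr0 in hc.
have hw : 2 * M * (gap_rate M * (x - x0) / d) ^+ n * wgt 0 k @[n --> \oo] --> (0 : R) * wgt 0 k.
  by apply: cvgM hc _; exact: cvg_cst.
rewrite mul0r in hw.
rewrite -(cvg_lim (@Rhausdorff R) hw); apply: limr_ge; first by apply/cvg_ex; exists 0.
apply: nearW => n; have := gap_iterate n M0 hM h0 (lexx 0) d0 hx0 hx1 k.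
by rewrite subr0.
Qed.

(** A function that is differentiable at a point is bounded near it. *)
Lemma bounded_nearby U x : coef_solution d p U -> normc (x%:C * t) < p ->
  exists M c : R, [/\ 0 <= M, 0 < c & forall y, `|y - x| < c -> wbound d M (along U y)].
Proof.
move=> sU hx; have [[A hA] [B hB] hd] := sU _ hx.
have [c c0 hc] := hd 1 ltr01.
have A0 := wbound_ge0 hA; have B0 := wbound_ge0 hB.
exists (A + c * (B + 1)), (c / normc t); split.
- by rewrite addr_ge0// mulr_ge0 ?addr_ge0// ltW.
- by rewrite divr_gt0.
move=> y hy; case: (eqVneq y x) => [->|yx].
  by apply: (wboundW (lexx d) _ hA); rewrite lerDl mulr_ge0 ?addr_ge0// ltW.
pose h := (y - x)%:C * t.
have H0 : h != 0 by rewrite mulf_neq0// eq_complex /= eqxx andbT subr_eq0.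
have H1 : normc h < c by rewrite normc_along -ltr_pdivlMr.
move=> k; have := hc h H0 H1 k.
have e : x%:C * t + h = y%:C * t by rewrite /h -mulrDl -rmorphD addrC subrK.
rewrite /along e; set u1 := U _ k; set u2 := U _ k; set q := Q _ _ k => hb.
have -> : u1 = u2 + h * ((h^-1 * (u1 - u2) - q) + q) by field.
apply: le_trans (le_normcD _ _) _; rewrite mulrDl; apply: lerD; first exact: hA.
rewrite normcM -mulrA; apply: ler_pM; rewrite ?normc_ge0//; first exact: ltW.
apply: le_trans (le_normcD _ _) _; rewrite mulrDl addrC; apply: lerD => //; exact: hB.
Qed.

(** The supremum of the points up to which the solutions agree: they agree there by continuity,
   and beyond it by [unique_nearby] unless it is the end point. *)
Lemma unique_on_segment x : 0 <= x -> x <= 1 -> along V x = along W x.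
Proof.
pose E := [set x | [/\ 0 <= x, x <= 1 & forall y, 0 <= y -> y <= x -> along V y = along W y]].
have along0 U : along U 0 = U 0 by rewrite /along mul0r.
have E0 : E 0.
  split => // y y0 y1; have -> : y = 0 by apply/eqP; rewrite eq_le y0 y1.
  by rewrite !along0.
have hE : has_sup E by split; [exists 0|exists 1 => y []].
pose c := sup E.
have c0 : 0 <= c by apply: ub_le_sup => //; exact: hE.2.
have c1 : c <= 1 by apply: ge_sup; [exists 0|move=> y []].
have in_disc y : 0 <= y -> y <= 1 -> normc (y%:C * t) < p.
  move=> y0 y1; rewrite normc_along ger0_norm//; apply: le_lt_trans ht.
  by rewrite -[leRHS]mul1r; apply: ler_wpM2r => //; exact: normc_ge0.
have hlt y : 0 <= y -> y < c -> along V y = along W y.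
  move=> y0 yc; have cy : 0 < c - y by rewrite subr_gt0.
  have [e [e0 e1 he]] := sup_adherent cy hE.
  by rewrite subKr => /ltW ye; exact: he.
have hc : along V c = along W c.
  case: (eqVneq c 0) => [->|cn0]; first by rewrite !along0.
  have cp : 0 < c by rewrite lt_neqAle eq_sym cn0.
  apply/funext => k; apply/eqP; rewrite -subr_eq0; apply/eqP.
  (* continuity of real parts; [z = 1] and [z = - 'i] suffice to conclude *)
  have key (z : R[i]) : complex.Re (z * along V c k) = complex.Re (z * along W c k).
    have dV := along_deriv k z sV (in_disc c c0 c1).
    have dW := along_deriv k z sW (in_disc c c0 c1).
    pose F y := complex.Re (z * along V y k) - complex.Re (z * along W y k).
    have dF : is_derive c (1 : R) F (complex.Re (z * (t *
      Q (along V c) (along V c) k)) - complex.Re (z * (t * Q (along W c) (along W c) k))).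
      exact: is_deriveB dV dW.
    have cF : {for c, continuous F} by apply/differentiable_continuous/derivable1_diffP; case: dF.
    apply/eqP; rewrite -subr_eq0 -/(F c); apply/eqP.
    have h1 : F y @[y --> c^'-] --> F c by exact: cvg_at_left_filter cF.
    have h2 : F y @[y --> c^'-] --> (0 : R).
      apply: cvg_near_cst; near=> y.
      have yc : y < c by near: y; exact: nbhs_left_lt.
      have y0 : 0 <= y by near: y; apply: nbhs_left_ge.
      by rewrite /F hlt// subrr.
    exact: cvg_unique h1 h2.
  have k1 := key 1; have k2 := key (- 'i%C).
  apply/eqP; rewrite eq_complex; move: k1 k2; case: (along V c k) => p1 p2;
    case: (along W c k) => q1 q2 /=.
  by move=> k1 k2; apply/andP; split; apply/eqP; lra.
have [c1' |c1'] := ltP c 1; last first.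
  move=> x0 x1; have [xc|xc] := ltP x c; first exact: hlt.
  by have -> : x = c by apply/eqP; rewrite eq_le xc (le_trans x1 c1').
exfalso.
have [M1 [e1 [M10 e10 hM1]]] := bounded_nearby sV (in_disc c c0 c1).
have [M2 [e2 [M20 e20 hM2]]] := bounded_nearby sW (in_disc c c0 c1).
pose M := M1 + M2; have M0 : 0 <= M by exact: addr_ge0.
have L0 := gap_rate_gt0 M0.
(* a point beyond [c] up to which both bounds and [unique_nearby] are available *)
pose x1 := Num.min 1 (Num.min (c + e1 / 2) (Num.min (c + e2 / 2) (c + d / (2 * gap_rate M)))).
have x11 : x1 <= 1 by rewrite ge_min lexx.
have x12 : x1 <= c + e1 / 2 by rewrite /x1 !ge_min lexx ?orbT.
have x13 : x1 <= c + e2 / 2 by rewrite /x1 !ge_min lexx ?orbT.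
have x14 : x1 <= c + d / (2 * gap_rate M) by rewrite /x1 !ge_min lexx ?orbT.
have cx1 : c < x1.
  by rewrite !lt_min c1' !ltrDl !divr_gt0// mulr_gt0.
have hloc := @unique_nearby c x1 M M0 _ hc.
have Ex1 : E x1.
  split; [exact: le_trans (ltW cx1)|by []|].
  move=> y y0 y1; have [yc|yc] := ltP y c; first exact: hlt.
  apply: hloc => //; last exact: le_trans y1 x14.
  move=> z z0 z1; split; first by apply: in_disc; [exact: le_trans z0|exact: le_trans x11].
  - apply: wboundW (hM1 z _) => //; first by rewrite lerDl.
    by rewrite ger0_norm ?subr_ge0//; lra.
  - apply: wboundW (hM2 z _) => //; first by rewrite lerDr.
    by rewrite ger0_norm ?subr_ge0//; lra.
have := ub_le_sup hE.2 Ex1; rewrite leNgt -/c => /negP; apply.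
exact: cx1.
Unshelve. all: by end_near. Qed.

End uniqueness.

Lemma coef_solution_unique (d p : R) V W : 0 < d -> d <= 1 -> coef_solution d p V ->
  coef_solution d p W -> V 0 = W 0 ->
  forall t, normc t < p -> V t = W t.
Proof.
move=> d0 d1 sV sW V0 t ht; case: (eqVneq t 0) => [->//|t0].
have := unique_on_segment d0 d1 sV sW ht t0 V0 ler01 (lexx 1).
by rewrite /along mul1r.
Qed.

Lemma solution_unique (d s p : R) u0 u v : 0 < d -> d <= 1 -> 3 <= s -> 0 < p ->
  holomorphic_solution d s p u0 u -> holomorphic_solution d s p u0 v ->
  forall t, normc t < p -> v t = u t %[ae mu].
Proof.
move=> d0 d1 s3 p0 hu hv t ht.
have su := solution_coef d0 s3 hu; have sv := solution_coef d0 s3 hv.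
have [hhu [iu _]] := hu; have [hhv [iv _]] := hv.
have n0 : normc (0 : R[i]) < p by rewrite normc0.
have e0 : fcoef (v 0) = fcoef (u 0).
  apply/funext => k.
  have [_ _ ru] := inG_has_coefs d0 s3 (hhu 0 n0).1.
  have [_ _ rv] := inG_has_coefs d0 s3 (hhv 0 n0).1.
  apply: fcoef_ae; [exact: has_coefs_Cmeas rv|exact: has_coefs_Cmeas ru|].
  by apply: ae_imply2 iv iu => x h1 h2 _; rewrite h1// h2.
have e := coef_solution_unique d0 d1 sv su e0 ht.
have [_ _ [_ au _]] := inG_has_coefs d0 s3 (hhu t ht).1.
have [_ _ [_ av _]] := inG_has_coefs d0 s3 (hhv t ht).1.
rewrite e in av.
by move: (synth _) au av => g au av; apply: ae_imply2 au av => x h1 h2 _; rewrite h1// h2.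
Qed.

End NormsUniqueness.

(** * Existence *)

Section Existence.
Context {R : realType}.
Implicit Types (k j l : int) (f g : R -> R[i]) (a b : int -> R[i]).
Local Notation mu := (@lebesgue_measure R).

(** Room at a point of the open disk: passing from weighted supremum bounds to norms costs
   some radius ([d1]), and differentiating in time needs a smaller disk ([p]). *)
Lemma radius_room (L d x : R) : 0 < L -> d < 1 -> 0 <= x -> x < L^-1 * (1 - d) ->
  exists d1 p, [/\ d < d1, d1 < 1, 0 < p, x < p & L / (1 - d1) * p < 1].
Proof.
move=> L0 d1 x0; rewrite [L^-1 * _]mulrC ltr_pdivlMr// => hx.
pose p := (x + (1 - d) / L) / 2.
have hp : p * L = (x * L + (1 - d)) / 2 by rewrite /p; field; exact: lt0r_neq0.
have xL : 0 <= x * L by rewrite mulr_ge0// ltW.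
(* both the point and the radius are chosen as midpoints *)
exists (d + ((1 - d) - p * L) / 2), p; split.
- by rewrite hp; lra.
- by rewrite hp; lra.
- by rewrite /p divr_gt0// ltr_wpDl// divr_gt0// subr_gt0.
- by rewrite -(ltr_pM2r L0) hp; lra.
- rewrite mulrAC ltr_pdivrMr; last by rewrite hp; lra.
  by rewrite mulrC mul1r hp; lra.
Qed.

Lemma wbound_expw (d A : R) a k : wbound d A a -> normc (a k) <= A * expw d k.
Proof.
move=> h; apply: le_trans (h k) _; rewrite /wgt mulrA.
apply: ler_wpM2r; first exact/ltW/expw_gt0.
rewrite -[leRHS]mulr1; apply: ler_wpM2l; [exact: wbound_ge0 h|exact: bracketXV_le1].
Qed.

Lemma inG_synth (d s d1 A : R) a : 0 < d1 -> d < d1 -> wbound d1 A a -> inG d s (synth a).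
Proof.
move=> d10 dd h; have [M hM] := exp_decay_zasum (wbound_exp_decay d10 h).
split; first by apply: bounded_L2;
  [exact: synth_periodic|exact: Cmeas_synth hM|exact: Cbounded_synth hM].
have [C C0 hC] := @Gnorm_le R d s d1 dd.
apply: le_lt_trans (hC _ A (wbound_ge0 h) _) (ltry _) => k.
by rewrite (fcoef_synth k hM); exact: wbound_expw.
Qed.

Section existence.
Variables (a : int -> R[i]) (r : R).
Hypotheses (r0 : 0 < r) (ha : wbound 1 r a).
Let L := Tconst * r.
Let L0 : 0 < L. Proof. by rewrite mulr_gt0// Tconst_gt0. Qed.

Definition flow t : R -> R[i] := synth (Useries a t).

(** Near [t] the series is controlled at some radius [d' > d], and [Gnorm_le] converts the
   weighted supremum bounds into bounds for [Gnorm]. *)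
Lemma flow_deriv (d s : R) t : 0 < d -> d < 1 -> normc t < L^-1 * (1 - d) ->
  [/\ exp_decay (Useries a t), exp_decay (dUseries a t), inG d s (flow t),
      (forall k, dUseries a t k = Q (Useries a t) (Useries a t) k) &
      Gderiv d s flow t (synth (dUseries a t))].
Proof.
move=> d0 d1 ht.
have [d' [p [dd' d'1 p0 tp hp]]] := radius_room L0 d1 (normc_ge0 t) ht.
have d'0 : 0 < d' by exact: lt_trans dd'.
have K0 : 0 < L / (1 - d') by rewrite divr_gt0// subr_gt0.
have small z : normc z <= p -> L / (1 - d') * normc z < 1.
  by move=> hz; apply: le_lt_trans hp; apply: ler_wpM2l hz; exact: ltW.
have Ub z : normc z <= p -> wbound d' (r / (1 - L / (1 - d') * normc z)) (Useries a z).
  by move=> hz; exact: (Useries_wbound r0 ha d'0 d'1 (small z hz)).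
have dUb := dUseries_wbound r0 ha d'0 d'1 (small t (ltW tp)).
have Ue z : normc z <= p -> exp_decay (Useries a z) by move=> hz; exact: wbound_exp_decay d'0 (Ub z hz).
have dUe := wbound_exp_decay d'0 dUb.
split.
- exact: Ue (ltW tp).
- exact: dUe.
- exact: inG_synth d'0 dd' (Ub t (ltW tp)).
- by move=> k; exact: (dUseries_Q r0 ha d'0 d'1 k (small t (ltW tp))).
split; first exact: inG_synth d'0 dd' dUb.
move=> e e0; have [C C0 hC] := @Gnorm_le R d s d' dd'.
pose N := r / p ^+ 2 / (1 - L / (1 - d') * p).
have N0 : 0 < N.
  by rewrite /N divr_gt0 ?subr_gt0// divr_gt0// exprn_gt0.
exists (Num.min (p - normc t) (e / (C * N))).
  by rewrite lt_min subr_gt0 tp divr_gt0// mulr_gt0.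
move=> h h0; rewrite lt_min => /andP[h1 h2].
have hth : normc (t + h) <= p by apply: le_trans (le_normcD _ _) _; lra.
have hD := Useries_deriv r0 ha d'0 d'1 p0 (ltW tp) hth hp h0.
have hr := has_coefsB (has_coefsZ h^-1 (has_coefsB (has_coefs_synth (Ue _ hth)) (has_coefs_synth
  (Ue _ (ltW tp))))) (has_coefs_synth dUe).
apply: le_lt_trans (hC _ (normc h * N) _ _) _.
- by rewrite mulr_ge0 ?normc_ge0// ltW.
- by move=> k; rewrite (has_coefs_fcoef k hr); exact: wbound_expw hD.
by rewrite lte_fin mulrCA -ltr_pdivlMr// mulr_gt0.
Qed.

Lemma flow_solution (d s : R) (u0 : R -> R) : 0 < d -> d < 1 -> has_coefs (realfun u0) a ->
  holomorphic_solution d s (L^-1 * (1 - d)) u0 flow.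
Proof.
move=> d0 d1 hu0; split.
  move=> t ht; have [_ _ h _ h'] := flow_deriv s d0 d1 ht; split => //.
  by exists (synth (dUseries a t)).
split.
  have [_ h _] := hu0; apply: ae_imply1 h => x h /= _; rewrite h// /flow.
  by congr synth; apply/funext => k; rewrite Useries0.
move=> t ht; have [eU edU h hQ h'] := flow_deriv s d0 d1 ht.
exists (synth (dUseries a t)) => //.
have hr := has_coefsD (has_coefs_synth edU) (has_coefs_equation (has_coefs_synth eU)).
have {}hr := eq_has_coefs hr (fun x => addrA _ _ _).
by apply: (has_coefs0_ae hr) => k; rewrite hQ subrr.
Qed.

(** For real times the coefficients stay Hermitian, hence the sum of the Fourier series equals
   its conjugate. *)
Lemma flow_real (d : R) (t : R) : 0 < d -> d < 1 -> hermitian a -> `|t| < L^-1 * (1 - d) ->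
  forall x, complex.Im (flow t%:C x) = 0.
Proof.
move=> d0 d1 H; rewrite -normcR => ht x.
have [d' [p [dd' d'1 p0 tp hp]]] := radius_room L0 d1 (normc_ge0 t%:C) ht.
have d'0 : 0 < d' by exact: lt_trans dd'.
have small : L / (1 - d') * normc t%:C < 1.
  apply: lt_trans hp; rewrite ltr_pM2l// divr_gt0// subr_gt0//.
have hH := Useries_hermitian r0 ha d'0 d'1 H small.
have [M hM] := exp_decay_zasum (wbound_exp_decay d'0 (Useries_wbound r0 ha d'0 d'1 small)).
have hM' : zasum (fun k => Useries a t%:C k * fexp k x) M.
  move=> s us; under eq_bigr do rewrite normcM normc_fexp mulr1.
  exact: hM.
have e : conjc (flow t%:C x) = flow t%:C x.
  rewrite /flow /synth -(zsum_reflect hM'); congr zsum; apply/funext => k.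
  by rewrite conjcM hH fexpN !conjcK.
by move: e; case: (flow t%:C x) => p1 p2 /= [] e; lra.
Qed.

End existence.

Lemma circ_int_conj f : Cintble f -> circ_int (fun x => conjc (f x)) = conjc (circ_int f).
Proof.
move=> [hr hi]; rewrite /circ_int /=; congr (_ +i* _).
  by apply: eq_Rintegral => x _; case: (f x).
rewrite -[RHS]mulN1r -RintegralZl//.
by apply: eq_Rintegral => x _; case: (f x) => p q; rewrite mulN1r.
Qed.

Lemma hermitian_fcoef (u : R -> R) : L2circle (realfun u) -> hermitian (fcoef (realfun u)).
Proof.
move=> h k; have ci : Cintble (fun x => realfun u x * fexp (- k) x).
  apply: CintbleM (L2_Cintble h) _ _; last exact: Cbounded_fexp.
    by have [_ mr mi _] := h.
  exact: Cmeas_fexp.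
rewrite /fcoef -circ_int_conj//; congr circ_int; apply/funext => x.
by rewrite fexpN rmorphM /=; congr (_ * _); rewrite /realfun /= oppr0.
Qed.

Lemma Gnorm_eq0 (d s : R) (u : R -> R) : 0 < d -> 3 <= s -> inG d s (realfun u) ->
  fine (Gnorm d s (realfun u)) = 0 -> u = (fun=> 0) %[ae mu].
Proof.
move=> d0 s3 hG hg; have [L2 fG] := hG; have [A hA hr] := inG_has_coefs d0 s3 hG.
have fin : Gnorm d s (realfun u) \is a fin_num by rewrite ge0_fin_numE// Gnorm_ge0.
have h0 : (Gnorm d s (realfun u) <= 0%:E)%E by rewrite -(fineK fin) hg.
have hb := Gnorm_wbound s3 h0.
have hz k : fcoef (realfun u) k = 0.
  by apply/eqP; rewrite -normc_eq0 eq_le normc_ge0 andbT; have := hb k; rewrite mulr0 mul0r.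
have := has_coefs0_ae hr hz; apply: ae_imply1 => x h hx; have := h hx.
by rewrite /realfun => -[].
Qed.

End Existence.

Theorem theorem18 (R : realType) (s : R) (hs : 1 / 2 < s) :
  exists2 c : R, 0 < c &
  forall u0 : R -> R, inG 1 (s + 3) (realfun u0) ->
  exists T : R,
    [/\ 0 < T,
        (~ (u0 = (fun=> 0) %[ae lebesgue_measure]) ->
           T = c / fine (Gnorm 1 (s + 3) (realfun u0))) &
        forall delta : R, 0 < delta -> delta < 1 ->
        exists u : R[i] -> R -> R[i],
          [/\ holomorphic_solution delta (s + 3) (T * (1 - delta)) u0 u,
              (forall t : R, `|t| < T * (1 - delta) ->
                 (fun x => complex.Im (u t%:C x)) = (fun=> 0)
                   %[ae lebesgue_measure]) &
              forall v : R[i] -> R -> R[i],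
                holomorphic_solution delta (s + 3) (T * (1 - delta)) u0 v ->
                forall t : R[i], normc t < T * (1 - delta) ->
                  v t = u t %[ae lebesgue_measure]]].
Proof.
have s3 : 3 <= s + 3 by lra.
exists (8 * Tconst)^-1; first by rewrite invr_gt0 mulr_gt0 ?Tconst_gt0.
move=> u0 hG; have [L2 fG] := hG.
have [_ _ hr] := inG_has_coefs ltr01 s3 hG.
have fin : Gnorm 1 (s + 3) (realfun u0) \is a fin_num by rewrite ge0_fin_numE// Gnorm_ge0.
pose G := fine (Gnorm 1 (s + 3) (realfun u0)).
have G0 : 0 <= G by rewrite fine_ge0// Gnorm_ge0.
have hb : wbound 1 (8 * G) (fcoef (realfun u0)).
  by apply: (Gnorm_wbound s3); rewrite /G fineK.
have hH := hermitian_fcoef L2.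
(* for a null datum any positive [r] bounds the coefficients, which all vanish *)
pose r := if G == 0 then 1 else 8 * G.
have r0 : 0 < r.
  by rewrite /r; case: (eqVneq G 0) => // Gn; rewrite mulr_gt0// lt_neqAle eq_sym Gn.
have hbr : wbound 1 r (fcoef (realfun u0)).
  by apply: (wboundW (lexx 1) _ hb); rewrite /r; case: (eqVneq G 0) => // ->; rewrite mulr0.
have K0 : 0 < Tconst :> R by exact: Tconst_gt0.
have T0 : 0 < (Tconst * r)^-1 by rewrite invr_gt0 mulr_gt0.
exists (Tconst * r)^-1; split => //.
  move=> un; have Gn : G != 0 by apply/eqP => /(Gnorm_eq0 ltr01 s3 hG).
  by rewrite /r (negbTE Gn) -/G -invfM; congr (_^-1); ring.
move=> d d0 d1; exists (flow (fcoef (realfun u0))).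
have sol := flow_solution r0 hbr (s + 3) d0 d1 hr.
split => //.
  move=> t ht; apply: ae_forall => x _; exact: (flow_real r0 hbr d0 d1 hH ht).
move=> v hv t ht; apply: (solution_unique d0 (ltW d1) s3 _ sol hv ht).
by rewrite mulr_gt0// subr_gt0.
Qed.
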